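(* Let $\mu$ be doubling and let $X$ be a quasi-Banach function lattice over $(\mathcal P,\mu)$. Assume that $\mathcal P$ is locally compact and supports a $p$-Poincaré inequality and let $s$ be such that the dimension condition holds with exponent $s$. Suppose that one of the following sets of assumptions is satisfied: (a) $1\le s<p\le q$ and $X\hookrightarrow L^q_{\mathrm{loc}}$; (b) $1=p=s$ and $X\hookrightarrow L^s(\log L)^\alpha_{\mathrm{loc}}$ for some $\alpha\ge1$; (c) $1<p=s$ and $X\hookrightarrow L^s(\log L)^\alpha_{\mathrm{loc}}$ for some $\alpha>1$; (d) $1\le p<s$ and $X\hookrightarrow L^{s,1}_{\mathrm{loc}}$. Then every $u\in N^1X$ is continuous.
   Context: Setting. $\mathcal P=(\mathcal P,\mathrm d,\mu)$ is a metric space with a $\sigma$-finite Borel regular measure $\mu$ (all Borel sets are $\mu$-measurable, and every $\mu$-measurable set $A$ is contained in a Borel set $D$ with $\mu(D)=\mu(A)$) such that every ball has finite positive measure. A ball $B=B(x,r)$ is open and comes with its center and radius; $\lambda B=B(x,\lambda r)$. $u_B=\mu(B)^{-1}\int_Bu\,d\mu$. $\mathcal M(\mathcal P,\mu)$ is the set of all extended real-valued $\mu$-measurable functions on $\mathcal P$ (defined everywhere, not up to equality a.e.). Continuous functions are understood to be real-valued. Quasi-Banach function lattice: a linear space $X=\{u\in\mathcal M(\mathcal P,\mu):\|u\|_X<\infty\}$ given by a functional $\|\cdot\|_X:\mathcal M(\mathcal P,\mu)\to[0,\infty]$ such that: $\|u\|_X=0$ iff $u=0$ a.e.; $\|au\|_X=|a|\,\|u\|_X$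 for $a\in\mathbb R$; there is a constant $c_\triangle\ge1$ with $\|u+v\|_X\le c_\triangle(\|u\|_X+\|v\|_X)$; if $|u|\le|v|$ a.e. then $\|u\|_X\le\|v\|_X$; and (Riesz--Fischer) if $u_n\ge0$ a.e. for all $n$ then $\|\sum_{n=1}^\infty u_n\|_X\le\sum_{n=1}^\infty c_\triangle^n\|u_n\|_X$. The quasi-norm is also assumed continuous: $\|u_n-u\|_X\to0$ implies $\|u_n\|_X\to\|u\|_X$. Newtonian space. A curve is a non-constant continuous map $\gamma$ from a compact interval into $\mathcal P$ of finite length, parametrized by arc length $ds$ on $[0,l_\gamma]$. A Borel function $g:\mathcal P\to[0,\infty]$ is an upper gradient of $u:\mathcal P\to[-\infty,\infty]$ if $|u(\gamma(0))-u(\gamma(l_\gamma))|\le\int_\gamma g\,ds$ for every curve $\gamma$, with the convention $|(\pm\infty)-(\pm\infty)|=\infty$. Set $\|u\|_{N^1X}=\|u\|_X+\inf_g\|g\|_X$, infimum over all upper gradients $g$ of $u$, and $N^1X=\{u\in\mathcal M(\mathcal P,\mu):\|u\|_{N^1X}<\infty\}$. Doubling: there is $c_{\mathrm{dbl}}\ge1$ with $\mu(2B)\le c_{\mathrm{dbl}}\mu(B)$ for every ball $B$. Dimension condition with exponent $s>0$: there is $c_s>0$ with $\mu(B(y,r))/\mu(B(x,R))\ge c_s(r/R)^s$ whenever $0<r\le R$, $x\in\mathcal P$, $y\in B(x,R)$. $p$-Poincaré inequality ($p\in[1,\infty)$): there are $c_{\mathrm{PI}}>0$ and $\lambda\ge1$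 such that $\frac1{\mu(B)}\int_B|u-u_B|\,d\mu\le c_{\mathrm{PI}}\,\mathrm{diam}(B)\bigl(\frac1{\mu(\lambda B)}\int_{\lambda B}g^p\,d\mu\bigr)^{1/p}$ for all balls $B$, all $u\in L^1_{\mathrm{loc}}(\mathcal P)$ and all upper gradients $g$ of $u$. Function spaces. The decreasing rearrangement is $f^*(t)=\inf\{\tau\ge0:\mu(\{|f|>\tau\})\le t\}$. Zygmund: for $p\ge1$, $\alpha\ge0$, $\mu(E)<\infty$, $\|u\|_{L^p(\log L)^\alpha(E)}^p=\int_0^{\mu(E)}\bigl(u^*(t)(1+\log\frac{\mu(E)}t)^\alpha\bigr)^p\,dt$. Lorentz: $\|u\|_{L^{p,1}}=\frac1p\int_0^\infty u^*(t)t^{1/p-1}\,dt$ for $1\le p<\infty$. $X\hookrightarrow Y_{\mathrm{loc}}$ means: for every ball $B$ there is $c_{\mathrm{emb}}(B)>0$ with $\|u\chi_B\|_{Y}\le c_{\mathrm{emb}}(B)\|u\chi_B\|_X$ for all $u\in\mathcal M(\mathcal P,\mu)$ (where the norm of $u\chi_B$ is taken in $Y(B)$ for $Y=L^s(\log L)^\alpha$). *)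

(* Defs.v *)
From HB Require Import structures.
From mathcomp Require Import all_boot all_order all_algebra.
From mathcomp Require Import all_classical all_reals all_analysis.
From mathcomp Require Import measurable_realfun.

Set Implicit Arguments.
Unset Strict Implicit.
Unset Printing Implicit Defensive.

Import Order.TTheory GRing.Theory Num.Theory.
Import numFieldNormedType.Exports.

Local Open Scope classical_set_scope.
Local Open Scope ring_scope.
Local Open Scope ereal_scope.

(* A metric space carrying a sigma-algebra, that of the mu-measurable sets;
   it is related to the Borel sets by [borel_regular] below. *)
#[short(type="measurableMetricType")]
HB.structure Definition MeasurableMetric (R : numDomainType) (d : measure_display) :=
  { T of Metric R T & Measurable d T }.

Section Space.
Context (R : realType) (d : measure_display) (P : measurableMetricType R d).
Variable mu : {measure set P -> \bar R}.

Definition borel_set (A : set P) : Prop := <<s @open P >> A.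

Definition borel_fun (g : P -> \bar R) : Prop :=
  @measurable_fun _ _ (g_sigma_algebraType (@open P)) (\bar R) setT g.

Definition borel_regular : Prop :=
  (forall A : set P, borel_set A -> measurable A) /\
  (forall A : set P, measurable A ->
     exists D : set P, [/\ borel_set D, A `<=` D & mu D = mu A]).

Definition balls_finite_positive : Prop :=
  forall (x : P) (r : R), (0 < r)%R -> 0 < mu (ball x r) < +oo.

Definition doubling : Prop :=
  exists2 c : R, (1 <= c)%R &
    forall (x : P) (r : R), (0 < r)%R ->
      mu (ball x (2 * r)%R) <= c%:E * mu (ball x r).

Definition dimension_condition (s : R) : Prop :=
  exists2 c : R, (0 < c)%R &
    forall (x y : P) (r r' : R), (0 < r <= r')%R -> ball x r' y ->
      (c * (r / r') `^ s)%:E <= mu (ball y r) / mu (ball x r').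

(* length of gamma restricted to [a, b] *)
Definition curve_length (a b : R) (gamma : R -> P) : \bar R :=
  ereal_sup [set (\sum_(0 <= i < size t)
      mdist (gamma (nth b (a :: t) i)) (gamma (nth b (a :: t) i.+1)))%:E
    | t in itv_partition a b].

(* gamma, restricted to [0, l], is a curve parametrized by arc length; such a
   curve has length l, so it is non-constant iff 0 < l *)
Record arc_length_curve (l : R) (gamma : R -> P) : Prop := ArcLengthCurve {
  curve_pos : (0 < l)%R ;
  curve_continuous : {within `[0%R, l], continuous gamma} ;
  curve_arc_length : forall t : R, (0 <= t <= l)%R ->
    curve_length 0 t gamma = t%:E }.

(* In [\bar R], +oo - +oo = -oo - -oo = -oo, so that the absolute value below is
   +oo whenever it involves a difference of equal infinities. *)
Record upper_gradient (u g : P -> \bar R) : Prop := UpperGradient {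
  upper_gradient_borel : borel_fun g ;
  upper_gradient_ge0 : forall x, 0 <= g x ;
  upper_gradient_le : forall (l : R) (gamma : R -> P), arc_length_curve l gamma ->
    `|u (gamma 0%R) - u (gamma l)|
      <= \int[lebesgue_measure]_(t in `[0%R, l]) g (gamma t) }.

(* The functional is only constrained on mu-measurable functions.  Sums of
   functions taking infinite values of opposite signs use the convention
   +oo + -oo = -oo of [\bar R]. *)
Record quasi_banach_function_lattice_with (c : R) (nX : (P -> \bar R) -> \bar R)
    : Prop := QuasiBanachFunctionLatticeWith {
  nX_ge0 : forall u, measurable_fun setT u -> 0 <= nX u ;
  nX_eq0 : forall u, measurable_fun setT u ->
    nX u = 0 <-> {ae mu, forall x, u x = 0} ;
  nX_scale : forall (a : R) u, measurable_fun setT u ->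
    nX (fun x => a%:E * u x) = `|a|%:E * nX u ;
  nX_triangle : forall u v, measurable_fun setT u -> measurable_fun setT v ->
    nX (u \+ v) <= c%:E * (nX u + nX v) ;
  nX_lattice : forall u v, measurable_fun setT u -> measurable_fun setT v ->
    {ae mu, forall x, `|u x| <= `|v x|} -> nX u <= nX v ;
  (* the series makes sense almost everywhere only *)
  nX_riesz_fischer : forall (u : nat -> P -> \bar R) (v : P -> \bar R),
    (forall n, measurable_fun setT (u n)) -> measurable_fun setT v ->
    (forall n, {ae mu, forall x, 0 <= u n x}) ->
    {ae mu, forall x, v x = \sum_(1 <= n <oo) u n x} ->
    nX v <= \sum_(1 <= n <oo) (c ^+ n)%:E * nX (u n) ;
  nX_continuous : forall (u : nat -> P -> \bar R) (v : P -> \bar R),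
    (forall n, measurable_fun setT (u n)) -> measurable_fun setT v ->
    nX (u n \- v) @[n --> \oo] --> 0 -> nX (u n) @[n --> \oo] --> nX v }.

Definition quasi_banach_function_lattice (nX : (P -> \bar R) -> \bar R) : Prop :=
  exists2 c : R, (1 <= c)%R & quasi_banach_function_lattice_with c nX.

Definition newtonian_norm (nX : (P -> \bar R) -> \bar R) (u : P -> \bar R) : \bar R :=
  nX u + ereal_inf [set nX g | g in upper_gradient u].

Definition newtonian (nX : (P -> \bar R) -> \bar R) (u : P -> \bar R) : Prop :=
  measurable_fun setT u /\ newtonian_norm nX u < +oo.

Definition average (B : set P) (u : P -> \bar R) : \bar R :=
  (mu B)^-1 * \int[mu]_(x in B) u x.

Definition diam (A : set P) : \bar R :=
  ereal_sup [set (mdist z.1 z.2)%:E | z in A `*` A].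

(* L^1_loc, where "loc" means "on every ball", as for embeddings *)
Definition integrable_on_balls (u : P -> \bar R) : Prop :=
  measurable_fun setT u /\
  forall (x : P) (r : R), (0 < r)%R -> mu.-integrable (ball x r) u.

Definition poincare (p : R) : Prop :=
  exists c lambda : R, [/\ (0 < c)%R, (1 <= lambda)%R &
    forall (x : P) (r : R) (u g : P -> \bar R), (0 < r)%R ->
      integrable_on_balls u -> upper_gradient u g ->
      average (ball x r) (fun y => `|u y - average (ball x r) u|)
        <= c%:E * diam (ball x r) *
           average (ball x (lambda * r)%R) (fun y => g y `^ p) `^ p^-1].

(* rearrangement of the restriction of u to E *)
Definition rearrangement (E : set P) (u : P -> \bar R) (t : R) : \bar R :=
  ereal_inf [set tau%:E | tau in
    [set tau : R | (0 <= tau)%R /\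
                   mu (E `&` [set x | tau%:E < `|u x|]) <= t%:E]].

(* norm of L^p (log L)^alpha (E), for E of finite measure *)
Definition zygmund_norm (p alpha : R) (E : set P) (u : P -> \bar R) : \bar R :=
  let m := fine (mu E) in
  (\int[lebesgue_measure]_(t in `]0%R, m[)
     (rearrangement E u t * ((1 + ln (m / t)) `^ alpha)%:E) `^ p) `^ p^-1.

(* norm of L^{p,1} *)
Definition lorentz_norm (p : R) (u : P -> \bar R) : \bar R :=
  (p^-1)%:E * \int[lebesgue_measure]_(t in `]0%R, +oo[)
    (rearrangement setT u t * (t `^ (p^-1 - 1))%:E).

(* X embeds into Y_loc; the norm nY B of Y may depend on the ball B *)
Definition embeds_loc (nX : (P -> \bar R) -> \bar R)
    (nY : set P -> (P -> \bar R) -> \bar R) : Prop :=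
  forall (x : P) (r : R), (0 < r)%R ->
    exists2 c : R, (0 < c)%R &
      forall u : P -> \bar R, measurable_fun setT u ->
        let uB := fun y => u y * (\1_(ball x r) y)%:E in
        nY (ball x r) uB <= c%:E * nX uB.

End Space.

(* Main.v *)
(* Each of the four embeddings controls the measure of the superlevel sets of a
   function f with finite norm so well that, uniformly for y near x0, the L^p
   averages of f over the balls B(y, 2^-j) are at most S_j with
   sum_j 2^-j S_j finite.  For f = g, an upper gradient of u, the Poincare
   inequality bounds the mean oscillation of u over B(y, 2^-j) by a multiple of
   2^-j S_j, and telescoping over j shows that the averages of u converge
   locally uniformly to a continuous function f, which equals u outside a
   null set N.

   To get u(x0) = f(x0) at a non-isolated point x0, choose by a
   Vitali-Caratheodory argument a lower semicontinuous h >= g with h = +oo on N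
   near x0, whose averages over B(x0, 2^-j) still satisfy the same kind of
   bound.  Let F be the complement of a small ball around x0 and let C be the
   infimum of the integrals of h along curves from x0 to F.  Then C is finite:
   otherwise, as local compactness makes this infimum lower semicontinuous in
   the starting point, its truncations at height one, scaled by 1/k, would be
   near 1 around x0 and 0 on F although their upper gradient is h/k,
   contradicting the Poincare inequality for large k.  Hence h is integrable
   along some curve starting at x0.  This curve meets N in a set of zero length,
   and u is continuous along it at x0, so u(x0) is the limit of values of f. *)

Require Import Defs.
From HB Require Import structures.
From mathcomp Require Import all_boot all_order all_algebra.
From mathcomp Require Import all_classical all_reals all_analysis.
From mathcomp Require Import measurable_realfun.
From mathcomp Require Import ess_sup_inf ring lra.
Set Implicit Arguments.
Unset Strict Implicit.
Unset Printing Implicit Defensive.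
Import Order.TTheory GRing.Theory Num.Theory.
Import numFieldNormedType.Exports.
Local Open Scope classical_set_scope.
Local Open Scope ring_scope.

(** The scale of the estimates is 2^-s: by the dimension condition B(y, r 2^-j) has measure at least
    m 2^(-js) with m independent of y. In the Zygmund and Lorentz cases, levels tau_i are chosen
    with {|f| > tau_i} of measure at most m 2^(-is); the average over the j-th ball is then governed
    by the tail from j on of the series of m 2^(-is) tau_i^p, and finiteness of the norm is a
    weighted summability of the tau_i.

    Averages see u only almost everywhere, and an upper gradient says nothing along a curve on which
    its integral is infinite; hence the search for one good curve at each point. The test function
    in the Poincare inequality has to be measurable, which is not evident for an infimum over
    curves. Lower semicontinuity gives this, and also makes the test function large near x0. It
    rests on compactness of cheap paths: since h >= 1, the cost of a path bounds its duration.

    Enlarging g to h adds j + 4 to the bound of the j-th average, which is harmless because the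
    series of 2^-j (j + 4) converges. For h only balls centred at x0 are controlled, and this
    suffices. *)

(** The integral of a non-negative function is a supremum over the simple functions below it, hence
    monotone for arbitrary functions. This serves integrands along curves whose measurability is not
    at hand. *)
Lemma ge0_le_integral_nomeas d (T : measurableType d) (R : realType)
    (mu : {measure set T -> \bar R}) (D : set T) (f g : T -> \bar R) :
  (forall x, D x -> 0 <= f x)%E -> (forall x, D x -> f x <= g x)%E ->
  (\int[mu]_(x in D) f x <= \int[mu]_(x in D) g x)%E.
Proof.
move=> f0 fg.
have g0 x : D x -> (0 <= g x)%E by move=> Dx; rewrite (le_trans (f0 _ Dx)) ?fg.
rewrite !ge0_integralE//; apply: ge_ereal_sup => _ [h/= hf <-].
apply: ereal_sup_ubound; exists h => //= x; rewrite (le_trans (hf x))//.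
by rewrite /patch; case: ifPn => // /set_mem /fg.
Qed.

(** * Curves *)

Section contraction_integral.
Context {R : realType}.
Notation leb := (@lebesgue_measure R).
Implicit Types phi : R -> R.

Definition contraction phi := forall x y, `|phi x - phi y| <= `|x - y|.

Lemma contraction_continuous phi : contraction phi -> continuous phi.
Proof.
move=> phiL x; apply/cvgrPdist_lt => e e0; near=> y.
by rewrite (le_lt_trans (phiL _ _))//; near: y; apply: cvgr_dist_lt.
Unshelve. all: by end_near. Qed.

(** A contraction maps an interval of length L into the closed interval of length L centred at the
    image of the midpoint, so each cover of S by intervals yields a cover of A of the same total
    length. *)
Lemma contraction_lebesgue_le phi (A S : set R) : contraction phi ->
  measurable A -> measurable S -> A `<=` phi @` S -> (leb A <= leb S)%E.
Proof.
move=> phiL mA mS AS; apply: le_ereal_inf_tmp => _ [F [mF SF] <-].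
have [I IE] : exists I : nat -> R * R, forall k, F k = `](I k).1, (I k).2]%classic.
  have /(_ _)/cid2 := mF _ => C.
  by exists (fun k => s2val (C k)) => k; case: (C k).
have FE k : F k `<=` `](I k).1, (I k).2]%classic by rewrite IE.
pose c k := ((I k).1 + (I k).2) / 2.
pose J k : set R := if (I k).1 < (I k).2 then
  `[phi (c k) - ((I k).2 - (I k).1) / 2, phi (c k) + ((I k).2 - (I k).1) / 2]%classic else set0.
have AJ : A `<=` \bigcup_k J k.
  move=> x /AS[t /SF[k _ /FE]] /=; rewrite in_itv/= => /andP[It tI] <-.
  exists k => //; rewrite /J (lt_le_trans It tI)/= in_itv/=.
  have := phiL t (c k); rewrite ler_norml => /andP[].
  have : `|t - c k| <= ((I k).2 - (I k).1) / 2.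
    by rewrite ler_norml /c; apply/andP; split; lra.
  by move=> ? ? ?; apply/andP; split; lra.
have mJ k : measurable (J k) by rewrite /J; case: ifPn.
apply: (@le_trans _ _ (\sum_(k <oo) leb (J k))%E).
  exact: measure_sigma_subadditive.
apply: lee_nneseries => // k _.
rewrite IE /J; set W := (X in (_ <= X)%E).
have -> : W = (if ((I k).1 < (I k).2)%R then ((I k).2 - (I k).1)%:E else 0%E).
  exact: (etrans (wlength_itv idfun `](I k).1, (I k).2])).
case: ifPn => [I12|]; last by rewrite measure0.
rewrite lebesgue_measure_itv/= lte_fin ifT; last by lra.
by rewrite -EFinB lee_fin; lra.
Qed.

(** One half of a change of variables: by the preceding lemma, Lebesgue measure on [c, d] is
    dominated by the push-forward under [phi] of Lebesgue measure on [a, b]. *)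
Lemma contraction_integral phi (a b c d : R) (H : R -> \bar R) : contraction phi ->
  `[c, d] `<=` phi @` `[a, b] -> measurable_fun (setT : set (measurableTypeR R)) H ->
  (forall x, 0 <= H x)%E ->
  (\int[leb]_(x in `[c, d]) H x <= \int[leb]_(x in `[a, b]) H (phi x))%E.
Proof.
move=> phiL cd mH H0.
have mphi : measurable_fun setT (phi : measurableTypeR R -> measurableTypeR R).
  by apply: continuous_measurable_fun; exact: contraction_continuous.
(* The value c - 1 lies outside [c, d], so the push-forward of Lebesgue measure on the whole line
   charges [c, d] only through [a, b]. *)
pose psi x := if x \in `[a, b] then phi x else c - 1.
have mpsi : measurable_fun setT (psi : measurableTypeR R -> measurableTypeR R).
  apply: measurable_fun_ifT => //.
  apply: (measurable_fun_bool true); rewrite setTI.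
  have -> : (fun t => t \in `[a, b]) @^-1` [set true] = `[a, b]%classic.
    by apply/seteqP; split => x.
  exact: measurable_itv.
have mpre (S : set R) : measurable S -> measurable (psi @^-1` S).
  by move=> mS; rewrite -[X in measurable X]setTI; apply: mpsi.
have mcd : measurable (`[c, d]%classic : set R) by [].
pose m1 := [the measure _ _ of mrestr leb mcd].
pose m2' := [the measure _ _ of pushforward leb
  (psi : measurableTypeR R -> measurableTypeR R)].
pose m2 := m2' mpsi.
have -> : (\int[leb]_(x in `[c, d]) H x = \int[m1]_(x in `[c, d]) H x)%E.
  by apply: eq_measure_integral => A mA Acd; rewrite /m1/= /mrestr setIidl.

have le12 : (\int[m1]_(x in `[c, d]) H x <= \int[m2]_(x in `[c, d]) H x)%E.
  apply: ge0_le_measure_integral => // S mS.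
  rewrite /m1 /m2 /m2'/= /mrestr /pushforward.
  have mT : measurable (`[a, b] `&` phi @^-1` (S `&` `[c, d]) : set R).
    apply: measurableI => //; rewrite -[X in measurable X]setTI.
    by apply: mphi => //; exact: measurableI.
  apply: (@le_trans _ _ (leb (`[a, b] `&` phi @^-1` (S `&` `[c, d])))).
    apply: (contraction_lebesgue_le phiL) => //; first exact: measurableI.
    by move=> x [Sx cdx]; have [t abt tx] := cd _ cdx; exists t; rewrite //= tx.
  apply: le_measure; rewrite ?inE//.
    exact: mpre.
  by move=> x /= [abx [Sx _]]; rewrite /psi abx.
apply: (le_trans le12).
rewrite ge0_integral_pushforward//; last exact: measurable_funTS.
have E : psi @^-1` `[c, d] = `[a, b] `&` phi @^-1` `[c, d].
  apply/seteqP; split=> x /=; rewrite /psi; last by move=> [-> ].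
  case: ifPn => // _; rewrite !in_itv/= => /andP[]; lra.
have mE : measurable (psi @^-1` `[c, d]) by exact: mpre.
apply: (@le_trans _ _ (\int[leb]_(x in psi @^-1` `[c, d]) H (phi x))%E).
  apply: ge0_le_integral_nomeas => x; rewrite E => -[abx _] //=.
  by rewrite /psi ifT.
apply: ge0_subset_integral => //.
- by apply: measurable_funTS; apply: (measurableT_comp mH).
- by rewrite E; exact: subIsetl.
Qed.

End contraction_integral.

Section curves.
Context {R : realType} {d : measure_display} {P : measurableMetricType R d}.
Notation leb := (@lebesgue_measure R).
Implicit Types gamma : R -> P.

Definition lip1 gamma := forall x y, mdist (gamma x) (gamma y) <= `|x - y|.

Lemma lip1_continuous gamma : lip1 gamma -> continuous gamma.
Proof.
move=> gL x; apply/cvg_ballP => e e0; exists e => //= y xy.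
by rewrite ballEmdist/= (le_lt_trans (gL _ _)).
Qed.

(** The nearest-point projection onto [0, T]. Composing with it extends a path on [0, T] to the
    whole line by constants, so that Lipschitz bounds need no domain. *)
Definition clamp (T x : R) : R := Num.max 0 (Num.min T x).

Lemma clamp_itv T x : 0 <= T -> 0 <= clamp T x <= T.
Proof. by move=> T0; rewrite /clamp le_max lexx/= ge_max T0 ge_min lexx. Qed.

Lemma clamp_id T x : 0 <= x <= T -> clamp T x = x.
Proof. by case/andP=> x0 xT; rewrite /clamp min_r// max_r. Qed.

Lemma clamp_contraction T : contraction (clamp T).
Proof.
move=> x y; have := ler_norm (x - y); have := ler_norm (y - x).
rewrite distrC ler_norml => ? ?; rewrite /clamp /Num.max /Num.min.
by do ?case: ifPn; rewrite -?leNgt => *; apply/andP; split; lra.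
Qed.

Fixpoint chain_sum gamma (a : R) (t : seq R) : R :=
  if t is c :: t' then mdist (gamma a) (gamma c) + chain_sum gamma c t' else 0.

Lemma chain_sumE gamma a b t :
  \sum_(0 <= i < size t)
    mdist (gamma (nth b (a :: t) i)) (gamma (nth b (a :: t) i.+1))
  = chain_sum gamma a t.
Proof.
elim: t a => [|c t IH] a; first by rewrite big_nil.
by rewrite big_nat_recl//= -IH.
Qed.

Lemma chain_sum_cat gamma a s t :
  chain_sum gamma a (s ++ t) = chain_sum gamma a s + chain_sum gamma (last a s) t.
Proof. by elim: s a => [|c s IH] a /=; rewrite ?add0r// IH addrA. Qed.

Lemma chain_sum_le_length gamma a b t : itv_partition a b t ->
  ((chain_sum gamma a t)%:E <= curve_length a b gamma)%E.
Proof.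
by move=> abt; apply: ereal_sup_ubound; exists t => //; rewrite (chain_sumE _ _ b).
Qed.

Lemma curve_length_le gamma a b (M : \bar R) :
  (forall t, itv_partition a b t -> ((chain_sum gamma a t)%:E <= M)%E) ->
  (curve_length a b gamma <= M)%E.
Proof.
by move=> H; apply: ge_ereal_sup => _ [t abt <-]; rewrite chain_sumE; exact: H.
Qed.

Lemma mdist_le_length gamma a b : a <= b ->
  ((mdist (gamma a) (gamma b))%:E <= curve_length a b gamma)%E.
Proof.
rewrite le_eqVlt => /predU1P[<-|ab].
  rewrite mdistxx; apply: (@chain_sum_le_length _ _ _ [::]).
  by split => //=.
have := @chain_sum_le_length gamma a b [:: b]; rewrite /= addr0; apply.
exact: itv_partition1.
Qed.

Lemma curve_length_ge0 gamma a b : a <= b -> (0 <= curve_length a b gamma)%E.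
Proof.
by move=> ab; apply: le_trans (mdist_le_length gamma ab); rewrite lee_fin mdist_ge0.
Qed.

(** Partitions of [a, b] and [b, c] concatenate. When a > b there is no partition, the length is the
    supremum -oo of the empty set, and -oo absorbs every summand. *)
Lemma curve_length_superadd gamma a b c :
  (curve_length a b gamma + curve_length b c gamma <= curve_length a c gamma)%E.
Proof.
have H s : itv_partition a b s ->
    ((chain_sum gamma a s)%:E + curve_length b c gamma <= curve_length a c gamma)%E.
  move=> abs; rewrite addeC -leeBrDr//; apply: curve_length_le => t bct.
  rewrite leeBrDr// addeC -EFinD.
  have := itv_partition_cat abs bct.
  move=> /(chain_sum_le_length gamma); rewrite chain_sum_cat.
  by case: abs => _ /eqP ->.
have [->|bcNy] := eqVneq (curve_length b c gamma) -oo%E.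
  by rewrite addeNy leNye.
have [bcy|bcNy'] := eqVneq (curve_length b c gamma) +oo%E.
  have [->|/eqP abN] := eqVneq (curve_length a b gamma) -oo%E; first by rewrite leNye.
  suff -> : curve_length a c gamma = +oo%E by rewrite leey.
  have [s abs] : exists s, itv_partition a b s.
    apply: contrapT => /forallNP N; apply: abN.
    by apply/eqP; rewrite -leeNy_eq; apply: curve_length_le => t /N.
  by apply/eqP; rewrite -leye_eq; apply: le_trans (H s abs); rewrite bcy.
have fbc : (curve_length b c gamma \is a fin_num)%E by rewrite fin_numE bcNy.
rewrite -leeBrDr//; apply: curve_length_le => s abs.
by rewrite leeBrDr// H.
Qed.

Lemma lip1_curve_length_le gamma a b : lip1 gamma ->
  (curve_length a b gamma <= (b - a)%:E)%E.
Proof.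
move=> gL; apply: curve_length_le => t; rewrite lee_fin.
elim: t a => [|c t IH] a; first by move=> /itv_partition_nil ->; rewrite /= subrr.
move=> act; have /IH := itv_partition_cons act.
case: act => /= /andP[ac _] _; have := gL a c.
by rewrite ltr0_norm ?subr_lt0//; lra.
Qed.

(** The partition step that straddles b is cut at b, and all that follows b contributes at most c -
    b. This makes the arc length function of a 1-Lipschitz path 1-Lipschitz itself. *)
Lemma lip1_curve_length_split gamma a b c : lip1 gamma -> a <= b <= c ->
  (curve_length a c gamma <= curve_length a b gamma + (c - b)%:E)%E.
Proof.
move=> gL abc; apply: curve_length_le => t.
elim: t a abc => [|e t IH] a /andP[ab bc] act.
  have ac := itv_partition_nil act; subst c.
  have -> : b = a by apply/eqP; rewrite eq_le bc ab.
  by rewrite /= subrr adde0 curve_length_ge0.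
have ect := itv_partition_cons act.
have ae : a < e by case: act => /= /andP[].
have [eb|be] := leP e b.
  rewrite /= EFinD; apply: (@le_trans _ _ ((mdist (gamma a) (gamma e))%:E +
      (curve_length e b gamma + (c - b)%:E))%E).
    by rewrite leeD2lE// IH// eb.
  rewrite addeA leeD2r//; apply: le_trans (curve_length_superadd _ a e b).
  by rewrite leeD2r// mdist_le_length// ltW.
rewrite /=.
apply: (@le_trans _ _ ((mdist (gamma a) (gamma b))%:E + (c - b)%:E)%E).
  rewrite -EFinD lee_fin.
  have := metric_triangle (gamma a) (gamma b) (gamma e).
  have := gL b e; rewrite ltr0_norm ?subr_lt0//.
  have := chain_sum_le_length gamma ect.
  move=> /le_trans/(_ (lip1_curve_length_le _ _ gL)); rewrite lee_fin; lra.
by rewrite leeD2r// mdist_le_length.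
Qed.

Lemma arc_length_lip1 l gamma : arc_length_curve l gamma ->
  lip1 (gamma \o clamp l).
Proof.
case=> l0 _ gl.
have H x y : 0 <= x -> x <= y -> y <= l -> mdist (gamma x) (gamma y) <= y - x.
  move=> x0 xy yl; have := curve_length_superadd gamma 0 x y.
  rewrite gl ?x0 ?(le_trans xy)//= gl ?yl ?(le_trans x0)// => H.
  rewrite -lee_fin; apply: le_trans (mdist_le_length gamma xy) _.
  by rewrite EFinB leeBrDr// addeC.
move=> x y /=; apply: le_trans (clamp_contraction l x y).
have /andP[x0 xl] := clamp_itv x (ltW l0).
have /andP[y0 yl] := clamp_itv y (ltW l0).
have [xy|/ltW xy] := leP (clamp l x) (clamp l y).
  by rewrite distrC ger0_norm ?subr_ge0// H.
by rewrite metric_sym ger0_norm ?subr_ge0// H.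
Qed.

(** Upper gradients speak of arc length parametrizations, the cost of 1-Lipschitz maps; this is the
    way back. The new curve is [gamma \o psi] with [psi] a right inverse of the arc length function
    [len]. The choice of [psi] is immaterial, since [gamma] is constant wherever [len] is. As [len]
    is a contraction, [contraction_integral] compares the integrals. *)
Lemma lip1_arc_length_reparam gamma (T : R) : lip1 gamma -> 0 <= T ->
  gamma 0 <> gamma T ->
  exists l, exists gamma' : R -> P, [/\ arc_length_curve l gamma', lip1 gamma',
    gamma' 0 = gamma 0,
    (forall x, 0 <= x < l -> exists2 t, 0 <= t < T & gamma' x = gamma t) &
    forall H : P -> \bar R, (forall x, 0 <= H x)%E ->
      measurable_fun (setT : set (measurableTypeR R)) (H \o gamma') ->
      (\int[leb]_(x in `[0%R, l]) H (gamma' x) <=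
       \int[leb]_(x in `[0%R, T]) H (gamma x))%E].
Proof.
move=> gL T0 g0T.
have lenfin t : 0 <= t -> curve_length 0 t gamma \is a fin_num.
  move=> t0; rewrite ge0_fin_numE ?curve_length_ge0//.
  by apply: le_lt_trans (lip1_curve_length_le _ _ gL) _; rewrite ltry.
pose len t := fine (curve_length 0 t gamma).
have lenE t : 0 <= t -> curve_length 0 t gamma = (len t)%:E.
  by move=> t0; rewrite fineK ?lenfin.
have len0 : len 0 = 0.
  have := lip1_curve_length_le 0 0 gL; have := curve_length_ge0 gamma (lexx 0).
  by rewrite lenE// !lee_fin subrr => ? ?; apply/le_anti/andP.
have len_dist x y : 0 <= x -> x <= y -> mdist (gamma x) (gamma y) <= len y - len x.
  move=> x0 xy; have := curve_length_superadd gamma 0 x y.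
  rewrite !lenE ?(le_trans x0)// => H.
  rewrite -lee_fin; apply: le_trans (mdist_le_length gamma xy) _.
  by rewrite EFinB leeBrDr// addeC.
have len_lip x y : 0 <= x -> x <= y -> len y - len x <= y - x.
  move=> x0 xy; have := @lip1_curve_length_split gamma 0 x y gL.
  by rewrite x0 xy !lenE ?(le_trans x0)// -EFinD lee_fin => /(_ isT); lra.
have len_mono x y : 0 <= x -> x <= y -> len x <= len y.
  by move=> x0 xy; have := len_dist _ _ x0 xy; have := mdist_ge0 (gamma x) (gamma y); lra.
pose l := len T.
have l0 : 0 < l.
  have := len_dist _ _ (lexx 0) T0; rewrite len0 subr0; apply: lt_le_trans.
  by rewrite mdist_gt0; apply/eqP.
pose len' t := len (clamp T t).
have len'C : contraction len'.
  move=> x y; apply: le_trans (clamp_contraction T x y); rewrite /len'.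
  have /andP[x0 xl] := clamp_itv x T0.
  have /andP[y0 yl] := clamp_itv y T0.
  have [xy|/ltW xy] := leP (clamp T x) (clamp T y).
    rewrite distrC ger0_norm ?subr_ge0 ?len_mono//.
    by rewrite distrC ger0_norm ?subr_ge0// len_lip.
  by rewrite ger0_norm ?subr_ge0 ?len_mono// ger0_norm ?subr_ge0// len_lip.
have surj x : exists t, (0 <= t <= T) /\ len t = clamp l x.
  have := @IVT R len' 0 T (clamp l x) T0.
  rewrite /len' (@clamp_id T 0) ?lexx// (@clamp_id T T) ?lexx ?T0// len0.
  have : Num.min 0 (len T) <= clamp l x <= Num.max 0 (len T).
    by rewrite -/l min_l ?max_r ?(ltW l0)//; apply: clamp_itv; exact: ltW.
  move=> M H; case: (H _ M).
    by apply: continuous_subspaceT; exact: contraction_continuous.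
  move=> c; rewrite in_itv/= => c0T; rewrite clamp_id// => E.
  by exists c.
have [psi psiP] := choice surj.
pose gamma' := gamma \o psi.
have gE t : 0 <= t <= T -> gamma' (len t) = gamma t.
  move=> /andP[t0 tT]; have [/andP[p0 pT]] := psiP (len t).
  rewrite clamp_id; last by rewrite /l -{1}len0 !len_mono.
  move=> E; apply: (@mdist_positivity R); apply/eqP; rewrite eq_le mdist_ge0 andbT.
  rewrite /gamma'/=; have [/len_dist|/ltW/len_dist] := leP (psi (len t)) t.
    by rewrite E subrr => ->.
  by rewrite E subrr metric_sym => ->.
have g'L : lip1 gamma'.
  move=> x y; apply: le_trans (clamp_contraction l x y).
  have [/andP[x0 xT] <-] := psiP x; have [/andP[y0 yT] <-] := psiP y.
  rewrite /gamma'/=; have [xy|/ltW xy] := leP (psi x) (psi y).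
    by rewrite distrC ger0_norm ?subr_ge0 ?len_mono// len_dist.
  by rewrite metric_sym ger0_norm ?subr_ge0 ?len_mono// len_dist.
exists l, gamma'; split => //.
- split => //.
    by apply: continuous_subspaceT; exact: lip1_continuous.
  move=> x /andP[x0 xl]; apply/eqP; rewrite eq_le; apply/andP; split.
    by apply: le_trans (lip1_curve_length_le _ _ g'L) _; rewrite subr0.
  have [/andP[p0 pT]] := psiP x; rewrite (@clamp_id l) ?x0// => lpx.
  (* [len] may agree at consecutive partition points, so their images need not form a partition;
     superadditivity of length is used instead. *)
  have key a t : 0 <= a -> itv_partition a (psi x) t ->
      ((chain_sum gamma a t)%:E <= curve_length (len a) (len (psi x)) gamma')%E.
    elim: t a => [|c t IH] a a0 act.
      by rewrite (itv_partition_nil act)/= curve_length_ge0.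
    have cpt := itv_partition_cons act.
    have cp := itv_partition_le cpt.
    have ac : a < c by case: act => /= /andP[].
    have c0 : 0 <= c by rewrite (le_trans a0)// ltW.
    rewrite /= EFinD; apply: le_trans (curve_length_superadd _ _ (len c) _).
    apply: leeD; last exact: IH.
    rewrite -(gE a) ?a0 ?(le_trans (ltW ac) (le_trans cp pT))//.
    rewrite -(gE c) ?c0 ?(le_trans cp pT)//.
    by apply: mdist_le_length; rewrite len_mono// ltW.
  rewrite -{1}lpx -lenE// -{2}len0 -[in X in (_ <= X)%E]lpx.
  by apply: curve_length_le => t; exact: key.
- by rewrite -{1}len0 gE// lexx.
- move=> x /andP[x0 xl]; have [/andP[p0 pT]] := psiP x.
  rewrite clamp_id ?x0 ?ltW// => lpx; exists (psi x) => //; rewrite p0/=.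
  by rewrite lt_neqAle pT andbT; apply: contraTneq xl => pxT; rewrite -lpx pxT ltxx.
- move=> H H0 mH.
  apply: le_trans (@contraction_integral _ len' 0 T 0 l _ len'C _ mH _) _ => //=.
  + move=> x /=; rewrite in_itv/= => x0l; have [p0 ] := psiP x.
    by rewrite clamp_id// => E; exists (psi x); rewrite ?in_itv//= /len' clamp_id.
  + apply: ge0_le_integral_nomeas => // t /=; rewrite in_itv/= => t0T.
    by rewrite /len' clamp_id// gE.
Qed.

End curves.

(** * Compactness of 1-Lipschitz paths *)

Section lip1_compactness.
Context {R : realType} {d : measure_display} {P : measurableMetricType R d}.
Implicit Types gamma : R -> P.

(** An Arzela-Ascoli argument: Tychonoff gives a cluster point for pointwise convergence, and
    Lipschitz bounds pass to it. The index [f k] is chosen so that the path is 1/(k+1)-close to the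
    limit at the points i/(k+1) with i < (k+1)^2; this grid covers [0, A] once k + 1 > A, and the
    Lipschitz bounds fill the gaps. *)
Lemma lip1_limit (K : set P) (g : nat -> R -> P) : compact K ->
  (forall n, lip1 (g n)) -> (forall n t, K (g n t)) ->
  exists gamma, [/\ lip1 gamma, (forall t, K (gamma t)) &
    forall A, exists f : nat -> nat, (forall k, (k <= f k)%N) /\
      forall t, 0 <= t <= A -> (fun k => g (f k) t) @ \oo --> gamma t].
Proof.
move=> cK gL gK.
pose PT := [the topologicalType of prod_topology (fun _ : R => P : topologicalType)].
have cKT := @tychonoff R (fun=> P) (fun=> K) (fun=> cK).
have [|gamma [gammaK gammacl]] := cKT ((g : nat -> PT) @ \oo) _.
  by exists 0%N => // n _ i; exact: gK.
have near_proj t (e : R) : 0 < e ->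
    nbhs (gamma : PT)
      [set f : PT | mdist (gamma t) (f t) < e].
  move=> e0; apply: (@proj_continuous R (fun=> P) t gamma [set y | mdist (gamma t) y < e]).
  by have := nbhsx_ballx (gamma t) _ e0; rewrite ballEmdist.
have hits (U : set PT) k :
    nbhs (gamma : PT) (U : set PT) -> exists2 m, (k <= m)%N & U (g m).
  move=> nU; have [|_ [[m /= km <-] Um]] := gammacl [set g m | m in [set m | (k <= m)%N]] U _ nU.
    by exists k => // m /= km; exists m.
  by exists m.
have gammaL : lip1 gamma.
  move=> x y; apply/ler_addgt0Pr => e e0.
  have e2 : 0 < e / 2 by rewrite divr_gt0.
  have [m _ [hx hy]] := hits _ 0%N (filterI (near_proj x _ e2) (near_proj y _ e2)).
  have := metric_triangle (gamma x) (g m x) (gamma y).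
  have := metric_triangle (g m x) (g m y) (gamma y).
  have := gL m x y; have : mdist (gamma y) (g m y) < e / 2 by exact: hy.
  have : mdist (gamma x) (g m x) < e / 2 by exact: hx.
  rewrite (metric_sym (g m y)); lra.
exists gamma; split => // A.
have step k : exists m, (k <= m)%N /\ forall i : 'I_(k.+1 * k.+1),
    mdist (gamma (i%:R / k.+1%:R)) (g m (i%:R / k.+1%:R)) < k.+1%:R^-1.
  have [|m km H] := hits [set f : PT | forall i : 'I_(k.+1 * k.+1),
    mdist (gamma (i%:R / k.+1%:R)) (f (i%:R / k.+1%:R)) < k.+1%:R^-1] k.
    apply: (@filter_forall _ _ (fun (i : 'I_(k.+1 * k.+1)) (f : PT) =>
      mdist (gamma (i%:R / k.+1%:R)) (f (i%:R / k.+1%:R)) < k.+1%:R^-1)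
      (nbhs (gamma : PT)) (nbhs_filter _)) => i.
    by apply: (near_proj (i%:R / k.+1%:R)); rewrite invr_gt0.
  by exists m.
have [f fP] := choice step.
exists f; split=> [k|t /andP[t0 tA]]; first by case: (fP k).
apply/cvg_ballP => e e0; near=> k; rewrite ballEmdist/=.
have [_ H] := fP k.
pose i := Num.truncn (t * k.+1%:R).
have /andP[it ti] : i%:R <= t * k.+1%:R < i.+1%:R.
  by apply: truncn_itv; rewrite mulr_ge0.
have ik : (i < k.+1 * k.+1)%N.
  rewrite -(ltr_nat R) natrM (le_lt_trans it)// ltr_pM2r//.
  rewrite (le_lt_trans tA)//; near: k.
  exists (Num.truncn A).+1 => // k /= Ak.
  have := truncnS_gt A; move=> /lt_le_trans; apply.
  by rewrite ler_nat ltnS ltnW.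
have {H} := H (Ordinal ik) => /=.
have k0 : 0 < k.+1%:R :> R by [].
set q := i%:R / k.+1%:R => H.
have tq : `|t - q| <= k.+1%:R^-1.
  rewrite ger0_norm ?subr_ge0 ?ler_pdivrMr//.
  rewrite -(ler_pM2r k0) mulrBl mulVf ?gt_eqF// mulfVK ?gt_eqF//.
  by rewrite lerBlDr addrC natr1 ltW.
have := gammaL t q; have := gL (f k) q t; rewrite distrC.
have := metric_triangle (gamma t) (gamma q) (g (f k) t).
have := metric_triangle (gamma q) (g (f k) q) (g (f k) t).
have : k.+1%:R^-1 < e / 3.
  by near: k; apply: near_infty_natSinv_lt (PosNum _) => //; rewrite divr_gt0.
move: tq H; move: (k.+1%:R^-1) => x; lra.
Unshelve. all: by end_near. Qed.

Lemma first_hit (F : set P) gamma (T : R) : continuous gamma -> closed F ->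
  0 <= T -> F (gamma T) -> exists M, [/\ 0 <= M <= T, F (gamma M) &
    forall t, 0 <= t < M -> ~ F (gamma t)].
Proof.
move=> cg cF T0 FT.
pose A := [set t | 0 <= t <= T /\ F (gamma t)].
have A0 : has_inf A.
  by split; [exists T; rewrite /A/= T0 lexx | exists 0 => t [/andP[]]].
have lbA t : A t -> inf A <= t by move=> At; apply: ge_inf => //; case: A0.
have infA0 : 0 <= inf A by apply: lb_le_inf; [case: A0|move=> t [/andP[]]].
exists (inf A); split.
- by rewrite infA0 lbA//; rewrite /A/= T0 lexx.
- apply: contrapT => nF.
  have oF : open (~` F) by exact: closed_openC.
  have /cg/nbhs_ballP[e /= e0 He] : nbhs (gamma (inf A)) (~` F) by exact: open_nbhs_nbhs.
  have [t At te] := inf_adherent e0 A0.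
  have At0 : inf A <= t by exact: lbA.
  have : ball (inf A) e t.
    by rewrite /ball/= distrC ger0_norm ?subr_ge0//; lra.
  by move=> /He; case: At.
- move=> t /andP[t0 tA] Ft; have tT : t <= T.
    by rewrite (le_trans (ltW tA))// lbA// /A/= T0 lexx.
  by move: tA; rewrite ltNge lbA// /A/= t0.
Qed.
End lip1_compactness.

Lemma metric_ball_open {R : realFieldType} {M : metricType R} (x : M) (r : R) :
  open (ball x r).
Proof.
rewrite openE => y; rewrite ballEmdist /= => xy.
apply/nbhs_ballP; exists (r - mdist x y); first by rewrite /= subr_gt0.
move=> z; rewrite !ballEmdist/= => yz.
by rewrite (le_lt_trans (metric_triangle x y z))// -ltrBrDl.
Qed.

(** * Lower semicontinuity and the cost of reaching a set *)

Section lsc.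
Context {R : realType}.

Lemma lsc_comp {X Y : topologicalType} (h : Y -> \bar R) (f : X -> Y) :
  lower_semicontinuous h -> continuous f -> lower_semicontinuous (h \o f).
Proof.
move=> lh cf x a /lh[V nV hV]; exists (f @^-1` V); first exact: cf.
by move=> y /hV.
Qed.

Lemma lsc_measurable (h : R -> \bar R) : lower_semicontinuous h ->
  measurable_fun (setT : set (measurableTypeR R)) h.
Proof. exact: lower_semicontinuous_measurable. Qed.

Lemma lsc_restrict {X : topologicalType} (h : X -> \bar R) (G : set X) :
  open G -> (forall x, 0 <= h x)%E -> lower_semicontinuous h ->
  lower_semicontinuous (h \_ G).
Proof.
move=> oG h0 lh x a; rewrite /patch; case: ifPn => [/set_mem Gx /lh[V nV hV]|_ a0].
  exists (V `&` G); first by apply: filterI => //; exact: open_nbhs_nbhs.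
  by move=> y [/hV hy Gy]; rewrite mem_set.
exists setT; first exact: filterT.
by move=> y _; case: ifPn => // _; rewrite (lt_le_trans a0).
Qed.

Lemma limn_einf_ge (u : nat -> \bar R) (a : \bar R) :
  (\forall n \near \oo, a <= u n)%E -> (a <= limn_einf u)%E.
Proof.
move=> [N _ Nu]; rewrite limn_einf_lim; apply: lime_ge; first exact: is_cvg_einfs.
exists N => // n /= Nn; apply: le_ereal_inf_tmp => _ [m /= nm <-].
by apply: Nu => /=; exact: leq_trans nm.
Qed.

Lemma limn_einf_le (u : nat -> \bar R) (a : \bar R) :
  (forall n, u n <= a)%E -> (limn_einf u <= a)%E.
Proof.
move=> ua; rewrite limn_einf_lim; apply: lime_le; first exact: is_cvg_einfs.
by apply: nearW => n; apply: le_trans (ua n); apply: ereal_inf_lbound; exists n => /=.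
Qed.

Lemma lsc_limn_einf {X : topologicalType} (h : X -> \bar R) (u : nat -> X) (x : X) :
  lower_semicontinuous h -> (forall y, 0 <= h y)%E -> u @ \oo --> x ->
  (h x <= limn_einf (h \o u))%E.
Proof.
move=> lh h0 ux.
have H a : (a%:E < h x)%E -> (a%:E <= limn_einf (h \o u))%E.
  move=> /lh[V nV hV]; apply: limn_einf_ge.
  have : \forall n \near \oo, V (u n) by exact: ux.
  by apply: filterS => n /hV /ltW.
case: (h x) H (h0 x) => [r| |]// H r0.
  apply/lee_addgt0Pr => e e0; rewrite -leeBlDr// -EFinB; apply: H.
  by rewrite lte_fin ltrBlDr ltrDl.
rewrite leye_eq; apply/eqP/eqyP => A A0; apply: H; exact: ltry.
Qed.

End lsc.

Section cost.
Context {R : realType} {d : measure_display} {P : measurableMetricType R d}.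
Notation leb := (@lebesgue_measure R).
Variable h : P -> \bar R.
Hypotheses (h0 : forall x, (0 <= h x)%E) (lsc_h : lower_semicontinuous h).
Implicit Types gamma : R -> P.

Lemma measurable_lsc_curve gamma : continuous gamma ->
  measurable_fun (setT : set (measurableTypeR R)) (h \o gamma).
Proof. by move=> cg; apply: lsc_measurable; exact: lsc_comp. Qed.

(* Curves are parametrized as 1-Lipschitz maps on [0, T], a class that, unlike
   arc length parametrizations, is closed under pointwise limits. *)
Definition joins (y z : P) (C : \bar R) :=
  exists T : R, exists gamma, [/\ 0 <= T, lip1 gamma, gamma 0 = y, gamma T = z &
    (\int[leb]_(t in `[0%R, T]) h (gamma t) <= C)%E].

Lemma joins_refl y : joins y y 0%E.
Proof.
exists 0, (fun=> y); split => //.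
  by move=> s t; rewrite mdistxx.
by rewrite set_itv1 integral_set1.
Qed.

(** Reflections, and the translations used for concatenation below, are contractions, so
    [contraction_integral] does the substitution. *)
Lemma joins_sym y z C : joins y z C -> joins z y C.
Proof.
move=> [T [gamma [T0 gL g0 gT gC]]].
have C1 : contraction (fun t => T - t).
  by move=> s t; have -> : T - s - (T - t) = t - s; [ring|rewrite (distrC t)].
have g'L : lip1 (fun t => gamma (T - t)).
  by move=> s t; apply: le_trans (gL _ _) (C1 _ _).
exists T, (fun t => gamma (T - t)); split => //; rewrite ?subr0 ?subrr//.
apply: le_trans gC.
apply: le_trans (@contraction_integral _ _ 0 T 0 T
  (fun t => h (gamma (T - t))) C1 _ _ _) _ => //.
- move=> t /=; rewrite in_itv/= => /andP[t0 tT]; exists (T - t) => /=; last lra.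
  by rewrite in_itv/=; apply/andP; split; lra.
- apply: (measurable_lsc_curve (gamma := fun t => gamma (T - t))).
  exact: lip1_continuous.
- by apply: ge0_le_integral_nomeas => // t _; rewrite opprB addrC subrK.
Qed.

Lemma joins_trans x y z C D : joins x y C -> joins y z D -> joins x z (C + D)%E.
Proof.
move=> [T [g [T0 gL g0 gT gC]]] [S [k [S0 kL k0 kS kD]]].
pose c t := if t <= T then g t else k (t - T).
have cL : lip1 c.
  have H s t : s <= t -> mdist (c s) (c t) <= `|s - t|.
    move=> st; rewrite /c; case: ifPn => sT; case: ifPn => tT.
    - exact: gL.
    - have -> : `|s - t| = `|s - T| + `|0 - (t - T)|.
        by rewrite sub0r normrN !(distrC s) !ger0_norm; lra.
      apply: le_trans (metric_triangle _ (g T) _) _.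
      by apply: lerD => //; rewrite gT -k0; exact: kL.
    - lra.
    - by rewrite (le_trans (kL _ _))// opprB addrA subrK.
  by move=> s t; have [/H//|/ltW/H] := leP s t; rewrite metric_sym distrC.
exists (T + S), c; split => //; first by rewrite addr_ge0.
- by rewrite /c T0.
- rewrite /c; case: ifPn => [TS|_]; last by rewrite addrAC subrr add0r.
  have S00 : S = 0 by lra.
  by rewrite S00 addr0 -kS S00 k0.
have mc := measurable_lsc_curve (lip1_continuous cL).
have -> : `[0, T + S]%classic = `[0, T] `|` `]T, T + S] :> set R.
  by rewrite -itv_bndbnd_setU// bnd_simp; lra.
rewrite ge0_integral_setU//; last 2 first.
- exact: measurable_funTS.
- apply/disj_setPS => t [] /=; rewrite !in_itv/=; case/andP=> _ + /andP[+ _]; lra.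
apply: leeD.
  apply: le_trans gC; apply: ge0_le_integral_nomeas => // t /=.
  by rewrite in_itv/= /c => /andP[_ ->].
apply: le_trans kD.
pose k' t := k (t - T).
have k'L : lip1 k'.
  by move=> s t; rewrite /k' (le_trans (kL _ _))// opprB addrA subrK.
have mk' := measurable_lsc_curve (lip1_continuous k'L).
apply: (@le_trans _ _ (\int[leb]_(t in `[T, (T + S)%R]) h (k' t))%E).
  rewrite -integral_itv_obnd_cbnd; last exact: measurable_funTS.
  apply: ge0_le_integral_nomeas => // t /=.
  by rewrite in_itv/= /c => /andP[Tt _]; rewrite (leNgt t) Tt.
have CT : contraction (fun t => t + T).
  by move=> s t; have -> : s + T - (t + T) = s - t; [ring|exact: lexx].
apply: le_trans (@contraction_integral _ _ 0 S T (T + S) (h \o k') CT _ _ _) _ => //.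
- move=> t /=; rewrite in_itv/= => /andP[t0 tT]; exists (t - T) => /=; last lra.
  by rewrite in_itv/=; apply/andP; split; lra.
- by move=> t; exact: h0.
- by apply: ge0_le_integral_nomeas => //= t _; rewrite /k' addrK.
Qed.

Lemma joins_arc l gamma : arc_length_curve l gamma ->
  joins (gamma 0) (gamma l) (\int[leb]_(t in `[0%R, l]) h (gamma t)).
Proof.
move=> gl; have l0 : 0 <= l by case: gl => /ltW.
exists l, (gamma \o clamp l); split => //=.
- exact: arc_length_lip1.
- by rewrite clamp_id// lexx.
- by rewrite clamp_id// lexx l0.
- by apply: ge0_le_integral_nomeas => // t /=; rewrite in_itv/= => tl; rewrite clamp_id.
Qed.

Variable F : set P.

Definition cost (y : P) : \bar R :=
  ereal_inf [set C | exists2 z, F z & joins y z C].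

Lemma joins_ge0 y z C : joins y z C -> (0 <= C)%E.
Proof.
by move=> [T [g [_ _ _ _]]]; apply: le_trans; apply: integral_ge0.
Qed.

Lemma cost_ge0 y : (0 <= cost y)%E.
Proof. by apply: le_ereal_inf_tmp => C [z _ /joins_ge0]. Qed.

Lemma cost_eq0 y : F y -> cost y = 0%E.
Proof.
move=> Fy; apply/eqP; rewrite eq_le cost_ge0 andbT; apply: ereal_inf_lbound.
by exists y => //; exact: joins_refl.
Qed.

Lemma cost_le y z C : joins y z C -> (cost y <= C + cost z)%E.
Proof.
move=> yzC; have C0 := joins_ge0 yzC.
have [->|Cy] := eqVneq C +oo%E; first by rewrite addye ?leey// -ltNye (lt_le_trans _ (cost_ge0 _)).
have Cf : C \is a fin_num by rewrite ge0_fin_numE// ltey.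
rewrite addeC -leeBlDr//; apply: le_ereal_inf_tmp => D [w Fw zwD].
rewrite leeBlDr// addeC; apply: ereal_inf_lbound; exists w => //.
exact: joins_trans zwD.
Qed.

(** Stopping at the first visit to F keeps the path outside F until its end, which is where its
    position and cost are under control. *)
Lemma cost_hit y (C : \bar R) : closed F -> (cost y < C)%E ->
  exists M, exists gamma, [/\ 0 <= M, lip1 gamma, gamma 0 = y,
    F (gamma M) /\ forall t, 0 <= t < M -> ~ F (gamma t) &
    (\int[leb]_(t in `[0%R, M]) h (gamma t) < C)%E].
Proof.
move=> cF /ereal_inf_lt[D [z Fz [T [g [T0 gL g0 gT gD]]]] DC].
have FT : F (g T) by rewrite gT.
have [M [/andP[M0 MT] FM MF]] := first_hit (lip1_continuous gL) cF T0 FT.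
exists M, g; split => //; apply: le_lt_trans DC; apply: le_trans gD.
apply: ge0_subset_integral => //.
  by apply: measurable_funTS; apply: measurable_lsc_curve; exact: lip1_continuous.
by apply: subset_itvl; rewrite bnd_simp.
Qed.

Hypothesis h1 : forall x, (1 <= h x)%E.

(** If it failed at y, there would be paths of cost below b < [cost y] from points tending to y,
    each stopped on reaching F. Their durations are at most b, so after being frozen at their ends
    they have a limit path on [0, b] inside K. Fatou's lemma and lower semicontinuity bound its cost
    by b, and it reaches F because F is closed: a contradiction. *)
Lemma cost_lsc (K : set P) (x0 : P) (r : R) : F = ~` (ball x0 r) ->
  ball x0 (2 * r) `<=` K -> compact K -> lower_semicontinuous cost.
Proof.
move=> FE GK cK; pose G := ball x0 r.
have oG : open G by exact: metric_ball_open.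
have cF : closed F by rewrite FE; exact: open_closedC.
have nFG z : ~ F z -> G z by rewrite FE => /contrapT.
have GnF z : G z -> ~ F z by rewrite FE => Gz.
have GK' : G `<=` K by move=> z Gz; apply: GK; move: Gz; rewrite /G !ballEmdist/=; have := mdist_ge0 x0 z; lra.
move=> y a ay.
have [a0|a0] := ltP a 0.
  exists setT; first exact: filterT.
  by move=> z _; rewrite (lt_le_trans _ (cost_ge0 _)) ?lte_fin.
have Gy : G y.
  by apply: nFG => /cost_eq0 y0; move: ay; rewrite y0 lte_fin ltNge a0.
have [b ab by_] : exists2 b, a < b & (b%:E < cost y)%E.
  move: (cost y) ay => [c| |]//; rewrite ?lte_fin => ac.
    by exists ((a + c) / 2); rewrite ?lte_fin; lra.
  by exists (a + 1); rewrite ?ltry//; lra.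
apply: contrapT => Hno.
have b0 : 0 <= b by lra.
have [hG [hG0 lhG hGE hGn]] : exists hG : P -> \bar R,
    [/\ forall z, (0 <= hG z)%E, lower_semicontinuous hG,
      forall z, G z -> hG z = h z & forall z, F z -> hG z = 0%E].
  exists (h \_ G); split; first by move=> z; rewrite /patch; case: ifP.
  - exact: lsc_restrict.
  - by move=> z Gz; rewrite /patch mem_set.
  - by move=> z Fz; rewrite /patch memNset// => /GnF.
have hGh z : (hG z <= h z)%E.
  by have [/hGn ->|/nFG/hGE ->] := pselect (F z).
have step n : exists M, exists gamma, [/\ 0 <= M, lip1 gamma,
    ball y n.+1%:R^-1 (gamma 0) /\ G (gamma 0),
    F (gamma M) /\ forall t, 0 <= t < M -> ~ F (gamma t) &
    (\int[leb]_(t in `[0%R, M]) h (gamma t) < b%:E)%E].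
  have [z [zy Gz] za] : exists2 z, (ball y n.+1%:R^-1 z /\ G z) & (cost z <= a%:E)%E.
    apply: contrapT => N; apply: Hno; exists (ball y n.+1%:R^-1 `&` G).
      apply: filterI; last exact: open_nbhs_nbhs.
      by apply: nbhsx_ballx; rewrite invr_gt0.
    by move=> z zV; rewrite ltNge; apply/negP => za; apply: N; exists z.
  have [|M [g [M0 gL g0 FM gb]]] := @cost_hit z b%:E cF.
    by rewrite (le_lt_trans za)// lte_fin.
  by exists M, g; split; rewrite ?g0.
have /choice[M /choice[g gP]] := step.
have M0 n : 0 <= M n by case: (gP n).
pose k n := g n \o clamp (M n).
have kL n : lip1 (k n).
  move=> s t; case: (gP n) => _ gL _ _ _; apply: le_trans (gL _ _) _.
  exact: clamp_contraction.
have gG n t : 0 <= t < M n -> G (g n t).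
  by case: (gP n) => _ _ _ [_ H] _ /H /nFG.
(* As h >= 1, a path costs at least its duration. *)
have Mb n : M n <= b.
  case: (gP n) => _ _ _ _ /ltW H; rewrite -lee_fin; apply: le_trans H.
  have -> : (M n)%:E = (\int[leb]_(t in `[0%R, M n]) 1%E)%E.
    rewrite integral_cst//= mul1e lebesgue_measure_itv/= lte_fin.
    by case: ltP => [_|]; [rewrite sube0|have := M0 n => *; congr (_%:E); lra].
  by apply: ge0_le_integral_nomeas.
(* The endpoint lies outside G, but at most r in time after a point of G; hence the radius 2r in the
   hypothesis on K. *)
have kK n t : K (k n t).
  rewrite /k/=; have /andP[c0] := clamp_itv t (M0 n).
  rewrite le_eqVlt => /predU1P[->|cM]; last by apply: GK'; apply: gG; rewrite c0.
  case: (gP n) => _ gL [_ G0] _ _.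
  move: (M0 n); rewrite le_eqVlt => /predU1P[<-|M0']; first exact: GK'.
  have rM : 0 <= Num.max 0 (M n - r) < M n.
    rewrite le_max lexx/= gt_max M0'/=.
    by move: G0; rewrite /G ballEmdist/=; have := mdist_ge0 x0 (g n 0); lra.
  have := gG n _ rM; rewrite /G ballEmdist/= => ltr; apply: GK; rewrite ballEmdist/=.
  apply: le_lt_trans (metric_triangle _ (g n (Num.max 0 (M n - r))) _) _.
  have := gL (Num.max 0 (M n - r)) (M n).
  have : `|Num.max 0 (M n - r) - M n| <= r.
    rewrite ler_norml; case/andP: rM => _ /ltW ?.
    have : M n - r <= Num.max 0 (M n - r) by rewrite le_max lexx orbT.
    by move: G0; rewrite /G ballEmdist/=; have := mdist_ge0 x0 (g n 0) => *; apply/andP; split; lra.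
  lra.
have kb n : (\int[leb]_(t in `[0%R, b]) hG (k n t) <= b%:E)%E.
  case: (gP n) => _ gL _ [FM _] /ltW; apply: le_trans.
  rewrite integral_mkcond [leRHS]integral_mkcond.
  apply: ge0_le_integral_nomeas => t _.
    by rewrite /patch; case: ifP.
  rewrite /patch; case: ifPn => [|_]; last by case: ifP.
  rewrite inE/= in_itv/= => /andP[t0 tb]; rewrite /k/=.
  have [tM|Mt] := ltP t (M n).
    have tM' : 0 <= t <= M n by rewrite t0 ltW.
    by rewrite mem_set/= ?in_itv/=// clamp_id.
  have -> : clamp (M n) t = M n by rewrite /clamp min_l// max_r.
  by rewrite hGn//; case: ifP.
have [c [cL cK' /(_ b)[f [fk fc]]]] := lip1_limit cK kL kK.
have k0y : (fun n => k (f n) 0) @ \oo --> y.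
  apply/cvg_ballP => e e0; near=> n.
  case: (gP (f n)) => _ _ [yg _] _ _.
  rewrite /k/= clamp_id ?lexx ?M0//; apply: le_ball yg.
  apply: (@le_trans _ _ n.+1%:R^-1).
    by rewrite lef_pV2 ?posrE// ler_nat ltnS.
  by apply/ltW; near: n; exact: near_infty_natSinv_lt (PosNum e0).
have c0y : c 0 = y.
  apply: (cvg_unique (@metric_hausdorff _ _)) k0y; apply: fc; rewrite lexx//.
have cbF : F (c b).
  apply: (closed_cvg F cF) (fc b _); last by rewrite b0 lexx.
  apply: nearW => n; case: (gP (f n)) => _ _ _ [FM _] _.
  by rewrite /k /clamp/= min_l// max_r.
have cb : (\int[leb]_(t in `[0%R, b]) hG (c t) <= b%:E)%E.
  apply: (@le_trans _ _ (\int[leb]_(t in `[0%R, b])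
      limn_einf (fun n => hG (k (f n) t)))%E).
    apply: ge0_le_integral_nomeas => // t /=; rewrite in_itv/= => tb.
    by apply: (@lsc_limn_einf _ _ _ (fun n => k (f n) t)) => //; exact: fc.
  apply: le_trans (fatou _ _ _ _) _ => //.
    move=> n; apply: measurable_funTS; apply: lsc_measurable.
    by apply: lsc_comp => //; exact: lip1_continuous.
  by apply: limn_einf_le => n; exact: kb.
(* The limit path may enter F before time b. Only up to its first visit does [hG] agree with h along
   it. *)
have [T [/andP[T0 Tb] FT TF]] := first_hit (lip1_continuous cL) cF b0 cbF.
suff : (cost y <= b%:E)%E by rewrite leNgt by_.
apply: ereal_inf_lbound; exists (c T) => //; exists T, c; split => //.
apply: le_trans cb.
rewrite -integral_itv_bndo_bndc; last first.
  by apply: measurable_funTS; apply: measurable_lsc_curve; exact: lip1_continuous.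
rewrite integral_mkcond [leRHS]integral_mkcond.
apply: ge0_le_integral_nomeas => t _; rewrite /patch; first by case: ifP.
case: ifPn => [|_]; last by case: ifP.
rewrite inE/= in_itv/= => /andP[t0 tT].
rewrite mem_set/= ?in_itv/= ?t0 ?(le_trans (ltW tT))//.
by rewrite hGE//; apply: nFG; apply: TF; rewrite t0.
Unshelve. all: by end_near. Qed.

End cost.

Lemma lsc_scale {R : realType} {X : topologicalType} (h : X -> \bar R) (c : R) :
  0 < c -> lower_semicontinuous h -> lower_semicontinuous (fun x => c%:E * h x)%E.
Proof.
move=> c0 lh.
have E a x : (a%:E < c%:E * h x)%E = ((a / c)%:E < h x)%E.
  case: (h x) => [r| |].
  - by rewrite -EFinM !lte_fin ltr_pdivrMr// mulrC.
  - by rewrite gt0_muley ?lte_fin// !ltry.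
  - by rewrite gt0_muleNy ?lte_fin.
by move=> x a; rewrite E => /lh[V nV hV]; exists V => // y /hV; rewrite E.
Qed.

Section borel.
Context {R : realType} {d : measure_display} {P : measurableMetricType R d}.
Variable mu : {measure set P -> \bar R}.

Lemma lsc_borel (h : P -> \bar R) : lower_semicontinuous h -> borel_fun h.
Proof.
move=> /lower_semicontinuousP lh.
apply: (measurability _ (ErealGenOInfty.measurableE R)) => _ [_ [a ->] <-].
rewrite setTI; apply: sub_gen_smallest.
by rewrite /= preimage_itvoy; exact: lh.
Qed.

Lemma borel_fun_measurable (h : P -> \bar R) : borel_regular mu ->
  borel_fun h -> measurable_fun setT h.
Proof.
move=> [bm _] bh _ Y mY; apply: bm; exact: bh.
Qed.

Lemma open_measurable_metric (A : set P) : borel_regular mu -> open A -> measurable A.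
Proof. by move=> [bm _] oA; apply: bm; exact: sub_gen_smallest. Qed.

Lemma closed_measurable_metric (A : set P) : borel_regular mu -> closed A -> measurable A.
Proof.
move=> br cA; rewrite -(setCK A); apply: measurableC.
exact: (open_measurable_metric br (closed_openC cA)).
Qed.

Lemma continuous_measurable_metric (f : P -> R) : borel_regular mu ->
  continuous f -> measurable_fun setT f.
Proof.
move=> br /continuousP cf.
apply: (measurability _ (RGenOpens.measurableE R)) => _ [_ [a [b ->]] <-].
by rewrite setTI; apply: open_measurable_metric => //; apply: cf; exact: interval_open.
Qed.

End borel.

(** * Truncated costs and their upper gradients *)

Section cost_upper_gradient.
Context {R : realType} {d : measure_display} {P : measurableMetricType R d}.
Variables (h : P -> \bar R) (F : set P).
Hypotheses (h0 : forall x, (0 <= h x)%E) (lsc_h : lower_semicontinuous h).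

Definition cost_trunc (k : R) (y : P) : \bar R :=
  Order.min 1%E ((k^-1)%:E * cost h F y)%E.

Lemma cost_trunc_itv k y : 0 < k -> (0 <= cost_trunc k y <= 1)%E.
Proof.
move=> k0; rewrite /cost_trunc ge_min lexx/= andbT le_min lee01/=.
by rewrite mule_ge0 ?cost_ge0// lee_fin invr_ge0 ltW.
Qed.

Lemma cost_trunc_lsc k : 0 < k -> lower_semicontinuous (cost h F) ->
  lower_semicontinuous (cost_trunc k).
Proof.
move=> k0 lc x a; rewrite /cost_trunc lt_min => /andP[a1].
have ik0 : 0 < k^-1 by rewrite invr_gt0.
move=> /(lsc_scale ik0 lc)[V nV cV].
by exists V => // y /cV; rewrite lt_min a1.
Qed.

(** Prefixing the curve to a path that starts at its far end changes the cost by at most the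
    integral of h, and the reversed curve gives the other inequality. Truncation keeps both values
    finite, so that no difference of infinities arises. *)
Lemma cost_trunc_upper_gradient k : 0 < k ->
  upper_gradient (cost_trunc k) (fun y => (k^-1)%:E * h y)%E.
Proof.
move=> k0; have ik0 : 0 < k^-1 by rewrite invr_gt0.
split.
- by apply: lsc_borel; exact: lsc_scale.
- by move=> x; rewrite mule_ge0// lee_fin ltW.
- move=> l gamma gl.
  have jn := joins_arc h0 gl; have jn' := joins_sym h0 lsc_h jn.
  have mh : measurable_fun (`[0, l]%classic : set (measurableTypeR R)) (h \o gamma).
    apply: (@eq_measurable_fun _ _ _ _ _ (h \o (gamma \o clamp l))).
      by move=> t; rewrite inE/= in_itv/= => tl; rewrite clamp_id.
    apply: measurable_funTS; apply: measurable_lsc_curve => //.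
    exact/lip1_continuous/arc_length_lip1.
  rewrite ge0_integralZl_EFin//; last exact: ltW.
  set I := (\int[_]_(_ in _) _)%E in jn jn' *.
  have I0 : (0 <= I)%E by exact: joins_ge0 jn.
  have kI0 : (0 <= (k^-1)%:E * I)%E by rewrite mule_ge0// lee_fin ltW.
  have H x y : joins h x y I -> (cost_trunc k x <= cost_trunc k y + (k^-1)%:E * I)%E.
    move=> xy; rewrite /cost_trunc.
    have C0 := cost_ge0 h0 F y.
    case: (leP 1%E ((k^-1)%:E * cost h F y)%E) => [k1|k1].
      by rewrite ge_min leeDl.
    rewrite ge_min; apply/orP; right; rewrite addeC -ge0_muleDr//.
    by rewrite lee_wpmul2l ?lee_fin ?(ltW ik0)//; exact: (cost_le h0 lsc_h F xy).
  have fin x : cost_trunc k x \is a fin_num.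
    have /andP[c0 c1] := cost_trunc_itv x k0.
    by rewrite ge0_fin_numE// (le_lt_trans c1)// ltry.
  have := H _ _ jn; have := H _ _ jn'.
  rewrite -(fineK (fin (gamma 0))) -(fineK (fin (gamma l))).
  case: ((k^-1)%:E * I)%E => [r| |]; rewrite ?leey//.
  by rewrite -!EFinD !lee_fin => ? ?; rewrite ler_norml; apply/andP; split; lra.
Qed.
End cost_upper_gradient.

(** * Outer regularity and lower semicontinuous majorants *)

Section regularity.
Context {R : realType} {d : measure_display} {P : measurableMetricType R d}.
Variable mu : {measure set P -> \bar R}.
Hypothesis br : borel_regular mu.
Variable G : set P.
Hypotheses (oG : open G) (Gfin : (mu G < +oo)%E).

Let mG : measurable G.
Proof. exact: (open_measurable_metric br). Qed.

(** Approximation by open sets from outside alone does not pass to complements, so closed sets from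
    inside are carried along. The sets admitting both form a sigma-algebra that contains the open
    sets. *)
Let sandwiched (B : set P) := forall e : R, 0 < e -> exists U C : set P,
  [/\ open U, closed C, C `<=` B, B `<=` U & (mu (G `&` (U `\` C)) <= e%:E)%E].

Let lt_measure_near0 (A : nat -> set P) (e : R) : 0 < e ->
  (forall n, measurable (A n)) -> nonincreasing_seq A -> \bigcap_n A n = set0 ->
  (forall n, A n `<=` G) -> exists n, (mu (A n) <= e%:E)%E.
Proof.
move=> e0 mA dA A0 AG.
have : mu \o A @ \oo --> mu (\bigcap_n A n).
  apply: nonincreasing_cvg_mu => //; last by rewrite A0.
  by apply: le_lt_trans Gfin; apply: le_measure; rewrite ?inE//.
rewrite A0 measure0 => /fine_cvgP[fA /cvgrPdist_lt/(_ _ e0) Ae].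
near \oo => n; exists n.
have fn : mu (A n) \is a fin_num by near: n; exact: fA.
rewrite -(fineK fn) lee_fin; apply/ltW; apply: le_lt_trans (ler_norm _) _.
rewrite -normrN -sub0r; near: n; exact: Ae.
Unshelve. all: by end_near. Qed.

Let sandwiched_open B : open B -> sandwiched B.
Proof.
move=> oB e e0.
pose V n := \bigcup_(y in ~` B) ball y n.+1%:R^-1.
have oV n : open (V n) by apply: bigcup_open => y _; exact: metric_ball_open.
have [||||n Hn] := @lt_measure_near0 (fun n => G `&` (B `&` V n)) e e0.
- by move=> n; apply: (open_measurable_metric br); do 2?apply: openI.
- move=> m n mn; apply/subsetPset; apply: setIS; apply: setIS.
  move=> x [y By yx]; exists y => //; apply: le_ball yx.
  by rewrite lef_pV2 ?posrE// ler_nat ltnS.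
- rewrite -subset0 => x H; have [_ [Bx _]] := H 0%N I.
  have /nbhs_ballP[r /= r0 rB] : nbhs x B by exact: open_nbhs_nbhs.
  have [n] : exists n, n.+1%:R^-1 < r.
    near \oo => n; exists n; near: n; exact: near_infty_natSinv_lt (PosNum r0).
  have [_ [_ [y By yx]]] := H n I => nr; apply: By; apply: rB.
  by apply: ball_sym; apply: le_ball yx; exact: ltW.
- by move=> n x [].
exists B, (~` V n); split => //; first exact: open_closedC.
  move=> x Vx; apply: contrapT => Bx; apply: Vx; exists x => //.
  by apply: ballxx; rewrite invr_gt0.
by rewrite setDE setCK.
Unshelve. all: by end_near. Qed.

(** Complementation swaps the roles of U and C. For a countable union only finitely many C k are
    kept, to stay closed; the part Z n lost inside G has small measure for large n because [mu G] is
    finite. *)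
Let sandwiched_sigma : sigma_algebra setT sandwiched.
Proof.
split.
- by apply: sandwiched_open; exact: open0.
- move=> B sB e /sB[U [C [oU cC CB BU UC]]].
  exists (~` C), (~` U); rewrite setTD; split.
  + exact: closed_openC.
  + exact: open_closedC.
  + exact: subsetC.
  + exact: subsetC.
  + by have -> : ~` C `\` ~` U = U `\` C by rewrite !setDE setCK setIC.
- move=> B sB e e0.
  have e2 n : 0 < e / 2 / (2 ^ n.+1)%:R by rewrite !divr_gt0// ltr0n expn_gt0.
  have /choice[U /choice[C UC]] := fun n => sB n _ (e2 n).
  pose W n := G `&` ((\bigcup_k U k) `\` \bigcup_(k < n) C k).
  have oU : open (\bigcup_k U k) by apply: bigcup_open => n _; case: (UC n).
  have cC n : closed (\bigcup_(k < n) C k).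
    by apply: closed_bigcup; [exact: finite_II|move=> k _; case: (UC k)].
  have mCn n : measurable (\bigcup_(k < n) C k) by exact: (closed_measurable_metric br).
  have mC k : measurable (C k) by apply: (closed_measurable_metric br); case: (UC k).
  have mU k : measurable (U k) by apply: (open_measurable_metric br); case: (UC k).
  have mUU : measurable (\bigcup_k U k) by apply: bigcupT_measurable.
  have mCC : measurable (\bigcup_k C k) by apply: bigcupT_measurable.
  pose Z n := G `&` ((\bigcup_k C k) `\` \bigcup_(k < n) C k).
  have [|||||n Zn] := @lt_measure_near0 Z (e / 2).
  + by rewrite divr_gt0.
  + by move=> n; apply: measurableI => //; exact: measurableD.
  + move=> m n mn; apply/subsetPset; apply: setIS; apply: setDS.
    by move=> x [k /= km Ckx]; exists k => //=; exact: leq_trans mn.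
  + rewrite -subset0 => x H; have [_ [[k _ Ckx] _]] := H 0%N I.
    by have [_ [_]] := H k.+1 I; apply; exists k => /=.
  + by move=> n x [].
  exists (\bigcup_k U k), (\bigcup_(k < n) C k); split => //.
  + by move=> x [k _ Ckx]; exists k => //; case: (UC k) => _ _ + _ _; exact.
  + by move=> x [k _ Bkx]; exists k => //; case: (UC k) => _ _ _ + _; exact.
  rewrite (splitr e) EFinD.
  apply: (@le_trans _ _ (mu ((\bigcup_k (G `&` (U k `\` C k))) `|` Z n))).
    apply: le_measure; rewrite ?inE.
    + by apply: measurableI => //; exact: measurableD.
    + apply: measurableU; last by apply: measurableI => //; exact: measurableD.
      by apply: bigcupT_measurable => k; apply: measurableI => //; exact: measurableD.
    move=> x [Gx [[k _ Ukx] nC]].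
    have [[i _ Cix]|nCC] := pselect ((\bigcup_k C k) x).
      by right; split => //; split => //; exists i.
    left; exists k => //; split => //; split => // Ckx; apply: nCC; by exists k.
  apply: le_trans (measureU2 _ _ _) _.
  + by apply: bigcupT_measurable => k; apply: measurableI => //; exact: measurableD.
  + by apply: measurableI => //; exact: measurableD.
  apply: leeD => //.
  apply: le_trans (measure_sigma_subadditive (F := fun k => G `&` (U k `\` C k)) _ _ _ _) _ => //.
  + by move=> k; apply: measurableI => //; exact: measurableD.
  + by apply: bigcupT_measurable => k; apply: measurableI => //; exact: measurableD.
  apply: le_trans (epsilon_trick0 _ _); last by rewrite ltW// divr_gt0.
  by apply: lee_nneseries => // k _; case: (UC k).
Qed.

(** A has finite measure, so a Borel hull of the same measure exceeds it by a null set only, and an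
    open set that approximates the hull approximates A. *)
Lemma outer_regular (A : set P) (e : R) : measurable A -> A `<=` G -> 0 < e ->
  exists U, [/\ open U, A `<=` U, U `<=` G & (mu (U `\` A) <= e%:E)%E].
Proof.
move=> mA AG e0; have [_ /(_ _ mA)[D [bD AD DA]]] := br.
have mD : measurable D by case: br => + _; exact.
have sD : sandwiched D.
  by move: D bD {AD DA mD}; apply: smallest_sub.
have [U [C [oU cC CD DU UC]]] := sD e e0.
exists (U `&` G); split.
- exact: openI.
- by move=> x Ax; split; [apply: DU; exact: AD|exact: AG].
- exact: subIsetr.
have Afin : (mu A < +oo)%E by apply: le_lt_trans Gfin; apply: le_measure; rewrite ?inE.
have mU : measurable U by exact: (open_measurable_metric br).
have mC : measurable C by exact: (closed_measurable_metric br).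
apply: (@le_trans _ _ (mu (G `&` (U `\` C) `|` (D `\` A)))).
  apply: le_measure; rewrite ?inE.
  + by apply: measurableD => //; exact: measurableI.
  + apply: measurableU; last exact: measurableD.
    by apply: measurableI => //; exact: measurableD.
  move=> x [[Ux Gx] Ax]; have [Dx|nDx] := pselect (D x); [by right|left].
  by split => //; split => // /CD.
have DA0 : mu (D `\` A) = 0%E.
  have Dfin : (mu D < +oo)%E by rewrite DA.
  rewrite measureD// setIidr//.
  transitivity (mu A - mu A)%E; first by congr (_ - _)%E; exact: DA.
  by rewrite subee// ge0_fin_numE.
apply: le_trans (measureU2 _ _ _) _; last first.
  by rewrite [X in (_ + X)%E](_ : _ = 0%E) ?adde0//; exact: DA0.
all: by do ?[apply: measurableD | apply: measurableI].
Qed.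

End regularity.

Lemma le_poweR {R : realType} (x y : \bar R) (r : R) :
  0 <= r -> (0 <= x)%E -> (x <= y)%E -> (x `^ r <= y `^ r)%E.
Proof.
move=> r0 x0 xy; apply: gt0_ler_poweR => //; rewrite in_itv/= leey andbT//.
exact: le_trans xy.
Qed.

Section lsc_majorant.
Context {R : realType} {d : measure_display} {P : measurableMetricType R d}.

Lemma lsc_poweR {X : topologicalType} (H : X -> \bar R) (q : R) : 0 < q ->
  (forall x, 0 <= H x)%E -> lower_semicontinuous H ->
  lower_semicontinuous (fun x => H x `^ q)%E.
Proof.
move=> q0 H0 lH x a aH.
have [a0|a0] := ltP a 0.
  by exists setT; [exact: filterT|move=> y _; rewrite (lt_le_trans _ (poweR_ge0 _ _))].
have aq : ((a `^ q^-1)%:E `^ q = a%:E)%E.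
  by rewrite poweR_EFin -powRrM mulVf ?gt_eqF// powRr1.
have E y : (a%:E < H y `^ q)%E = ((a `^ q^-1)%:E < H y)%E.
  rewrite -aq; apply/idP/idP; apply: contraTT; rewrite -!leNgt => L.
    by apply: le_poweR; rewrite ?H0// ltW.
  have : ((H y `^ q) `^ q^-1 <= ((a `^ q^-1)%:E `^ q) `^ q^-1)%E.
    by apply: le_poweR; rewrite ?poweR_ge0// invr_ge0 ltW.
  by rewrite -!poweRrM mulfV ?gt_eqF// !poweRe1// lee_fin powR_ge0.
move: aH; rewrite E => /lH[V nV hV].
by exists V => // y /hV; rewrite E.
Qed.

Lemma nneseries_indic_partial (X : Type) (U : nat -> set X) (x : X) (n : nat) :
  (\sum_(0 <= k < n) (\1_(U k) x)%:E <= \sum_(k <oo) (\1_(U k) x : R)%:E)%E.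
Proof. by apply: nneseries_lim_ge => k _ _; rewrite lee_fin. Qed.

Lemma nneseries_le_bound (u : nat -> \bar R) (M : \bar R) : (forall k, 0 <= u k)%E ->
  (forall n, \sum_(0 <= k < n) u k <= M)%E -> (\sum_(k <oo) u k <= M)%E.
Proof.
move=> u0 uM; apply: lime_le; first by apply: is_cvg_nneseries => k _ _; exact: u0.
exact: nearW.
Qed.

(** The series counts the integers k >= 0 below y. *)
Lemma nneseries_ceil_le (y : \bar R) : (0 <= y)%E ->
  (\sum_(k <oo) ((k%:R%:E < y)%E%:R : R)%:E <= y + 1)%E.
Proof.
move=> y0; apply: nneseries_le_bound => [k|n]; first by rewrite lee_fin.
rewrite sumEFin; case: y y0 => [r| |]//; rewrite ?leey// lee_fin => r0.
rewrite -EFinD lee_fin.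
suff [] : \sum_(0 <= k < n) (k%:R%:E < r%:E)%E%:R <= r + 1 /\
    \sum_(0 <= k < n) (k%:R%:E < r%:E)%E%:R <= n%:R :> R by [].
elim: n => [|n [IH1 IH2]]; first by rewrite big_nil; split => //; lra.
by rewrite big_nat_recr//= -natr1 lte_fin; case: ltP => nr /=; split; lra.
Qed.

Lemma lsc_nneseries_indic {X : topologicalType} (U : nat -> set X) :
  (forall k, open (U k)) ->
  lower_semicontinuous (fun x => 1 + \sum_(k <oo) (\1_(U k) x : R)%:E)%E.
Proof.
move=> oU x a ax.
have [n an] : exists n, (a%:E < 1 + \sum_(0 <= k < n) (\1_(U k) x : R)%:E)%E.
  apply: contrapT => /forallNP N; move: ax; rewrite ltNge => /negP; apply.
  rewrite -leeBrDl//; apply: lime_le; first exact: is_cvg_nneseries.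
  by apply: nearW => n; rewrite leeBrDl// leNgt; exact/negP.
exists [set y | forall k : 'I_n, (\1_(U k) x <= \1_(U k) y :> R)].
  apply: (@filter_forall _ _ (fun (k : 'I_n) y => \1_(U k) x <= \1_(U k) y :> R)) => k.
  have [Ux|Ux] := pselect (U k x); last by apply: nearW => y; rewrite indicE memNset.
  have : nbhs x (U k) by exact: open_nbhs_nbhs.
  by apply: filterS => y Uy; rewrite !indicE !mem_set.
move=> y xy; apply: (lt_le_trans an); rewrite leeD2lE//.
apply: le_trans (nneseries_indic_partial _ _ n).
rewrite !big_mkord; apply: lee_sum => k _; rewrite lee_fin; exact: xy.
Qed.

Variable mu : {measure set P -> \bar R}.
Hypothesis br : borel_regular mu.

(** The Vitali-Caratheodory construction, applied to f = g^p: h^p = 1 + sum_k 1_(U k), where U k is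
    open, contains the part of {f > k} and of D inside G, and exceeds it by at most 2^-k mu(B k).
    All U k contain the points of D in G, whence h = +oo there. The constant j + 4 is 1 for the
    leading constant, 1 for counting the levels below f, and j + 2 for the excess measures. *)
Lemma lsc_majorant (G D : set P) (B : nat -> set P) (g : P -> \bar R) (p : R) :
  0 < p -> open G -> (mu G < +oo)%E -> measurable D -> mu D = 0%E ->
  measurable_fun setT g -> (forall x, 0 <= g x)%E ->
  (forall j, measurable (B j)) -> (forall j, 0 < mu (B j) < +oo)%E ->
  (forall j k, (j <= k)%N -> B k `<=` B j) ->
  exists h : P -> \bar R, [/\ lower_semicontinuous h, forall x, (1 <= h x)%E,
    forall x, G x -> (g x <= h x)%E, forall x, G x -> D x -> h x = +oo%E &
    forall j, (\int[mu]_(x in B j) (h x `^ p) <=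
      \int[mu]_(x in B j) (g x `^ p) + (j + 4)%:R%:E * mu (B j))%E].
Proof.
move=> p0 oG Gfin mD D0 mg g0 mB Bpos Bdec.
pose f x := (g x `^ p)%E.
have f0 x : (0 <= f x)%E by exact: poweR_ge0.
have mf : measurable_fun setT f by exact: (measurableT_comp (measurable_poweR p)).
pose L k := [set x | (k%:R%:E < f x)%E].
have mL k : measurable (L k).
  by rewrite -[X in measurable X]setTI; exact: emeasurable_fun_o_infty.
pose A k := G `&` (L k `|` D).
have mG : measurable G by exact: (open_measurable_metric br).
have mA k : measurable (A k) by apply: measurableI => //; exact: measurableU.
have mBfin k : mu (B k) \is a fin_num.
  by have /andP[/ltW b0 b1] := Bpos k; rewrite ge0_fin_numE.
have step k : exists U, [/\ open U, A k `<=` U, U `<=` G &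
    (mu (U `\` A k) <= ((2 ^ k)%:R^-1)%:E * mu (B k))%E].
  have e0 : 0 < (2 ^ k)%:R^-1 * fine (mu (B k)).
    rewrite mulr_gt0 ?invr_gt0 ?ltr0n ?expn_gt0// fine_gt0//.
  have [U [oU AU UG mU]] := outer_regular br oG Gfin (mA k) (@subIsetl _ _ _) e0.
  by exists U; split => //; move: mU; rewrite EFinM fineK.
have /choice[U UP] := step.
have oU k : open (U k) by case: (UP k).
have mU k : measurable (U k) by exact: (open_measurable_metric br).
pose H x := (1 + \sum_(k <oo) (\1_(U k) x : R)%:E)%E.
have H1 x : (1 <= H x)%E by rewrite leeDl// nneseries_ge0// => k _ _; rewrite lee_fin.
have H0 x : (0 <= H x)%E by rewrite (le_trans _ (H1 x)).
have ip0 : 0 < p^-1 by rewrite invr_gt0.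
have fH x : G x -> (f x <= H x)%E.
  move=> Gx; have UL k : (k%:R%:E < f x)%E -> \1_(U k) x = 1 :> R.
    move=> kf; rewrite indicE mem_set//; case: (UP k) => _ + _ _; apply.
    by split => //; left.
  have Hn n : (n%:R%:E <= f x)%E -> (n.+1%:R%:E <= H x)%E.
    move=> nf; rewrite -natr1 addrC EFinD leeD2lE//.
    apply: le_trans (nneseries_indic_partial _ _ n).
    rewrite big_mkord (eq_bigr (fun=> (1 : R)%:E)); last first.
      move=> k _; rewrite UL// (lt_le_trans _ nf)// lte_fin ltr_nat.
      exact: ltn_ord.
    by rewrite sumEFin lee_fin sumr_const card_ord.
  move: (f0 x) Hn; case: (f x) => [r| |]// r0 Hn.
    have := Hn (Num.truncn r); rewrite lee_fin => /(_ _); rewrite lee_fin in r0.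
    have /andP[tr rt] := truncn_itv r0 => /(_ tr); apply: le_trans.
    by rewrite lee_fin ltW.
  rewrite leye_eq; apply/eqP/eqyP => M M0.
  apply: le_trans (Hn (Num.truncn M) _); last by rewrite leey.
  by rewrite lee_fin; have /andP[_ /ltW] := truncn_itv (ltW M0).
exists (fun x => H x `^ p^-1)%E; split.
- by apply: lsc_poweR => //; exact: lsc_nneseries_indic.
- move=> x; rewrite -(poweR1r p^-1).
  by apply: le_poweR => //; exact: ltW.
- move=> x Gx; rewrite -[leLHS](@poweRe1 _ _ (g0 x)) -(@mulfV _ p) ?gt_eqF// poweRrM.
  by apply: le_poweR; rewrite ?fH ?f0// ltW.
- move=> x Gx Dx; rewrite (_ : H x = +oo%E) ?poweRyr ?gt_eqF//.
  apply/eqyP => M M0.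
  have Hn n : (n%:R%:E <= H x)%E.
    apply: (@le_trans _ _ (\sum_(k <oo) (\1_(U k) x : R)%:E)%E); last by rewrite leeDr.
    apply: le_trans (nneseries_indic_partial _ _ n).
    rewrite big_mkord (eq_bigr (fun=> (1 : R)%:E)); last first.
      move=> k _; rewrite indicE mem_set//; case: (UP k) => _ + _ _; apply.
      by split => //; right.
    by rewrite sumEFin lee_fin sumr_const card_ord.
  apply: le_trans (Hn (Num.truncn M).+1); rewrite lee_fin.
  by have /andP[_ /ltW] := truncn_itv (ltW M0).
move=> j.
have -> : (\int[mu]_(x in B j) ((H x `^ p^-1) `^ p) = \int[mu]_(x in B j) H x)%E.
  by apply: eq_integral => x _; rewrite -poweRrM mulVf ?gt_eqF// poweRe1.
have mI k : measurable_fun (B j) (fun x => (\1_(U k) x : R)%:E).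
  by apply/measurable_EFinP; exact: measurable_indic.
have mLI k : measurable_fun (B j) (fun x => (\1_(L k) x : R)%:E).
  by apply/measurable_EFinP; exact: measurable_indic.
rewrite ge0_integralD//; last 2 first.
- by move=> x _; rewrite nneseries_ge0// => k _ _; rewrite lee_fin.
- by apply: ge0_emeasurable_sum => // k x _ _; rewrite lee_fin.
rewrite integral_cst// mul1e integral_nneseries//.
(* Bounds the excess of U k inside B j relative to mu(B j): trivially by 1 for k < j, and by 2^-k
   for k >= j since then B k is contained in B j. The total is at most j + 2. *)
pose c k : R := if (k < j)%N then 1 else (2 ^ k)%:R^-1.
have c0 k : 0 <= c k by rewrite /c; case: ifP.
have cj : (\sum_(k <oo) (c k)%:E <= (j + 2)%:R%:E)%E.
  apply: nneseries_le_bound => [k|n]; first by rewrite lee_fin.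
  have Sc : \sum_(0 <= k < n) c k <= (minn n j)%:R + 2 * (1 - (2 ^ n)%:R^-1).
    elim: n => [|n IH].
      by rewrite big_nil min0n expn0 invr1 subrr mulr0 addr0.
    rewrite big_nat_recr//=.
    have n2 : (2 ^ n)%:R^-1 = 2 * (2 ^ n.+1)%:R^-1 :> R.
      by rewrite expnS natrM invfM mulrA mulfV ?mul1r.
    have n0 : 0 <= (2 ^ n)%:R^-1 :> R by rewrite invr_ge0.
    move: IH; rewrite /c; have [nj|jn] := ltnP n j.
      rewrite (minn_idPl nj) -natr1; lra.
    rewrite (minn_idPr (leqW jn)); lra.
  rewrite sumEFin lee_fin; apply: le_trans Sc _; rewrite natrD.
  have : (minn n j)%:R <= j%:R :> R by rewrite ler_nat geq_minr.
  have : 0 <= (2 ^ n)%:R^-1 :> R by rewrite invr_ge0.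
  lra.
have UI k : (\int[mu]_(x in B j) (\1_(U k) x)%:E <=
    \int[mu]_(x in B j) (\1_(L k) x)%:E + (c k)%:E * mu (B j))%E.
  rewrite !integral_indic//.
  have mUA : measurable (U k `\` A k) by exact: measurableD.
  have mUAB : measurable ((U k `\` A k) `&` B j) by exact: measurableI.
  have mLB : measurable (L k `&` B j) by exact: measurableI.
  apply: (@le_trans _ _ (mu ((L k `&` B j) `|` (((U k `\` A k) `&` B j) `|` D)))).
    apply: le_measure; rewrite ?inE; [exact: measurableI| |].
      by apply: measurableU => //; apply: measurableU.
    move=> x [Ux Bx]; have [[Gx [Lx|Dx]]|nA] := pselect (A k x).
    - by left.
    - by right; right.
    - by right; left.
  apply: le_trans (measureU2 _ _ _) _.
  - exact: mLB.
  - exact: measurableU.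
  apply: leeD2l.
  apply: le_trans (measureU2 _ _ _) _ => //.
  rewrite [X in (_ + X)%E](_ : _ = 0%E) ?adde0//.
  rewrite /c; case: ifPn => kj.
    by rewrite mul1e; apply: le_measure; rewrite ?inE.
  apply: (@le_trans _ _ (mu (U k `\` A k))).
    by apply: le_measure; rewrite ?inE.
  case: (UP k) => _ _ _ /le_trans; apply.
  rewrite lee_wpmul2l ?lee_fin//; apply: le_measure; rewrite ?inE//.
  by apply: Bdec; rewrite leqNgt.
apply: (@le_trans _ _ (mu (B j) + (\int[mu]_(x in B j) (\sum_(k <oo) (\1_(L k) x)%:E)
   + (j + 2)%:R%:E * mu (B j)))%E).
  rewrite leeD2lE// integral_nneseries//.
  apply: (@le_trans _ _ (\sum_(k <oo) (\int[mu]_(x in B j) (\1_(L k) x)%:E + (c k)%:E * mu (B j)))%E).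
    apply: lee_nneseries => [k _ _|k _]; last exact: UI.
    by apply: integral_ge0 => x _; rewrite lee_fin.
  rewrite nneseriesD; last 2 first.
  - by move=> k _ _; apply: integral_ge0 => x _; rewrite lee_fin.
  - by move=> k _ _; rewrite mule_ge0 ?lee_fin.
  apply: leeD2l; rewrite -(fineK (mBfin j)).
  under eq_eseriesr do rewrite muleC.
  rewrite nneseriesZl//; last by move=> k _; rewrite lee_fin.
  by rewrite muleC lee_wpmul2r// lee_fin fine_ge0.
have LI : (\int[mu]_(x in B j) (\sum_(k <oo) (\1_(L k) x)%:E) <=
    \int[mu]_(x in B j) f x + mu (B j))%E.
  rewrite -[X in (_ + X)%E]mul1e -(integral_cst mu (mB j) 1).
  rewrite -ge0_integralD//; last exact: measurable_funTS.
  apply: ge0_le_integral_nomeas => x _; first by rewrite nneseries_ge0// => k _ _; rewrite lee_fin.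
  apply: le_trans (nneseries_ceil_le (f0 x)).
  apply: lee_nneseries => [k _ _|k _]; rewrite lee_fin// indicE.
  by rewrite (_ : (x \in L k) = (k%:R%:E < f x)%E)//; apply/idP/idP; rewrite inE.
apply: le_trans (leeD2l _ (leeD2r _ LI)) _.
have -> : ((j + 4)%:R%:E * mu (B j) = mu (B j) + mu (B j) + (j + 2)%:R%:E * mu (B j))%E.
  rewrite -(fineK (mBfin j)) -!EFinM -!EFinD; congr (_%:E).
  by rewrite !natrD; ring.
by rewrite addeA (addeA (mu (B j))) (addeC (mu (B j))) -!addeA.
Qed.

End lsc_majorant.

(** * Series *)

Section series_aux.
Context {R : realType}.

Lemma sum_geometric_le (x : R) n : 0 <= x -> x < 1 ->
  \sum_(0 <= k < n) x ^+ k <= (1 - x)^-1.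
Proof.
move=> x0 x1; have x1' : 0 < 1 - x by lra.
rewrite -(ler_pM2r x1') mulVf ?gt_eqF//.
suff -> : (\sum_(0 <= k < n) x ^+ k) * (1 - x) = 1 - x ^+ n.
  by rewrite gerBl exprn_ge0.
elim: n => [|n IH]; first by rewrite big_nil expr0; ring.
by rewrite big_nat_recr//= mulrDl IH exprS; ring.
Qed.

Lemma nneseries_geometric_lty (x : R) : 0 <= x -> x < 1 ->
  (\sum_(k <oo) (x ^+ k)%:E < +oo)%E.
Proof.
move=> x0 x1; apply: (@le_lt_trans _ _ ((1 - x)^-1)%:E); last exact: ltry.
apply: nneseries_le_bound => [k|n]; first by rewrite lee_fin exprn_ge0.
by rewrite sumEFin lee_fin sum_geometric_le.
Qed.

(* Telescoping against n^(1-a), using exp x >= 1 + x and ln x <= x - 1. *)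
Lemma nneseries_powR_lty (a : R) : 1 < a ->
  (\sum_(k <oo) (k.+1%:R `^ (- a))%:E < +oo)%E.
Proof.
move=> a1; pose b := a - 1; have b0 : 0 < b by rewrite subr_gt0.
have step n : b * n.+2%:R `^ (- a) <= n.+1%:R `^ (- b) - n.+2%:R `^ (- b).
  have n1 : 0 < n.+1%:R :> R by []. have n2 : 0 < n.+2%:R :> R by [].
  rewrite lerBrDr /powR !gt_eqF//.
  have -> : - a * ln n.+2%:R = - b * ln n.+2%:R - ln n.+2%:R :> R by rewrite /b; ring.
  rewrite expRD expRN lnK ?posrE//.
  have -> : - b * ln n.+1%:R = - b * ln n.+2%:R + b * (ln n.+2%:R - ln n.+1%:R) :> R by ring.
  rewrite expRD -[X in _ + X]mulr1 mulrCA -mulrDr ler_pM2l ?expR_gt0//.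
  apply: le_trans (expR_ge1Dx _); rewrite addrC lerD2l ler_pM2l//.
  have E : n.+1%:R / n.+2%:R = 1 + - n.+2%:R^-1 :> R.
    by rewrite -{1}(addrK 1 n.+1%:R) natr1 mulrBl mulfV ?gt_eqF// div1r.
  have : ln (n.+1%:R / n.+2%:R) <= - n.+2%:R^-1 :> R.
    by rewrite E le_ln1Dx// ltrN2 invf_lt1// ltr1n.
  rewrite ln_div ?posrE//; move: (ln n.+2%:R) (ln n.+1%:R) (n.+2%:R^-1) => ? ? ?; lra.
apply: (@le_lt_trans _ _ ((1 + b^-1)%:E)); last exact: ltry.
apply: nneseries_le_bound => [k|n]; first by rewrite lee_fin powR_ge0.
rewrite sumEFin lee_fin.
suff : b * \sum_(0 <= k < n) k.+1%:R `^ (- a) <= b + 1 - n.+1%:R `^ (- b) + n.+1%:R `^ (- b).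
  by rewrite subrK -ler_pdivlMl// mulrDr mulVf ?gt_eqF// mulr1.
apply: (@le_trans _ _ (b + 1 - n.+1%:R `^ (- b) + (n.+1%:R `^ (- b)))) => //.
case: n => [|n]; first by rewrite big_nil mulr0 subrK addr_ge0 ?ltW.
rewrite subrK; suff : b * \sum_(0 <= k < n.+1) k.+1%:R `^ (- a) <= b + 1 - n.+1%:R `^ (- b).
  by have := powR_ge0 n.+1%:R (- b); lra.
elim: n => [|n IH]; first by rewrite big_nat1 !powR1; lra.
by rewrite big_nat_recr//= mulrDr; have := step n; lra.
Qed.

End series_aux.

(** * Superlevel sets and decreasing rearrangements *)

Section levels.
Context {R : realType}.

(** Let i be the least index from j on with phi <= tau i. If i = j the first summand suffices;
    otherwise tau (i-1) < phi, and the term of index i - 1 is tau i ^ p. *)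
Lemma level_bound (phi : \bar R) (tau : nat -> R) (p : R) (j : nat) : 0 < p ->
  (0 <= phi)%E -> (forall i, 0 <= tau i) ->
  (exists2 i, (j <= i)%N & (phi <= (tau i)%:E)%E) ->
  (phi `^ p <= (tau j `^ p)%:E +
    \sum_(j <= i <oo) (tau i.+1 `^ p * ((tau i)%:E < phi)%E%:R)%:E)%E.
Proof.
move=> p0 phi0 tau0 [i0 ji0 phii0].
have t0 i : (0 <= (tau i.+1 `^ p * ((tau i)%:E < phi)%E%:R)%:E)%E.
  by rewrite lee_fin mulr_ge0// powR_ge0.
have ex : exists i, (j <= i)%N && (phi <= (tau i)%:E)%E by exists i0; rewrite ji0.
case: (ex_minnP ex) => i /andP[ji phii] imin.
have ptau k : (phi <= (tau k)%:E)%E -> (phi `^ p <= (tau k `^ p)%:E)%E.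
  by move=> pk; rewrite -poweR_EFin; apply: le_poweR => //; exact: ltW.
have [ij|ij] := eqVneq j i.
  by apply: le_trans (ptau j _) _; rewrite ?ij// leeDl// nneseries_ge0.
case: i ji phii imin ij => [|i] ji phii imin ij.
  by move: ji ij; rewrite leqn0 => ->.
have ji' : (j <= i)%N by move: ji ij; rewrite leq_eqVlt => /orP[->|].
have ti : ((tau i)%:E < phi)%E.
  by rewrite ltNge; apply/negP => pi; have := imin i; rewrite ji' pi ltnn => /(_ isT).
apply: le_trans (ptau _ phii) _.
apply: (@le_trans _ _ (\sum_(j <= k < i.+1) (tau k.+1 `^ p * ((tau k)%:E < phi)%E%:R)%:E)%E).
  by rewrite big_nat_recr//= ti mulr1 leeDr// sume_ge0.
apply: le_trans (nneseries_lim_ge _ _) _; first by move=> *; exact: t0.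
by rewrite leeDr// lee_fin powR_ge0.
Qed.

Lemma disjoint_steps_le (m : nat -> R) (c : nat -> \bar R) (t : R) (F : \bar R) :
  nonincreasing_seq m -> (0 <= F)%E -> (forall i, 0 <= c i)%E ->
  (forall i, m i.+1 <= t < m i -> (c i <= F)%E) ->
  (\sum_(i <oo) c i * (\1_(`[m i.+1, m i[) t : R)%:E <= F)%E.
Proof.
move=> dm F0 c0 cF; apply: nneseries_le_bound => [k|n].
  by rewrite mule_ge0// lee_fin.
(* The half-open steps are disjoint: the partial sum vanishes while t < m n and is at most F
   afterwards. *)
suff : (\sum_(0 <= i < n) c i * (\1_(`[m i.+1, m i[) t : R)%:E <=
    if (m n <= t)%R then F else 0)%E by move=> /le_trans; apply; case: ifP.
elim: n => [|n IH]; first by rewrite big_nil; case: ifP.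
rewrite big_nat_recr//= indicE; have mn := dm n n.+1 (leqnSn n).
case: ifPn => mnt1; last first.
  rewrite memNset ?mule0 ?adde0/=; last by rewrite in_itv/= (negbTE mnt1).
  move: IH; rewrite ifF//; apply/negbTE; apply: contra mnt1; exact: le_trans.
case: (lerP (m n) t) IH => mnt IH.
  by rewrite memNset ?mule0 ?adde0//= in_itv/= mnt1/= ltNge mnt.
rewrite mem_set/= ?in_itv/= ?mnt1// mule1 -[leRHS]add0e; apply: leeD => //.
by apply: cF; rewrite mnt1.
Qed.

Lemma integral_steps_ge (D : set R) (m : nat -> R) (c : nat -> \bar R) (F : R -> \bar R) :
  measurable D -> nonincreasing_seq m -> (forall i, `[m i.+1, m i[ `<=` D) ->
  (forall t, D t -> 0 <= F t)%E -> (forall i, 0 <= c i)%E ->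
  (forall i t, m i.+1 <= t < m i -> (c i <= F t)%E) ->
  (\sum_(i <oo) c i * (m i - m i.+1)%:E <=
    \int[lebesgue_measure]_(t in D) F t)%E.
Proof.
move=> mD dm mDi F0 c0 cF.
apply: (@le_trans _ _ (\int[lebesgue_measure]_(t in D)
    (\sum_(i <oo) c i * (\1_(`[m i.+1, m i[) t : R)%:E))%E).
  have mi i : measurable_fun D (fun t => (\1_(`[m i.+1, m i[) t : R)%:E).
    by apply/measurable_EFinP; exact: measurable_indic.
  have mci i : measurable_fun D (fun t => c i * (\1_(`[m i.+1, m i[) t : R)%:E)%E.
    exact: (@emeasurable_funM _ _ _ _ (cst (c i)) _ _ (mi i)).
  rewrite integral_nneseries//; last by move=> i t _; rewrite mule_ge0// lee_fin.
  apply: lee_nneseries => [i _ _|i _].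
    by rewrite mule_ge0// lee_fin subr_ge0 dm.
  rewrite ge0_integralZl//; last exact: (mi i).
  apply: (@le_trans _ _ (c i * lebesgue_measure (`[m i.+1, m i[%classic : set R))%E);
    last by rewrite integral_indic// (setIidl (mDi i)).
  rewrite lebesgue_measure_itv/= lte_fin.
  by case: ltP => [|mi']; rewrite ?EFinB// lee_wpmul2l// -EFinB lee_fin subr_le0.
apply: ge0_le_integral_nomeas => t Dt.
  by rewrite nneseries_ge0// => k _ _; rewrite mule_ge0// lee_fin.
by apply: disjoint_steps_le => [||//|i]; [exact: dm|exact: F0|exact: cF].
Qed.

End levels.

Section rearrangement.
Context {R : realType} {d : measure_display} {P : measurableMetricType R d}.
Variable mu : {measure set P -> \bar R}.
Implicit Types (E A : set P) (u f : P -> \bar R).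

Lemma rearrangement_ge0 E u t : (0 <= rearrangement mu E u t)%E.
Proof.
by apply: le_ereal_inf_tmp => _ [tau [tau0 _] <-]; rewrite lee_fin.
Qed.

Lemma rearrangement_nonincreasing E u t t' : t <= t' ->
  (rearrangement mu E u t' <= rearrangement mu E u t)%E.
Proof.
move=> tt'; apply: ereal_inf_le_tmp => _ [tau [tau0 H] <-]; exists tau => //.
by split => //; rewrite (le_trans H)// lee_fin.
Qed.

(** A finite infimum of admissible heights is admissible, by continuity of the measure from below
    along the sets {|u| > tau + 1/(n+1)}. *)
Lemma rearrangement_attained E u t (tau : R) : measurable E ->
  measurable_fun setT u -> rearrangement mu E u t = tau%:E ->
  (mu (E `&` [set x | tau%:E < `|u x|]) <= t%:E)%E.
Proof.
move=> mE mu_ Ht.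
pose A n := E `&` [set x | (tau + n.+1%:R^-1)%:E < `|u x|]%E.
have mS (a : R) : measurable (E `&` [set x | a%:E < `|u x|]%E).
  apply: measurableI => //; rewrite -[X in measurable X]setTI.
  by apply: emeasurable_fun_o_infty => //; exact: measurableT_comp.
have At n : (mu (A n) <= t%:E)%E.
  have : (rearrangement mu E u t < (tau + n.+1%:R^-1)%:E)%E.
    by rewrite Ht lte_fin ltrDl invr_gt0.
  move=> /ereal_inf_lt[_ [tau' [_ H] <-]]; rewrite lte_fin => tt'.
  apply: le_trans H; apply: le_measure; rewrite ?inE; [exact: mS|exact: mS|].
  by move=> x [Ex /= ux]; split => //=; apply: lt_trans ux; rewrite lte_fin.
have AU : E `&` [set x | tau%:E < `|u x|]%E = \bigcup_n A n.
  apply/seteqP; split => x /=.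
    move=> [Ex ux].
    have [n nu] : exists n, ((tau + n.+1%:R^-1)%:E < `|u x|)%E.
      move: ux; case: (`|u x|%E) => [r| |]// tr; last by exists 0%N; rewrite ltry.
      rewrite lte_fin -subr_gt0 in tr.
      near \oo => n; exists n; rewrite lte_fin -ltrBrDl.
      by near: n; exact: near_infty_natSinv_lt (PosNum tr).
    by exists n => //; split.
  move=> [n _ [Ex /= ux]]; split => //; apply: le_lt_trans ux.
  by rewrite lee_fin lerDl invr_ge0.
have mA n : measurable (A n) by exact: mS.
have cA : mu \o A @ \oo --> mu (\bigcup_n A n).
  apply: nondecreasing_cvg_mu => //; first exact: bigcupT_measurable.
  move=> a b ab; apply/subsetPset => x [Ex /= ux]; split => //=.
  by apply: le_lt_trans ux; rewrite lee_fin lerD2l lef_pV2 ?posrE// ler_nat ltnS.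
rewrite AU -(cvg_lim _ cA)//; apply: lime_le; first by apply/cvg_ex; eexists; exact: cA.
by apply: nearW => n; exact: At.
Unshelve. all: by end_near. Qed.

(** Integration of [level_bound]. The points where |f| exceeds every tau i have no admissible index,
    but they form a null set because m tends to 0. The shift between tau i.+1 and m i comes from the
    layer {tau i < |f| <= tau i.+1}. *)
Lemma integral_levels_le E A f (p : R) (tau m : nat -> R) : 0 < p ->
  measurable A -> A `<=` E -> measurable E -> measurable_fun setT f ->
  (forall i, 0 <= tau i) ->
  (forall i, (mu (E `&` [set x | (tau i)%:E < `|f x|]) <= (m i)%:E)%E) ->
  m @ \oo --> 0 ->
  (\int[mu]_(x in A) (`|f x| `^ p) <= (tau 0%N `^ p)%:E * mu A +
    \sum_(i <oo) (tau i.+1 `^ p * m i)%:E)%E.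
Proof.
move=> p0 mA AE mE mf tau0 mum m0.
pose L i := [set x | (tau i)%:E < `|f x|]%E.
have maf : measurable_fun setT (fun x => `|f x|%E) by exact: measurableT_comp.
have mL i : measurable (L i).
  by rewrite -[X in measurable X]setTI; exact: emeasurable_fun_o_infty.
pose N := A `&` \bigcap_i L i.
have mN : measurable N.
  by apply: measurableI => //; exact: bigcapT_measurable.
have N0 : mu N = 0%E.
  apply/eqP; rewrite eq_le measure_ge0 andbT.
  have Nm i : (mu N <= (m i)%:E)%E.
    apply: le_trans (mum i); apply: le_measure; rewrite ?inE//.
      exact: (measurableI _ _ mE (mL i)).
    by move=> x [Ax Lx]; split; [exact: AE|exact: (Lx i I)].
  have cm : (EFin \o m) n @[n --> \oo] --> 0%E by apply: cvg_EFin => //; exact: nearW.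
  apply: (cvge_to_ge cm).
  by apply: nearW => i; exact: Nm.
pose t i x := (tau i.+1 `^ p * ((tau i)%:E < `|f x|)%E%:R)%:E.
have t0 i x : (0 <= t i x)%E by rewrite lee_fin mulr_ge0// powR_ge0.
have LE i x : ((tau i)%:E < `|f x|)%E%:R = \1_(L i) x :> R.
  rewrite indicE; congr (_%:R); congr nat_of_bool.
  by apply/idP/idP; rewrite inE.
have mt i : measurable_fun A (t i).
  apply/measurable_EFinP; apply: measurable_funM => //.
  under eq_fun do rewrite LE; exact: measurable_indic.
apply: (@le_trans _ _ (\int[mu]_(x in A) ((tau 0%N `^ p)%:E + \sum_(i <oo) t i x))%E).
  apply: ae_ge0_le_integral => //.
  - by move=> x _; rewrite poweR_ge0.
  - apply: measurable_funTS; exact: (measurableT_comp (measurable_poweR p)).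
  - by move=> x _; rewrite adde_ge0 ?nneseries_ge0// lee_fin powR_ge0.
  - apply: emeasurable_funD => //; apply: ge0_emeasurable_sum => //.
  exists N; split => // x /= /not_implyP[Ax nx]; split => // i _.
  rewrite /L/= ltNge; apply/negP => fi; apply: nx.
  by apply: level_bound => //; exists i.
rewrite ge0_integralD//; last 3 first.
- by move=> x _; rewrite lee_fin powR_ge0.
- by move=> x _; rewrite nneseries_ge0.
- by apply: ge0_emeasurable_sum.
rewrite integral_cst//; apply: leeD2l.
rewrite integral_nneseries//.
apply: lee_nneseries => [i _ _|i _]; first exact: integral_ge0.
rewrite /t; under eq_integral do rewrite LE EFinM.
rewrite ge0_integralZl; [|exact: mA| |by move=> x _; rewrite lee_fin
  |by rewrite lee_fin powR_ge0]; last by apply/measurable_EFinP; exact: measurable_indic.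
rewrite EFinM lee_wpmul2l ?lee_fin ?powR_ge0// integral_indic//.
apply: le_trans (mum i); apply: le_measure; rewrite ?inE; [exact: measurableI|exact: (measurableI _ _ mE (mL i))|].
by rewrite setIC; exact: setSI.
Qed.

End rearrangement.

Section nneseries_aux.
Context {R : realType}.

Lemma nneseries_shift_le (u : nat -> \bar R) (j : nat) : (forall i, 0 <= u i)%E ->
  (\sum_(k <oo) u (j + k)%N <= \sum_(i <oo) ((j <= i)%N%:R : R)%:E * u i)%E.
Proof.
move=> u0; apply: nneseries_le_bound => // n.
apply: (@le_trans _ _ (\sum_(0 <= i < j + n) ((j <= i)%N%:R : R)%:E * u i)%E); last first.
  by apply: nneseries_lim_ge => i _ _; rewrite mule_ge0// lee_fin.
have v0 i : (0 <= ((j <= i)%N%:R : R)%:E * u i)%E by rewrite mule_ge0// lee_fin.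
rewrite (big_cat_nat (leq0n j) (leq_addr n j)) /=.
apply: (@le_trans _ _ (\sum_(j <= i < j + n) ((j <= i)%N%:R : R)%:E * u i)%E); last first.
  by rewrite leeDr// sume_ge0.
rewrite -{2}(add0n j) [(j + n)%N]addnC big_addn addnK; apply: lee_sum => k _.
by rewrite leq_addl mul1e addnC.
Qed.

Lemma nneseries_le_term (u : nat -> \bar R) (i : nat) : (forall i, 0 <= u i)%E ->
  (u i <= \sum_(k <oo) u k)%E.
Proof.
move=> u0; apply: le_trans (nneseries_lim_ge i.+1 _); last by move=> *; exact: u0.
by rewrite big_nat_recr//= leeDr// sume_ge0.
Qed.

Lemma nneseries_recl_le (u : nat -> \bar R) : (forall i, 0 <= u i)%E ->
  (u 0%N \is a fin_num -> u 0%N + \sum_(k <oo) u k.+1 <= \sum_(i <oo) u i)%E.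
Proof.
move=> u0 f0; rewrite addeC -leeBrDr//; apply: nneseries_le_bound => // n.
rewrite leeBrDr// addeC -(@big_nat_recl _ _ _ n 0%N)//.
by apply: nneseries_lim_ge => *; exact: u0.
Qed.

Lemma nneseries_shift_le0 (u : nat -> \bar R) (j : nat) : (forall i, 0 <= u i)%E ->
  (\sum_(k <oo) u (j + k)%N <= \sum_(i <oo) u i)%E.
Proof.
move=> u0; apply: le_trans (nneseries_shift_le _ u0) _.
apply: lee_nneseries => [i _ _|i _]; first by rewrite mule_ge0// lee_fin.
by case: (j <= i)%N; rewrite ?mul1e ?mul0e.
Qed.

(* [a_i^p <= A^(p-1) a_i] for [A = sum a_i]. *)
Lemma nneseries_powR_le (a : nat -> R) (p : R) : 1 <= p -> (forall i, 0 <= a i) ->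
  (\sum_(i <oo) (a i `^ p)%:E <= (\sum_(i <oo) (a i)%:E) `^ p)%E.
Proof.
move=> p1 a0; have p0 : 0 < p by lra.
have a0E i : (0 <= (a i)%:E)%E by rewrite lee_fin.
have S0 : (0 <= \sum_(i <oo) (a i)%:E)%E by exact: nneseries_ge0.
case AE : (\sum_(i <oo) (a i)%:E)%E S0 => [A| |]//; last first.
  by move=> _; rewrite poweRyr ?gt_eqF// leey.
rewrite lee_fin => A0.
have aA i : a i <= A by rewrite -lee_fin -AE nneseries_le_term.
have apA i : a i `^ p <= A `^ (p - 1) * a i.
  have [->|ai0] := eqVneq (a i) 0; first by rewrite powR0 ?gt_eqF// mulr0.
  have -> : a i `^ p = a i `^ (p - 1) * a i `^ 1.
    by rewrite -powRD ?subrK// ai0 implybT.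
  by rewrite powRr1// ler_wpM2r// ge0_ler_powR ?nnegrE// subr_ge0.
apply: (@le_trans _ _ ((A `^ (p - 1))%:E * \sum_(i <oo) (a i)%:E)%E).
  rewrite -nneseriesZl//; apply: lee_nneseries => [i _ _|i _]; rewrite ?lee_fin ?powR_ge0//.
rewrite AE -EFinM poweR_EFin lee_fin.
have [->|A00] := eqVneq A 0; first by rewrite mulr0 powR_ge0.
rewrite -{2}(powRr1 A0) -powRD ?subrK//.
by rewrite A00 implybT.
Qed.

(** After exchanging the sums, the double series is at most the product of the two single ones. *)
Lemma nneseries_geometric_conv (e : nat -> R) (eta : R) : 0 <= eta -> eta < 1 ->
  (forall i, 0 <= e i) -> (\sum_(i <oo) (e i)%:E < +oo)%E ->
  (\sum_(j <oo) \sum_(k <oo) (e (j + k)%N * eta ^+ k)%:E < +oo)%E.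
Proof.
move=> eta0 eta1 e0 eoo.
rewrite (nneseries_interchange xpredT xpredT); last first.
  by move=> i j; rewrite lee_fin mulr_ge0// exprn_ge0.
have E0 : (0 <= \sum_(i <oo) (e i)%:E)%E by apply: nneseries_ge0 => *; rewrite lee_fin.
apply: (@le_lt_trans _ _ (\sum_(k <oo) (\sum_(i <oo) (e i)%:E) * (eta ^+ k)%:E)%E).
  apply: lee_nneseries => [k _ _|k _].
    by apply: nneseries_ge0 => *; rewrite lee_fin mulr_ge0// exprn_ge0.
  under eq_eseriesr do rewrite EFinM muleC.
  rewrite nneseriesZl; last by move=> i _; rewrite lee_fin.
  rewrite muleC lee_wpmul2r ?lee_fin ?exprn_ge0//.
  under eq_eseriesr do rewrite addnC.
  by apply: (@nneseries_shift_le0 (fun i => (e i)%:E)) => i; rewrite lee_fin.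
have Ef : (\sum_(i <oo) (e i)%:E)%E \is a fin_num by rewrite ge0_fin_numE.
rewrite -(fineK Ef).
rewrite nneseriesZl; last by move=> *; rewrite lee_fin exprn_ge0.
have G := nneseries_geometric_lty eta0 eta1.
have G0 : (0 <= \sum_(k <oo) (eta ^+ k)%:E)%E.
  by apply: nneseries_ge0 => *; rewrite lee_fin exprn_ge0.
have Gf : (\sum_(k <oo) (eta ^+ k)%:E)%E \is a fin_num by rewrite ge0_fin_numE.
by rewrite -(fineK Gf) -EFinM ltry.
Qed.

(** After exchanging the sums, b i is counted once for each j <= i, that is i + 1 times. *)
Lemma nneseries_tails_lty (b : nat -> R) : (forall i, 0 <= b i) ->
  (\sum_(i <oo) (i.+1%:R * b i)%:E < +oo)%E ->
  (\sum_(j <oo) \sum_(k <oo) (b (j + k)%N)%:E < +oo)%E.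
Proof.
move=> b0; apply: le_lt_trans.
have b0E i : (0 <= (b i)%:E)%E by rewrite lee_fin.
apply: (@le_trans _ _ (\sum_(j <oo) \sum_(i <oo) ((j <= i)%N%:R : R)%:E * (b i)%:E)%E).
  apply: lee_nneseries => [j _ _|j _]; first exact: nneseries_ge0.
  exact: nneseries_shift_le.
rewrite (nneseries_interchange xpredT xpredT); last first.
  by move=> i j; rewrite mule_ge0// lee_fin.
apply: lee_nneseries => [i _ _|i _].
  by apply: nneseries_ge0 => j _ _; rewrite mule_ge0// lee_fin.
apply: nneseries_le_bound => [j|n]; first by rewrite mule_ge0// lee_fin.
under eq_bigr do rewrite -EFinM.
rewrite sumEFin lee_fin -mulr_suml ler_wpM2r//.
suff : \sum_(0 <= j < n) (j <= i)%N%:R <= (minn n i.+1)%:R :> R.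
  by move=> /le_trans; apply; rewrite ler_nat geq_minr.
elim: n => [|n IH]; first by rewrite big_nil.
rewrite big_nat_recr//=; apply: le_trans (lerD IH (lexx _)) _.
rewrite -natrD ler_nat; have [ni|ni] := leqP n i.
  have ni' : (n.+1 <= i.+1)%N by [].
  by rewrite (minn_idPl (leqW ni)) (minn_idPl ni') addn1.
by rewrite addn0 leq_min geq_minr andbT (leq_trans (geq_minl _ _)).
Qed.

End nneseries_aux.

(** * Growth of averages under the embeddings *)

Section growth.
Context {R : realType} {d : measure_display} {P : measurableMetricType R d}.
Variable mu : {measure set P -> \bar R}.
Hypotheses (br : borel_regular mu) (bfp : balls_finite_positive mu).
Implicit Types (f v : P -> \bar R).

Lemma measurable_ball_metric (x : P) (r : R) : measurable (ball x r).
Proof. by apply: (open_measurable_metric br); exact: metric_ball_open. Qed.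

Lemma ball_measure_gt0 (x : P) (r : R) : 0 < r -> (0 < mu (ball x r))%E.
Proof. by move=> /(bfp x)/andP[]. Qed.

Lemma ball_measure_fin (x : P) (r : R) : 0 < r -> mu (ball x r) \is a fin_num.
Proof. by move=> /(bfp x)/andP[/ltW ? ?]; rewrite ge0_fin_numE. Qed.

Lemma ball_sub (x y : P) (r r' : R) : mdist x y + r <= r' -> ball y r `<=` ball x r'.
Proof.
move=> H z; rewrite !ballEmdist/= => yz.
have := metric_triangle x y z; lra.
Qed.

(** The same r0 scales the balls and the region of their centres. It will be the dilation constant
    of the Poincare inequality, so that S j bounds the gradient term at radius 2^-j. *)
Definition growth_bound (p : R) (x0 : P) (r0 : R) f := exists S : nat -> R,
  [/\ forall j, 0 <= S j, (\sum_(j <oo) (2^-1 ^+ j * S j)%:E < +oo)%E &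
    forall y j, ball x0 r0 y ->
      (average mu (ball y (r0 * 2^-1 ^+ j)) (fun z => `|f z| `^ p) `^ p^-1 <=
        (S j)%:E)%E].

Lemma average_le (B : set P) (h : P -> \bar R) (m c : R) : measurable B ->
  0 < m -> (m%:E <= mu B)%E -> (mu B < +oo)%E -> 0 <= c ->
  (\int[mu]_(x in B) h x <= c%:E * mu B)%E -> (average mu B h <= c%:E)%E.
Proof.
move=> mB m0 mmu muoo c0 H; rewrite /average.
have muf : mu B \is a fin_num by rewrite ge0_fin_numE.
have mu0 : 0 < fine (mu B).
  by apply: lt_le_trans m0 _; rewrite -lee_fin fineK.
move: H; rewrite -(fineK muf) inver (gt_eqF mu0) => H.
apply: (@le_trans _ _ ((fine (mu B))^-1%:E * (c%:E * (fine (mu B))%:E))%E).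
  by rewrite lee_wpmul2l// lee_fin invr_ge0 ltW.
by rewrite -!EFinM mulrCA mulVf ?gt_eqF// mulr1.
Qed.

Variables (s : R) (s0 : 0 < s) (dim : dimension_condition mu s).

(** The factor by which the lower bound of the dimension condition shrinks when the radius is
    halved. *)
Let theta : R := 2^-1 `^ s.

Lemma powR_lt1 (x q : R) : 0 <= x -> x < 1 -> 0 < q -> x `^ q < 1.
Proof.
move=> x0 x1 q0; have : x `^ q < 1 `^ q by apply: gt0_ltr_powR => //; rewrite nnegrE.
by rewrite powR1.
Qed.

Let theta_gt0 : 0 < theta. Proof. by apply: powR_gt0; rewrite invr_gt0. Qed.

Let theta_lt1 : theta < 1. Proof. by apply: powR_lt1 => //; lra. Qed.

Let theta_exp_gt0 j : 0 < theta ^+ j. Proof. exact: exprn_gt0. Qed.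

Lemma powR_exprn (x q : R) j : 0 <= x -> (x ^+ j) `^ q = (x `^ q) ^+ j.
Proof.
by move=> x0; rewrite -(powR_mulrn j x0) -(powR_mulrn j (powR_ge0 x q)) -!powRrM mulrC.
Qed.

Lemma ball_measure_ge (x0 : P) (r0 : R) : 0 < r0 ->
  exists m : R, [/\ 0 < m, (m%:E <= mu (ball x0 r0))%E &
    forall y j, ball x0 r0 y ->
     ((m * theta ^+ j)%:E <= mu (ball y (r0 * 2^-1 ^+ j)))%E].
Proof.
move=> r00; have [c c0 cP] := dim.
have Bf := ball_measure_fin x0 r00.
have B0 : 0 < fine (mu (ball x0 r0)).
  by rewrite fine_gt0// ball_measure_gt0// ltey_eq Bf.
have H y j : ball x0 r0 y ->
     ((fine (mu (ball x0 r0)) * c * theta ^+ j)%:E <= mu (ball y (r0 * 2^-1 ^+ j)))%E.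
  move=> yB; have rj : 0 < r0 * 2^-1 ^+ j <= r0.
    by rewrite mulr_gt0 ?exprn_gt0//= ger_pMr// exprn_ile1//; lra.
  have := cP x0 y _ _ rj yB.
  rewrite mulrAC mulfV ?gt_eqF// mul1r powR_exprn; last by lra.
  rewrite -(fineK Bf) inver (gt_eqF B0) lee_pdivlMr// -EFinM fineK//.
  by rewrite mulrC mulrA.
exists (fine (mu (ball x0 r0)) * c); split => //; first exact: mulr_gt0.
by have := H x0 0%N (ballxx _ r00); rewrite !expr0 !mulr1.
Qed.

(** With b_i = m theta^i tau_i^p, integrating over the levels from j on gives tau_j^p mu(B) plus
    theta^-1 times the sum of the b_i with i > j, where B = B(y, r0 2^-j) and theta^-1 pays for the
    index shift. As mu(B) >= m theta^j, the average is at most theta^-1 (m theta^j)^-1 times the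
    tail of the b_i from j. *)
Lemma levels_growth_bound (p : R) (x0 : P) (r0 m : R) f (tau : nat -> R) :
  0 < p -> 0 < r0 -> measurable_fun setT f -> 0 < m ->
  (forall y j, ball x0 r0 y ->
     ((m * theta ^+ j)%:E <= mu (ball y (r0 * 2^-1 ^+ j)))%E) ->
  (forall i, 0 <= tau i) ->
  (forall i, (mu (ball x0 (2 * r0) `&` [set x | (tau i)%:E < `|f x|]) <=
     (m * theta ^+ i)%:E)%E) ->
  (\sum_(k <oo) (m * theta ^+ k * tau k `^ p)%:E < +oo)%E ->
  (\sum_(j <oo) (2^-1 ^+ j * ((theta^-1 * (m * theta ^+ j)^-1) *
     fine (\sum_(k <oo) (m * theta ^+ (j + k) * tau (j + k)%N `^ p)%:E)) `^ p^-1)%:E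
     < +oo)%E ->
  growth_bound p x0 r0 f.
Proof.
move=> p0 r00 mf m0 mball tau0 mutau T0oo Soo.
pose b i := m * theta ^+ i * tau i `^ p.
have b0 i : 0 <= b i by rewrite mulr_ge0 ?powR_ge0// mulr_ge0 ?ltW.
have b0E i : (0 <= (b i)%:E)%E by rewrite lee_fin.
pose T j := (\sum_(k <oo) (b (j + k)%N)%:E)%E.
have T0 j : (0 <= T j)%E by exact: nneseries_ge0.
have Tf j : T j \is a fin_num.
  rewrite (ge0_fin_numE (T0 j)); apply: le_lt_trans T0oo.
  exact: (@nneseries_shift_le0 _ (fun i => (b i)%:E)).
set C := fun j => (theta^-1 * (m * theta ^+ j)^-1) * fine (T j).
have C0 j : 0 <= C j.
  rewrite /C mulr_ge0 ?fine_ge0// mulr_ge0 ?invr_ge0 ?ltW//; exact: mulr_gt0.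
exists (fun j => C j `^ p^-1); split; [by move=> j; exact: powR_ge0|exact: Soo|].
move=> y j yB; have rj0 : 0 < r0 * 2^-1 ^+ j by rewrite mulr_gt0// exprn_gt0.
have mj0 : 0 < m * theta ^+ j by rewrite mulr_gt0.
rewrite -poweR_EFin; apply: le_poweR; first by rewrite invr_ge0 ltW.
  rewrite /average mule_ge0 ?integral_ge0//; last by move=> *; exact: poweR_ge0.
  by rewrite inve_ge0.
apply: (average_le _ mj0) => //; [exact: measurable_ball_metric|exact: mball| |].
  by rewrite -ge0_fin_numE// ball_measure_fin.
have sub : ball y (r0 * 2^-1 ^+ j) `<=` ball x0 (2 * r0).
  apply: ball_sub; move: yB; rewrite ballEmdist/= => yB.
  have : r0 * 2^-1 ^+ j <= r0 by rewrite ger_pMr// exprn_ile1//; lra.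
  lra.
have cm : (fun k => m * theta ^+ (j + k)) @ \oo --> 0.
  under eq_fun do rewrite exprD mulrA.
  by apply: cvg_geometric; rewrite ger0_norm ?ltW.
have L := @integral_levels_le _ _ _ mu _ _ f p (fun k => tau (j + k)%N)
  (fun k => m * theta ^+ (j + k)) p0 (measurable_ball_metric y (r0 * 2^-1 ^+ j)) sub
  (measurable_ball_metric _ _) mf (fun k => tau0 _) (fun k => mutau _) cm.
apply: (le_trans L); rewrite addn0.
have -> : (\sum_(i <oo) (tau (j + i.+1)%N `^ p * (m * theta ^+ (j + i)))%:E =
    (theta^-1)%:E * \sum_(i <oo) (b (j + i.+1)%N)%:E)%E.
  rewrite -nneseriesZl//; apply: eq_eseriesr => i _.
  rewrite -EFinM /b addnS exprS; congr (_%:E); field; exact: lt0r_neq0.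
have HT : ((b j)%:E + \sum_(i <oo) (b (j + i.+1)%N)%:E <= T j)%E.
  by have := @nneseries_recl_le _ (fun k => (b (j + k)%N)%:E); rewrite addn0; apply.
have bT : b j <= fine (T j).
  rewrite -lee_fin fineK//; apply: le_trans HT.
  by rewrite leeDl// nneseries_ge0.
have muf := ball_measure_fin y rj0.
have mM := mball y j yB; rewrite -(fineK muf) lee_fin in mM.
set M := fine _ in mM; rewrite -(fineK muf) -/M.
apply: (@le_trans _ _ ((tau j `^ p)%:E * M%:E + theta^-1%:E * (fine (T j) - b j)%:E)%E).
  rewrite leeD2lE// lee_wpmul2l ?lee_fin ?invr_ge0 ?(ltW theta_gt0)//.
  by rewrite EFinB fineK// leeBrDr// addeC.
rewrite -!EFinM -EFinD lee_fin /C -mulrA.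
have -> : tau j `^ p = b j / (m * theta ^+ j) by rewrite /b mulrC mulKf// lt0r_neq0.
have K1 : 1 <= M / (m * theta ^+ j) by rewrite ler_pdivlMr// mul1r.
have K2 : 1 <= theta^-1 by rewrite invf_ge1// ltW.
have -> : b j / (m * theta ^+ j) * M = b j * (M / (m * theta ^+ j)) by ring.
have -> : theta^-1 * ((m * theta ^+ j)^-1 * fine (T j)) * M =
  theta^-1 * (M / (m * theta ^+ j)) * fine (T j) by ring.
(* Both factors are at least 1, so the coefficients K of b_j and t of the rest of the tail can be
   raised to t K. *)
move: (M / _) (theta^-1) K1 K2 => K t K1 K2.
have Kt : K <= t * K by rewrite ler_peMl//; lra.
have tK : t <= t * K by rewrite ler_peMr//; lra.
have h1 : b j * K <= b j * (t * K) by rewrite ler_wpM2l.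
have h2 : t * (fine (T j) - b j) <= t * K * (fine (T j) - b j).
  by rewrite ler_wpM2r// subr_ge0.
have -> : t * K * fine (T j) = b j * (t * K) + t * K * (fine (T j) - b j) by ring.
exact: lerD.
Qed.

End growth.

(** * Growth bounds in the four cases *)

Section growth_cases.
Context {R : realType} {d : measure_display} {P : measurableMetricType R d}.
Variable mu : {measure set P -> \bar R}.
Hypotheses (br : borel_regular mu) (bfp : balls_finite_positive mu).
Variables (s : R) (s0 : 0 < s) (dim : dimension_condition mu s).
Let theta : R := 2^-1 `^ s.
Let theta_gt0 : 0 < theta. Proof. by apply: powR_gt0; rewrite invr_gt0. Qed.
Let theta_lt1 : theta < 1. Proof. by apply: powR_lt1 => //; lra. Qed.
Variables (x0 : P) (r0 : R) (f : P -> \bar R).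
Hypotheses (r00 : 0 < r0) (mf : measurable_fun setT f).
Let B := ball x0 (2 * r0).
Let fB := fun y => (f y * (\1_B y)%:E)%E.
Variable m : R.
Hypotheses (m0 : 0 < m)
  (mball : forall y j, ball x0 r0 y ->
     ((m * theta ^+ j)%:E <= mu (ball y (r0 * 2^-1 ^+ j)))%E).

Let r20 : 0 < 2 * r0. Proof. by rewrite mulr_gt0. Qed.
Let mB : measurable B. Proof. exact: (measurable_ball_metric br). Qed.
Let Bfin : mu B \is a fin_num. Proof. exact: (ball_measure_fin bfp). Qed.
Let m_gt0 i : 0 < m * theta ^+ i. Proof. by rewrite mulr_gt0// exprn_gt0. Qed.

Let m_dec : nonincreasing_seq (fun i => m * theta ^+ i).
Proof.
by move=> i j ij; rewrite ler_pM2l// ler_wiXn2l// ltW.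
Qed.

Let mfB : measurable_fun setT fB.
Proof.
apply: emeasurable_funM => //; apply/measurable_EFinP; exact: measurable_indic.
Qed.

(** Every average is bounded by the full integral over B divided by m theta^j, so 2^-j S j is
    geometric with ratio 2^-(1 - s/p), which is below 1 because s < p. *)
Lemma integral_abs_growth (p : R) : s < p ->
  (\int[mu]_(x in B) (`|f x| `^ p) < +oo)%E -> growth_bound mu p x0 r0 f.
Proof.
move=> sp Ioo; have p0 : 0 < p by exact: lt_trans sp.
have I0 : (0 <= \int[mu]_(x in B) (`|f x| `^ p))%E.
  by apply: integral_ge0 => x _; exact: poweR_ge0.
set I := (\int[mu]_(x in B) _)%E in Ioo I0.
have If : I \is a fin_num by rewrite ge0_fin_numE.
have K0 j : 0 <= (m * theta ^+ j)^-1 * fine I.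
  by rewrite mulr_ge0 ?fine_ge0// invr_ge0 ltW.
exists (fun j => ((m * theta ^+ j)^-1 * fine I) `^ p^-1); split.
- by move=> j; exact: powR_ge0.
- pose q := 2^-1 * theta^-1 `^ p^-1.
  have it0 : 0 <= theta^-1 by rewrite invr_ge0 ltW.
  have q0 : 0 <= q by rewrite mulr_ge0 ?powR_ge0// invr_ge0.
  have q1 : q < 1.
    have -> : q = 2^-1 `^ (1 - s / p).
      rewrite /q /theta -powRN -powRrM powRD; last by rewrite invr_neq0 ?implybT// pnatr_eq0.
      by rewrite powRr1 ?invr_ge0// mulNr.
    apply: powR_lt1; [by rewrite invr_ge0|by lra|].
    by rewrite subr_gt0 ltr_pdivrMr// mul1r.
  rewrite (eq_eseriesr (g := fun j => ((m^-1 * fine I) `^ p^-1)%:E * (q ^+ j)%:E)%E).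
    rewrite nneseriesZl; last by move=> i _; rewrite lee_fin exprn_ge0.
    have G := nneseries_geometric_lty q0 q1.
    have G0 : (0 <= \sum_(k <oo) (q ^+ k)%:E)%E.
      by apply: nneseries_ge0 => *; rewrite lee_fin exprn_ge0.
    have Gf : (\sum_(k <oo) (q ^+ k)%:E)%E \is a fin_num by rewrite ge0_fin_numE.
    by rewrite -(fineK Gf) -EFinM ltry.
  move=> j _; rewrite -EFinM; congr (_%:E).
  rewrite invfM -exprVn -mulrA [_ * fine I]mulrC mulrA.
  rewrite powRM ?exprn_ge0//; last by rewrite mulr_ge0 ?fine_ge0// invr_ge0 ltW.
  by rewrite powR_exprn// /q exprMn; ring.
- move=> y j yB; rewrite -poweR_EFin.
  have rj0 : 0 < r0 * 2^-1 ^+ j by rewrite mulr_gt0// exprn_gt0.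
  apply: le_poweR; first by rewrite invr_ge0 ltW.
    rewrite /average mule_ge0 ?integral_ge0//; last by move=> *; exact: poweR_ge0.
    by rewrite inve_ge0.
  have mBj : measurable (ball y (r0 * 2^-1 ^+ j)) by exact: (measurable_ball_metric br).
  have Mf := ball_measure_fin bfp y rj0.
  apply: (average_le _ (m_gt0 j)) => //; first exact: mball.
    by rewrite -ge0_fin_numE.
  apply: (@le_trans _ _ (fine I)%:E).
    rewrite fineK//; apply: ge0_subset_integral => //.
    + apply: measurable_funTS; apply: (measurableT_comp (measurable_poweR p)).
      exact: measurableT_comp.
    + by move=> x _; exact: poweR_ge0.
    + apply: ball_sub; move: yB; rewrite ballEmdist/= => yB.
      have : r0 * 2^-1 ^+ j <= r0 by rewrite ger_pMr// exprn_ile1//; lra.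
      lra.
  have := mball j yB; rewrite -(fineK Mf) lee_fin => mM.
  rewrite -EFinM lee_fin mulrAC ler_peMl ?fine_ge0//.
  by rewrite mulrC ler_pdivlMr// mul1r.
Qed.

(** B has finite measure, so |f|^p <= 1 + |f|^q settles finite q, and the bound by the essential
    supremum settles q = +oo. *)
Lemma Lnorm_growth (p : R) (q : \bar R) : s < p -> (p%:E <= q)%E ->
  (Lnorm mu q fB < +oo)%E -> growth_bound mu p x0 r0 f.
Proof.
move=> sp pq Loo; have p0 : 0 < p by exact: lt_trans sp.
apply: (integral_abs_growth sp).
have fBE x : B x -> fB x = f x by move=> Bx; rewrite /fB indicE mem_set// mule1.
have mpow (v : P -> \bar R) (r : R) (D : set P) : measurable_fun setT v ->
    measurable_fun D (fun x => `|v x| `^ r)%E.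
  move=> mv; apply: measurable_funTS; apply: (measurableT_comp (measurable_poweR r)).
  exact: measurableT_comp.
case: q pq Loo => [q| |]//; rewrite unlock.
- rewrite lee_fin => pq /lty_poweRy H.
  have q0 : 0 < q by exact: lt_le_trans pq.
  have {}H := H (invr_neq0 (lt0r_neq0 q0)).
  apply: (@le_lt_trans _ _ (\int[mu]_(x in B) (1 + `|f x| `^ q))%E).
    apply: ge0_le_integral_nomeas => x _; first exact: poweR_ge0.
    case: (`|f x|%E) (abse_ge0 (f x)) => [r| |]// r1; last first.
      by rewrite !poweRyr ?gt_eqF// leey.
    rewrite !poweR_EFin -EFinD lee_fin; rewrite lee_fin in r1.
    have [r11|r11] := leP r 1.
      apply: (@le_trans _ _ 1); last by rewrite lerDl powR_ge0.
      by have := @ge0_ler_powR R p (ltW p0) r 1; rewrite !nnegrE powR1; apply.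
    by apply: (@le_trans _ _ (r `^ q)); [exact: (ler_powR (ltW r11) pq)|rewrite lerDr].
  rewrite ge0_integralD//; [|by move=> *; exact: poweR_ge0|exact: mpow].
  rewrite integral_cst// mul1e lte_add_pinfty//; first by rewrite -ge0_fin_numE.
  apply: le_lt_trans H; rewrite [leLHS]integral_mkcond.
  apply: ge0_le_integral_nomeas => x _; rewrite /patch; case: ifPn => //.
  + by move=> *; exact: poweR_ge0.
  + by rewrite inE => /fBE ->.
  + by move=> *; exact: poweR_ge0.
- move=> _; have muT : (0 < mu [set: P])%E.
    apply: lt_le_trans (ball_measure_gt0 bfp x0 r20) _.
    by apply: le_measure; rewrite ?inE.
  rewrite muT; set M := ess_sup _ _ => Moo.
  have aeM : {ae mu, forall x, (`|fB x| <= M)%E} by exact: ess_sup_ge.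
  have M0 : (0 <= M)%E by apply: ess_sup_gee => //; apply: nearW => x /=.
  apply: (@le_lt_trans _ _ (\int[mu]_(x in B) (cst (M `^ p) x))%E).
    apply: ae_ge0_le_integral => //; [|exact: mpow| |].
    + by move=> x _; exact: poweR_ge0.
    + by move=> x _; exact: poweR_ge0.
    + move: aeM; apply: filterS => x fM Bx.
      by apply: le_poweR => //; [exact: ltW|rewrite -(fBE _ Bx)].
  rewrite integral_cst//.
  have Mf : (M `^ p)%E \is a fin_num by rewrite fin_num_poweR// ge0_fin_numE.
  by rewrite -(fineK Bfin) -(fineK Mf) -EFinM ltry.
Qed.

Section rearrangement_cases.
Variables (E : set P) (mE : measurable E) (BE : B `<=` E).
Let rho i := rearrangement mu E fB (m * theta ^+ i).

Let rho_level i (tau : R) : 0 <= tau -> rho i = tau%:E ->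
  (mu (B `&` [set x | tau%:E < `|f x|]) <= (m * theta ^+ i)%:E)%E.
Proof.
move=> tau0 /(rearrangement_attained mE mfB); apply: le_trans.
have mL v : measurable_fun setT v -> measurable [set x : P | (tau%:E < `|v x|)%E].
  move=> mv; rewrite -[X in measurable X]setTI.
  by apply: emeasurable_fun_o_infty => //; exact: measurableT_comp.
apply: le_measure; rewrite ?inE.
- by apply: measurableI => //; exact: mL.
- by apply: measurableI => //; exact: mL.
move=> x [Bx /= fx]; split; first exact: BE.
by rewrite /= /fB indicE mem_set// mule1.
Qed.

(** Sampling the rearrangement at m theta^i: on [m theta^(i+1), m theta^i[ it is at least its value
    at the right end and W is at least w i, while the length is (1 - theta) m theta^i. Finiteness of
    the integral forces the sampled values to be finite, so they can serve as levels. The set E is B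
    for Zygmund norms and the whole space for Lorentz norms. *)
Lemma rearrangement_steps (D : set R) (W : R -> R) (w : nat -> R) (q : R) :
  0 < q -> measurable D -> (forall t, D t -> 0 <= W t) ->
  (forall i, `[m * theta ^+ i.+1, m * theta ^+ i[ `<=` D) ->
  (forall i, 0 < w i) ->
  (forall i t, m * theta ^+ i.+1 <= t < m * theta ^+ i -> w i <= W t) ->
  (\int[lebesgue_measure]_(t in D)
    ((rearrangement mu E fB t * (W t)%:E) `^ q) < +oo)%E ->
  exists tau : nat -> R, [/\ forall i, 0 <= tau i,
    forall i, (mu (B `&` [set x | (tau i)%:E < `|f x|]) <= (m * theta ^+ i)%:E)%E &
    (\sum_(i <oo) ((tau i * w i) `^ q * (m * theta ^+ i))%:E < +oo)%E].
Proof.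
move=> q0 mD W0 miD w0 wW Ioo.
have rho0 i : (0 <= rho i)%E by exact: rearrangement_ge0.
pose c i := ((rho i * (w i)%:E) `^ q)%E.
have c0 i : (0 <= c i)%E by exact: poweR_ge0.
have d0 i : 0 < m * theta ^+ i - m * theta ^+ i.+1.
  by rewrite exprS mulrCA -{1}[m * _]mul1r -mulrBl mulr_gt0// subr_gt0.
have Soo : (\sum_(i <oo) c i * (m * theta ^+ i - m * theta ^+ i.+1)%:E < +oo)%E.
  apply: le_lt_trans Ioo; apply: integral_steps_ge => //.
  + by move=> t _; exact: poweR_ge0.
  + move=> i t tm; apply: le_poweR; rewrite ?(ltW q0)//.
      by rewrite mule_ge0// lee_fin ltW.
    apply: lee_pmul => //; rewrite ?lee_fin ?(ltW (w0 i))//; last exact: wW.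
    by apply: rearrangement_nonincreasing; case/andP: tm => _ /ltW.
have rhof i : rho i \is a fin_num.
  rewrite ge0_fin_numE// ltey; apply/eqP => rhoy.
  have := @nneseries_le_term _ (fun i => c i * (m * theta ^+ i - m * theta ^+ i.+1)%:E)%E i.
  rewrite leNgt => /(_ _)/negP; apply; first by move=> k; rewrite mule_ge0// lee_fin ltW.
  by rewrite /c rhoy gt0_mulye ?lte_fin// poweRyr ?gt_eqF// gt0_mulye ?lte_fin.
exists (fun i => fine (rho i)); split.
- by move=> i; rewrite fine_ge0.
- by move=> i; apply: rho_level; rewrite ?fine_ge0// fineK.
have th1 : 0 < 1 - theta by rewrite subr_gt0.
rewrite (eq_eseriesr (g := fun i => ((1 - theta)^-1)%:E *
    (c i * (m * theta ^+ i - m * theta ^+ i.+1)%:E))%E).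
  rewrite nneseriesZl; last by move=> i _; rewrite mule_ge0// lee_fin ltW.
  have S0 : (0 <= \sum_(i <oo) c i * (m * theta ^+ i - m * theta ^+ i.+1)%:E)%E.
    by apply: nneseries_ge0 => i _ _; rewrite mule_ge0// lee_fin ltW.
  have Sf : (\sum_(i <oo) c i * (m * theta ^+ i - m * theta ^+ i.+1)%:E)%E \is a fin_num.
    by rewrite ge0_fin_numE.
  by rewrite -(fineK Sf) -EFinM ltry.
move=> i _; rewrite /c; move: (fineK (rhof i)); set t := fine _ => <-.
rewrite -EFinM; congr (_%:E).
rewrite exprS; field; exact: lt0r_neq0.
Qed.

End rearrangement_cases.

(** The norm makes e_i = (m theta^i)^(1/s) tau_i summable. With del = 1/p - 1/s and eta = theta^del,
    the term of index j + k is the p-th power of (m theta^j)^del e_(j+k) eta^k, so the inclusion of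
    l^1 in l^p bounds the p-th root of the tail by (m theta^j)^del X_j, where X_j = sum_k e_(j+k)
    eta^k. Since theta^(1/s) = 1/2, all powers depending on j cancel in 2^-j S_j <= K X_j. *)
Lemma lorentz_growth (p : R) : 1 <= p -> p < s -> (lorentz_norm mu s fB < +oo)%E ->
  growth_bound mu p x0 r0 f.
Proof.
move=> p1 ps; have p0 : 0 < p by lra.
have is0 : 0 < s^-1 by rewrite invr_gt0.
have is1 : s^-1 <= 1 by rewrite invf_le1//; lra.
rewrite /lorentz_norm => Loo.
have Ioo : (\int[lebesgue_measure]_(t in `]0%R, +oo[)
    ((rearrangement mu setT fB t * (t `^ (s^-1 - 1))%:E) `^ 1) < +oo)%E.
  apply: le_lt_trans (_ : _ <= s%:E * (s^-1%:E * \int[lebesgue_measure]_(t in `]0%R, +oo[)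
    (rearrangement mu setT fB t * (t `^ (s^-1 - 1))%:E)))%E _.
    rewrite muleA -EFinM mulfV ?gt_eqF// mul1e.
    apply: ge0_le_integral_nomeas => t _; first exact: poweR_ge0.
    by rewrite poweRe1// mule_ge0 ?rearrangement_ge0// lee_fin powR_ge0.
  by rewrite lte_mul_pinfty// ?lee_fin ?ltW.
have [//|||||tau [tau0 taumu taum]] := @rearrangement_steps setT measurableT (@subsetT _ _)
  `]0%R, +oo[%classic (fun t => t `^ (s^-1 - 1)) (fun i => (m * theta ^+ i) `^ (s^-1 - 1)) 1 ltr01 _ _ _ _ _ Ioo.
- by move=> t _; exact: powR_ge0.
- by move=> i t /=; rewrite !in_itv/= andbT => /andP[+ _]; exact: lt_le_trans.
- by move=> i; exact: powR_gt0.
- move=> i t /andP[mt tm]; have t0 : 0 < t by exact: lt_le_trans mt.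
  rewrite -(opprB 1 s^-1) !powRN lef_pV2 ?posrE ?powR_gt0//.
  by apply: ge0_ler_powR; rewrite ?nnegrE ?subr_ge0// ltW.
have [del del0 delE] : exists2 del, 0 < del & p^-1 = del + s^-1.
  by exists (p^-1 - s^-1); rewrite ?subrK// subr_gt0 ltf_pV2.
pose eta := theta `^ del.
have eta0 : 0 <= eta by exact: powR_ge0.
have eta1 : eta < 1 by apply: powR_lt1 => //; exact: ltW.
pose e i := (m * theta ^+ i) `^ s^-1 * tau i.
have e0 i : 0 <= e i by rewrite mulr_ge0// powR_ge0.
have eoo : (\sum_(i <oo) (e i)%:E < +oo)%E.
  rewrite (eq_eseriesr (g := fun i => ((tau i * (m * theta ^+ i) `^ (s^-1 - 1)) `^ 1 *
    (m * theta ^+ i))%:E))// => i _; congr (_%:E).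
  rewrite powRr1; last by rewrite mulr_ge0// powR_ge0.
  have -> : e i = (m * theta ^+ i) `^ (s^-1 - 1 + 1) * tau i by rewrite subrK.
  rewrite powRD; last by rewrite (gt_eqF (m_gt0 i)) implybT.
  by rewrite powRr1 ?(ltW (m_gt0 i))//; ring.
have conv := nneseries_geometric_conv eta0 eta1 e0 eoo.
pose X j := (\sum_(k <oo) (e (j + k)%N * eta ^+ k)%:E)%E.
have X0 j : (0 <= X j)%E.
  by apply: nneseries_ge0 => k _ _; rewrite lee_fin mulr_ge0// exprn_ge0.
have Xf j : X j \is a fin_num.
  rewrite ge0_fin_numE//; apply: le_lt_trans conv.
  exact: (@nneseries_le_term _ X).
have aE j k : (m * theta ^+ (j + k)) * tau (j + k)%N `^ p =
    ((m * theta ^+ j) `^ del * (e (j + k)%N * eta ^+ k)) `^ p.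
  have x0' := ltW (m_gt0 (j + k)); have mj0 := ltW (m_gt0 j).
  have -> : (m * theta ^+ j) `^ del * (e (j + k)%N * eta ^+ k) =
      (m * theta ^+ (j + k)) `^ p^-1 * tau (j + k)%N.
    have -> : eta ^+ k = (theta ^+ k) `^ del by rewrite powR_exprn// ltW.
    rewrite delE powRD; last by rewrite (gt_eqF (m_gt0 _)) implybT.
    have -> : (m * theta ^+ (j + k)) `^ del =
        (m * theta ^+ j) `^ del * (theta ^+ k) `^ del.
      by rewrite exprD mulrA powRM ?exprn_ge0 ?(ltW theta_gt0).
    by rewrite /e; ring.
  by rewrite powRM ?powR_ge0// -powRrM mulVf ?gt_eqF// powRr1.
have TX j : (\sum_(k <oo) (m * theta ^+ (j + k) * tau (j + k)%N `^ p)%:E <=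
    (((m * theta ^+ j) `^ del * fine (X j)) `^ p)%:E)%E.
  under eq_eseriesr do rewrite aE.
  apply: le_trans (nneseries_powR_le p1 _) _.
    by move=> k; rewrite mulr_ge0 ?powR_ge0// mulr_ge0// exprn_ge0.
  rewrite -poweR_EFin; apply: le_poweR; [exact: ltW| |].
    by apply: nneseries_ge0 => k _ _; rewrite lee_fin mulr_ge0 ?powR_ge0// mulr_ge0// exprn_ge0.
  under eq_eseriesr do rewrite EFinM.
  rewrite nneseriesZl; last by move=> k _; rewrite lee_fin mulr_ge0// exprn_ge0.
  by rewrite EFinM fineK.
apply: (@levels_growth_bound _ _ _ mu br bfp s _ _ _ _ m _ tau) => //.
  by apply: le_lt_trans (ltry _); have := TX 0%N; under eq_eseriesr do rewrite add0n; exact.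
pose K := theta^-1 `^ p^-1 * m `^ (- s^-1).
have K0 : 0 <= K by rewrite mulr_ge0 ?powR_ge0.
apply: (@le_lt_trans _ _ (\sum_(j <oo) K%:E * X j)%E); last first.
  rewrite nneseriesZl//.
  have Sf : (\sum_(j <oo) X j)%E \is a fin_num by rewrite ge0_fin_numE ?nneseries_ge0.
  by rewrite -(fineK Sf) -EFinM ltry.
apply: lee_nneseries => [j _ _|j _].
  by rewrite lee_fin mulr_ge0 ?powR_ge0// exprn_ge0.
rewrite -(fineK (Xf j)) -EFinM lee_fin.
have mj0 := m_gt0 j.
have x0' : 0 <= fine (X j) by exact: fine_ge0.
have Tle : fine (\sum_(k <oo) (m * theta ^+ (j + k) * tau (j + k)%N `^ p)%:E)%E <=
    ((m * theta ^+ j) `^ del * fine (X j)) `^ p.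
  rewrite -lee_fin fineK//; rewrite ge0_fin_numE ?(le_lt_trans (TX j)) ?ltry//.
  by apply: nneseries_ge0 => k _ _; rewrite lee_fin mulr_ge0 ?powR_ge0// ltW.
have tm0 : 0 <= theta^-1 * (m * theta ^+ j)^-1 by rewrite mulr_ge0// invr_ge0 ltW.
apply: (@le_trans _ _ (2^-1 ^+ j * (theta^-1 * (m * theta ^+ j)^-1 *
    ((m * theta ^+ j) `^ del * fine (X j)) `^ p) `^ p^-1)).
  rewrite ler_pM2l ?exprn_gt0//; apply: ge0_ler_powR.
  - by rewrite invr_ge0 ltW.
  - rewrite nnegrE mulr_ge0// fine_ge0//.
    by apply: nneseries_ge0 => k _ _; rewrite lee_fin mulr_ge0 ?powR_ge0// ltW.
  - by rewrite nnegrE mulr_ge0// powR_ge0.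
  - by rewrite ler_wpM2l.
have Y0 : 0 <= (m * theta ^+ j) `^ del * fine (X j) by rewrite mulr_ge0 ?powR_ge0.
rewrite (powRM _ tm0 (powR_ge0 _ _)) -(powRrM (_ * fine _)) mulfV ?gt_eqF// (powRr1 Y0).
have it0 : 0 <= theta^-1 by rewrite invr_ge0 ltW.
have im0 : 0 <= (m * theta ^+ j)^-1 by rewrite invr_ge0 ltW.
rewrite (powRM _ it0 im0).
have -> : (m * theta ^+ j)^-1 `^ p^-1 = ((m * theta ^+ j) `^ p^-1)^-1.
  by rewrite -[X in X `^ _]powR_inv1 ?ltW// powRAC powR_inv1// powR_ge0.
rewrite delE [(m * theta ^+ j) `^ (del + _)]powRD; last by rewrite (gt_eqF mj0) implybT.
have -> : (m * theta ^+ j) `^ s^-1 = m `^ s^-1 * 2^-1 ^+ j.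
  rewrite powRM ?(ltW m0) ?exprn_ge0 ?(ltW theta_gt0)// powR_exprn ?(ltW theta_gt0)//.
  by rewrite /theta -powRrM mulfV ?gt_eqF// powRr1.
rewrite /K delE powRN.
have d0 : (m * theta ^+ j) `^ del != 0 by rewrite gt_eqF// powR_gt0.
have h0 : 2^-1 ^+ j != 0 :> R by rewrite gt_eqF// exprn_gt0.
have ms0 : m `^ s^-1 != 0 by rewrite gt_eqF// powR_gt0.
rewrite le_eqVlt; apply/orP; left; apply/eqP.
field; rewrite ?d0 ?h0 ?ms0//.
Qed.

Lemma ln2_ge_half : 2^-1 <= ln 2 :> R.
Proof.
have : ln (1 + - 2^-1 : R) <= - 2^-1 by apply: le_ln1Dx; lra.
have -> : 1 + - 2^-1 = 2^-1 :> R by lra.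
rewrite lnV ?posrE//; lra.
Qed.

(** For t < m theta^i <= M theta^i one has ln (M / t) >= i s ln 2 >= i / 2, so the logarithmic
    weight is at least ((i + 1) / 2)^alpha on the i-th step. *)
Lemma zygmund_levels (alpha : R) : 1 <= s -> 0 <= alpha -> (m%:E <= mu B)%E ->
  (zygmund_norm mu s alpha B fB < +oo)%E ->
  exists tau : nat -> R, [/\ forall i, 0 <= tau i,
    forall i, (mu (B `&` [set x | (tau i)%:E < `|f x|]) <= (m * theta ^+ i)%:E)%E &
    (\sum_(i <oo) (i.+1%:R `^ (alpha * s) * (m * theta ^+ i * tau i `^ s))%:E < +oo)%E].
Proof.
move=> s1 al0 mM; rewrite /zygmund_norm; set M := fine (mu B).
rewrite -(fineK Bfin) -/M lee_fin in mM.
have M0 : 0 < M by exact: lt_le_trans mM.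
have is0 : s^-1 != 0 by rewrite invr_neq0// gt_eqF.
move=> /(lty_poweRy is0) Ioo.
have mi i : m * theta ^+ i <= M * theta ^+ i by rewrite ler_pM2r// exprn_gt0.
have mM' i : m * theta ^+ i <= M.
  apply: le_trans mM; rewrite ger_pMr// exprn_ile1// ltW//.
have [|||||tau [tau0 taumu taum]] := @rearrangement_steps B mB (@subset_refl _ _)
  `]0, M[%classic (fun t => (1 + ln (M / t)) `^ alpha) (fun i => (i.+1%:R / 2) `^ alpha)
  s s0 _ _ _ _ _ Ioo.
- exact: measurable_itv.
- by move=> t _; exact: powR_ge0.
- move=> i t /=; rewrite !in_itv/= => /andP[mt tm]; rewrite (lt_le_trans (m_gt0 i.+1) mt)/=.
  exact: lt_le_trans (mM' i).
- by move=> i; rewrite powR_gt0// divr_gt0.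
- move=> i t /andP[mt tm]; have t0 : 0 < t by exact: lt_le_trans mt.
  have L : i%:R / 2 <= ln (M / t).
    apply: (@le_trans _ _ (ln (theta ^- i))).
      rewrite lnV ?posrE ?exprn_gt0// lnXn// /theta ln_powR lnV ?posrE//.
      rewrite mulrN mulNrn opprK -[leRHS]mulr_natl; apply: ler_wpM2l => //.
      apply: le_trans ln2_ge_half _; rewrite ler_peMl//.
      by apply: le_trans ln2_ge_half; rewrite invr_ge0.
    rewrite ler_ln ?posrE ?invr_gt0 ?exprn_gt0 ?divr_gt0//.
    rewrite ler_pdivlMr// mulrC ler_pdivrMr ?exprn_gt0//.
    by apply: ltW; apply: lt_le_trans tm _; exact: mi.
  apply: ge0_ler_powR; rewrite ?nnegrE//.
  - by rewrite addr_ge0//; apply: le_trans L; rewrite divr_ge0.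
  - by rewrite -natr1 mulrDl; lra.
exists tau; split => //.
rewrite (eq_eseriesr (g := fun i => (2 `^ (alpha * s))%:E *
    ((tau i * (i.+1%:R / 2) `^ alpha) `^ s * (m * theta ^+ i))%:E)%E).
  rewrite nneseriesZl; last by move=> i _; rewrite lee_fin mulr_ge0 ?powR_ge0// ltW.
  set S := (\sum_(i <oo) _)%E in taum *.
  have S0 : (0 <= S)%E.
    by apply: nneseries_ge0 => i _ _; rewrite lee_fin mulr_ge0 ?powR_ge0// ltW.
  have Sf : S \is a fin_num by rewrite ge0_fin_numE.
  by rewrite -(fineK Sf) -EFinM ltry.
move=> i _; rewrite -EFinM; congr (_%:E).
rewrite (powRM _ (tau0 i) (powR_ge0 _ _)) -powRrM.
rewrite powRM ?invr_ge0//.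
have -> : 2^-1 `^ (alpha * s) = (2 `^ (alpha * s))^-1 :> R.
  by rewrite -[X in X `^ _]powR_inv1// powRAC powR_inv1// powR_ge0.
field.
by rewrite gt_eqF// powR_gt0.
Qed.

(** For s = 1 the quantity 2^-j S_j is a constant times the tail of the b_i from j, and the sum of
    all tails is the series of (i + 1) b_i, which converges since alpha >= 1. *)
Lemma zygmund_growth1 (alpha : R) : s = 1 -> 1 <= alpha -> (m%:E <= mu B)%E ->
  (zygmund_norm mu s alpha B fB < +oo)%E -> growth_bound mu s x0 r0 f.
Proof.
move=> s1 al1 mM Zoo.
have s1' : 1 <= s by rewrite s1.
have al0 : 0 <= alpha by lra.
have [tau [tau0 taumu taum]] := zygmund_levels s1' al0 mM Zoo.
pose b i := m * theta ^+ i * tau i `^ s.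
have b0 i : 0 <= b i by rewrite mulr_ge0 ?powR_ge0// ltW.
have bb : (\sum_(i <oo) (i.+1%:R * b i)%:E < +oo)%E.
  apply: le_lt_trans taum; apply: lee_nneseries => [i _ _|i _].
    by rewrite lee_fin mulr_ge0.
  rewrite lee_fin /b; apply: ler_wpM2r; first exact: b0.
  rewrite -{1}(powRr1 (ler0n R i.+1)); apply: ler_powR; first by rewrite ler1n.
  by rewrite s1 mulr1.
have T0 : (\sum_(k <oo) (b k)%:E < +oo)%E.
  apply: le_lt_trans bb; apply: lee_nneseries => [i _ _|i _]; rewrite lee_fin//.
  by rewrite ler_peMl// ler1n.
have tb := nneseries_tails_lty b0 bb.
apply: (@levels_growth_bound _ _ _ mu br bfp s _ _ _ _ m _ tau) => //.
pose T j := (\sum_(k <oo) (b (j + k)%N)%:E)%E.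
have TE j : T j \is a fin_num.
  rewrite ge0_fin_numE; last by apply: nneseries_ge0 => *; rewrite lee_fin.
  by apply: le_lt_trans T0; apply: (@nneseries_shift_le0 _ (fun i => (b i)%:E)).
rewrite (eq_eseriesr (g := fun j => (theta^-1 * m^-1)%:E * T j)%E).
  have T00 j : (0 <= T j)%E by apply: nneseries_ge0 => *; rewrite lee_fin.
  rewrite nneseriesZl//.
  have Sf : (\sum_(i <oo) T i)%E \is a fin_num by rewrite ge0_fin_numE ?nneseries_ge0.
  by rewrite -(fineK Sf) -EFinM ltry.
have thE : theta = 2^-1 by rewrite /theta s1 powRr1.
have E j : 2^-1 ^+ j * (theta^-1 * (m * theta ^+ j)^-1 * fine (T j)) `^ s^-1 =
    theta^-1 * m^-1 * fine (T j).
  have -> : s^-1 = 1 by rewrite s1 invr1.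
  rewrite powRr1; last first.
    rewrite mulr_ge0 ?fine_ge0//; first by rewrite mulr_ge0 ?invr_ge0 ?(ltW theta_gt0)// ltW.
    by apply: nneseries_ge0 => *; rewrite lee_fin.
  rewrite invfM thE; have : 2^-1 ^+ j != 0 :> R by rewrite expf_neq0.
  by move: (2^-1 ^+ j) => h h0; field; rewrite ?h0 ?lt0r_neq0.
move=> j _; transitivity ((theta^-1 * m^-1 * fine (T j))%:E).
  exact: (congr1 EFin (E j)).
by rewrite EFinM fineK.
Qed.

(** The weights increase, so the tail from j is at most (j + 1)^(- alpha s) Z. As theta^(1/s) = 1/2
    cancels 2^-j, this leaves 2^-j S_j <= K (j + 1)^(- alpha), summable for alpha > 1. *)
Lemma zygmund_growth (alpha : R) : 1 <= s -> 1 < alpha -> (m%:E <= mu B)%E ->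
  (zygmund_norm mu s alpha B fB < +oo)%E -> growth_bound mu s x0 r0 f.
Proof.
move=> s1 al1 mM Zoo; have al0 : 0 <= alpha by lra.
have [tau [tau0 taumu taum]] := zygmund_levels s1 al0 mM Zoo.
pose b i := m * theta ^+ i * tau i `^ s.
have b0 i : 0 <= b i by rewrite mulr_ge0 ?powR_ge0// ltW.
set Z := (\sum_(i <oo) _)%E in taum.
have zb0 i : 0 <= i.+1%:R `^ (alpha * s) * b i by rewrite mulr_ge0// powR_ge0.
have Z0 : (0 <= Z)%E by apply: nneseries_ge0 => i _ _; rewrite lee_fin; exact: zb0.
have Zf : Z \is a fin_num by rewrite ge0_fin_numE.
pose T j := (\sum_(k <oo) (b (j + k)%N)%:E)%E.
have T0 j : (0 <= T j)%E by apply: nneseries_ge0 => *; rewrite lee_fin.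
have TZ j : (T j <= (j.+1%:R `^ (- (alpha * s)) * fine Z)%:E)%E.
  have H i : (j <= i)%N -> b i <= j.+1%:R `^ (- (alpha * s)) * (i.+1%:R `^ (alpha * s) * b i).
    move=> ji; rewrite mulrA ler_peMl// powRN mulrC ler_pdivlMr ?powR_gt0// mul1r.
    apply: ge0_ler_powR; rewrite ?nnegrE// ?ler_nat// mulr_ge0//; lra.
  rewrite EFinM fineK//.
  apply: (@le_trans _ _ (\sum_(k <oo) (j.+1%:R `^ (- (alpha * s)))%:E *
     ((j + k).+1%:R `^ (alpha * s) * b (j + k)%N)%:E)%E).
    apply: lee_nneseries => [k _ _|k _]; first by rewrite lee_fin.
    by rewrite -EFinM lee_fin; apply: H; rewrite leq_addr.
  rewrite nneseriesZl; last by move=> k _; rewrite lee_fin.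
  rewrite lee_wpmul2l ?lee_fin ?powR_ge0//.
  by apply: (@nneseries_shift_le0 _ (fun i => (i.+1%:R `^ (alpha * s) * b i)%:E)) => i; rewrite lee_fin.
apply: (@levels_growth_bound _ _ _ mu br bfp s _ _ _ _ m _ tau) => //.
  by apply: le_lt_trans (TZ 0%N) (ltry _).
pose K := (theta^-1 * m^-1 * fine Z) `^ s^-1.
have K0 : 0 <= K by exact: powR_ge0.
apply: (@le_lt_trans _ _ (\sum_(j <oo) K%:E * (j.+1%:R `^ (- alpha))%:E)%E); last first.
  rewrite nneseriesZl; last by move=> j _; rewrite lee_fin powR_ge0.
  have := nneseries_powR_lty al1; set S := (\sum_(j <oo) _)%E => Soo.
  have Sf : S \is a fin_num.
    by rewrite ge0_fin_numE// nneseries_ge0// => j _ _; rewrite lee_fin powR_ge0.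
  by rewrite -(fineK Sf) -EFinM ltry.
apply: lee_nneseries => [j _ _|j _].
  by rewrite lee_fin mulr_ge0 ?powR_ge0// exprn_ge0.
rewrite -EFinM lee_fin.
have z0 : 0 <= fine Z by exact: fine_ge0.
have Tle : fine (T j) <= j.+1%:R `^ (- (alpha * s)) * fine Z.
  rewrite -lee_fin fineK; first exact: TZ.
  by rewrite ge0_fin_numE// (le_lt_trans (TZ j))// ltry.
have it0 : 0 <= theta^-1 by rewrite invr_ge0 ltW.
have im0 : 0 <= m^-1 by rewrite invr_ge0 ltW.
have itj0 : 0 <= (m * theta ^+ j)^-1 by rewrite invr_ge0 ltW.
have is0 : 0 <= s^-1 by rewrite invr_ge0 ltW.
have W0 : 0 <= theta^-1 * m^-1 * fine Z by rewrite !mulr_ge0.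
have ij0 : 0 <= (theta ^+ j)^-1 by rewrite invr_ge0 exprn_ge0// ltW.
apply: (@le_trans _ _ (2^-1 ^+ j * (theta^-1 * m^-1 * fine Z *
    ((theta ^+ j)^-1 * j.+1%:R `^ (- (alpha * s)))) `^ s^-1)).
  rewrite ler_pM2l ?exprn_gt0//; apply: ge0_ler_powR => //.
  - have m1 : 0 <= theta^-1 * (m * theta ^+ j)^-1 by exact: mulr_ge0.
    by rewrite nnegrE; apply: mulr_ge0 => //; exact: (fine_ge0 (T0 j)).
  - by rewrite nnegrE mulr_ge0// mulr_ge0// powR_ge0.
  - have -> : theta^-1 * m^-1 * fine Z * ((theta ^+ j)^-1 * j.+1%:R `^ (- (alpha * s))) =
        theta^-1 * (m * theta ^+ j)^-1 * (j.+1%:R `^ (- (alpha * s)) * fine Z).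
      by rewrite invfM; ring.
    by apply: ler_wpM2l; rewrite ?mulr_ge0.
rewrite (powRM _ W0); last by rewrite mulr_ge0// powR_ge0.
rewrite -/K (powRM _ ij0 (powR_ge0 _ _)) -(powRrM j.+1%:R).
have -> : - (alpha * s) / s = - alpha by rewrite -mulNr mulfK// gt_eqF.
have -> : (theta ^+ j)^-1 `^ s^-1 = (2^-1 ^+ j)^-1.
  rewrite -[X in X `^ _]powR_inv1 ?exprn_ge0 ?(ltW theta_gt0)// powRAC.
  rewrite powR_exprn ?(ltW theta_gt0)// /theta -powRrM mulfV ?gt_eqF//.
  by rewrite powRr1// powR_inv1// exprn_ge0.
have h0 : 2^-1 ^+ j != 0 :> R by rewrite expf_neq0.
by rewrite mulrCA (mulrA (2^-1 ^+ j)) mulfV// mul1r.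
Qed.

End growth_cases.

Section embedding_growth.
Context {R : realType} {d : measure_display} {P : measurableMetricType R d}.
Variables (mu : {measure set P -> \bar R}) (nX : (P -> \bar R) -> \bar R) (p s : R).
Hypotheses (br : borel_regular mu) (bfp : balls_finite_positive mu)
  (lattice : forall u v, measurable_fun setT u -> measurable_fun setT v ->
    {ae mu, forall x, `|u x| <= `|v x|}%E -> (nX u <= nX v)%E).

Lemma embedding_growth : 1 <= p -> 0 < s -> dimension_condition mu s ->
  [\/ [/\ 1 <= s, s < p &
        exists q : \bar R, (p%:E <= q)%E /\ embeds_loc nX (fun=> Lnorm mu q)],
      [/\ 1 = p, p = s &
        exists alpha : R, 1 <= alpha /\ embeds_loc nX (zygmund_norm mu s alpha)],
      [/\ 1 < p, p = s &
        exists alpha : R, 1 < alpha /\ embeds_loc nX (zygmund_norm mu s alpha)]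
    | [/\ 1 <= p, p < s & embeds_loc nX (fun=> lorentz_norm mu s)]] ->
  forall f, measurable_fun setT f -> (nX f < +oo)%E ->
  forall x0 r0, 0 < r0 -> growth_bound mu p x0 r0 f.
Proof.
move=> p1 s0 dim emb f mf foo x0 r0 r00.
have r20 : 0 < 2 * r0 by rewrite mulr_gt0.
have [m [m0 mB mball]] := ball_measure_ge bfp dim x0 r00.
have mM : (m%:E <= mu (ball x0 (2 * r0)))%E.
  apply: le_trans mB _; apply: le_measure; rewrite ?inE.
  - exact: (measurable_ball_metric br).
  - exact: (measurable_ball_metric br).
  - by apply: le_ball; lra.
(* The embedding is applied to f itself; its truncation to the ball has norm at most that of f by
   the lattice property. *)
have fin nY : embeds_loc nX nY ->
    (nY (ball x0 (2 * r0)) (fun y => f y * (\1_(ball x0 (2 * r0)) y)%:E) < +oo)%E.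
  move=> /(_ x0 _ r20)[c c0 /(_ f mf) /= H]; apply: le_lt_trans H _.
  apply: (@le_lt_trans _ _ (c%:E * nX f)%E); last first.
    by rewrite lte_mul_pinfty// lee_fin ltW.
  rewrite lee_pmul2l ?lte_fin//; apply: lattice => //.
    apply: emeasurable_funM => //; apply/measurable_EFinP; apply: measurable_indic.
    exact: (measurable_ball_metric br).
  apply: nearW => x; rewrite indicE; case: (x \in _); rewrite ?mule1//.
  by rewrite mule0 abse0.
case: emb => [[_ sp [q [pq /fin Loo]]]|[p1' ps [al [al1 /fin Zoo]]]|
    [p1' ps [al [al1 /fin Zoo]]]|[_ ps /fin Loo]].
- exact: (Lnorm_growth br bfp s0 r00 mf m0 mball sp pq Loo).
- rewrite ps; apply: (zygmund_growth1 br bfp s0 r00 mf m0 mball _ al1 mM Zoo).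
  by rewrite -ps -p1'.
- rewrite ps; apply: (zygmund_growth br bfp s0 r00 mf m0 mball _ al1 mM Zoo).
  by rewrite -ps.
- exact: (lorentz_growth br bfp s0 r00 mf m0 mball p1 ps Loo).
Qed.

End embedding_growth.

(** * Integrability and comparison of averages *)

Section averages.
Context {R : realType} {d : measure_display} {P : measurableMetricType R d}.
Variables (mu : {measure set P -> \bar R}).
Hypotheses (br : borel_regular mu) (bfp : balls_finite_positive mu).

(** The bound at j = 0 with centre x and scale r puts |u|^p in L^1(B(x, r)), and |u| <= 1 +
    |u|^p. *)
Lemma growth_integrable (p : R) (u : P -> \bar R) : 1 <= p -> measurable_fun setT u ->
  (forall x0 r0, 0 < r0 -> growth_bound mu p x0 r0 u) -> integrable_on_balls mu u.
Proof.
move=> p1 mu_ H; split => // x r r0; have p0 : 0 < p by lra.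
have mB := measurable_ball_metric br x r.
have Bf := ball_measure_fin bfp x r0.
have B0 : 0 < fine (mu (ball x r)).
  by rewrite fine_gt0// ball_measure_gt0// ltey_eq Bf.
apply/integrableP; split; first exact: measurable_funTS.
have [S [S0 _ /(_ x 0%N (ballxx _ r0))]] := H x r r0.
rewrite expr0 mulr1 => avg.
have av0 : (0 <= average mu (ball x r) (fun z => `|u z| `^ p))%E.
  rewrite /average mule_ge0 ?inve_ge0//; apply: integral_ge0 => *; exact: poweR_ge0.
have : (average mu (ball x r) (fun z => `|u z| `^ p) < +oo)%E.
  apply: (@lty_poweRy _ _ p^-1); first by rewrite invr_neq0// gt_eqF.
  exact: le_lt_trans avg (ltry _).
rewrite /average -(fineK Bf) inver (gt_eqF B0) => avoo.
have Ioo : (\int[mu]_(x in ball x r) (`|u x| `^ p) < +oo)%E.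
  rewrite ltNge leye_eq; apply/negP => /eqP Iy; move: avoo.
  by rewrite Iy gt0_muley ?lte_fin ?invr_gt0// ltxx.
apply: (@le_lt_trans _ _ (\int[mu]_(x in ball x r) (1 + `|u x| `^ p))%E).
  apply: ge0_le_integral_nomeas => y _ //.
  case: (`|u y|%E) (abse_ge0 (u y)) => [t| |]// t0; last first.
    by rewrite poweRyr ?gt_eqF// addey.
  rewrite poweR_EFin -EFinD lee_fin; rewrite lee_fin in t0.
  have [t1|t1] := leP t 1; first by rewrite (le_trans t1)// lerDl powR_ge0.
  apply: (@le_trans _ _ (t `^ p)); last by rewrite lerDr.
  by rewrite -{1}(powRr1 t0); exact: (ler_powR (ltW t1) p1).
rewrite ge0_integralD//; [|by move=> *; exact: poweR_ge0|].
  by rewrite integral_cst// mul1e lte_add_pinfty// -ge0_fin_numE.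
apply: measurable_funTS; apply: (measurableT_comp (measurable_poweR p)).
exact: measurableT_comp.
Qed.

Lemma average_dist_le (B B' : set P) (w : P -> \bar R) (a K : R) :
  measurable B -> measurable B' -> B' `<=` B -> mu.-integrable B w ->
  (0 < mu B')%E -> (mu B < +oo)%E -> (mu B <= K%:E * mu B')%E ->
  (`|fine (average mu B' w) - a|%:E <= K%:E * average mu B (fun x => `|w x - a%:E|))%E.
Proof.
move=> mB mB' B'B iw B'0 Boo BK.
have B'le : (mu B' <= mu B)%E by apply: le_measure; rewrite ?inE.
have B'f : mu B' \is a fin_num by rewrite ge0_fin_numE// (le_lt_trans B'le).
have Bf : mu B \is a fin_num by rewrite ge0_fin_numE.
have b'0 : 0 < fine (mu B') by rewrite fine_gt0// B'0 ltey_eq B'f.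
have b0 : 0 < fine (mu B) by rewrite fine_gt0// Boo (lt_le_trans B'0).
have iw' : mu.-integrable B' w by exact: integrableS iw.
have ia : mu.-integrable B' (cst a%:E).
  apply/integrableP; split; first exact: measurable_cst.
  by rewrite integral_cst// -(fineK B'f) -EFinM ltry.
have If : (\int[mu]_(x in B') w x)%E \is a fin_num by exact: integrable_fin_num.
have E : (fine (average mu B' w) - a)%:E =
    ((fine (mu B'))^-1%:E * \int[mu]_(x in B') (w x - a%:E))%E.
  rewrite integralB// integral_cst//.
  rewrite /average -(fineK B'f) inver (gt_eqF b'0) -(fineK If) -!EFinM fineK//=.
  by congr (_%:E); field; exact: lt0r_neq0.
rewrite -abse_EFin E abseM.
have -> : (`|(fine (mu B'))^-1%:E| = (fine (mu B'))^-1%:E)%E.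
  by rewrite /= ger0_norm// invr_ge0 ltW.
have mwa D : measurable D -> mu.-integrable D w -> measurable_fun D (fun x => w x - a%:E)%E.
  move=> mD /integrableP[mw _]; exact: emeasurable_funB.
apply: (@le_trans _ _ ((fine (mu B'))^-1%:E * \int[mu]_(x in B) `|w x - a%:E|)%E).
  rewrite lee_wpmul2l ?lee_fin ?invr_ge0 ?(ltW b'0)//.
  apply: le_trans (le_abse_integral _ _ _) _ => //; first exact: mwa.
  apply: ge0_subset_integral => //; apply: measurableT_comp => //; exact: mwa.
rewrite /average -(fineK Bf) inver (gt_eqF b0) muleA -EFinM.
apply: lee_wpmul2r; first exact: integral_ge0.
move: BK; rewrite -(fineK Bf) -(fineK B'f) -EFinM !lee_fin => BK.
by rewrite ler_pdivlMr// ler_pdivrMl// mulrC.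
Qed.

End averages.

(** * Limits of averages *)

Section oscillation.
Context {R : realType} {d : measure_display} {P : measurableMetricType R d}.
Variables (mu : {measure set P -> \bar R}).
Hypotheses (br : borel_regular mu) (bfp : balls_finite_positive mu).
Variable c : R.
Hypotheses (c1 : 1 <= c) (dbl : forall (x : P) (r : R), 0 < r ->
  (mu (ball x (2 * r)) <= c%:E * mu (ball x r))%E).

Let rad j : R := 2^-1 ^+ j.
Let rad_gt0 j : 0 < rad j. Proof. by rewrite exprn_gt0. Qed.
Let radS j : rad j = 2 * rad j.+1.
Proof. by rewrite /rad exprS mulrA mulfV ?mul1r. Qed.
Let c0 : 0 <= c. Proof. exact: le_trans ler01 c1. Qed.

Definition dyadic_average (w : P -> \bar R) (y : P) (j : nat) : R :=
  fine (average mu (ball y (2^-1 ^+ j)) w).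

Definition oscillation_bound (w : P -> \bar R) (O : nat -> R) (y : P) := forall j,
  (average mu (ball y (2^-1 ^+ j)) (fun x => `|w x - (dyadic_average w y j)%:E|) <=
    (O j)%:E)%E.

Lemma poincare_oscillation (p cP lam : R) (w g : P -> \bar R) (S : nat -> R) (y : P) :
  0 < cP ->
  (forall (x : P) (r : R) (u g : P -> \bar R), 0 < r ->
      integrable_on_balls mu u -> upper_gradient u g ->
      (average mu (ball x r) (fun y => `|u y - average mu (ball x r) u|)
        <= cP%:E * diam (ball x r) *
           average mu (ball x (lam * r)%R) (fun y => g y `^ p) `^ p^-1)%E) ->
  integrable_on_balls mu w -> upper_gradient w g ->
  (forall j, average mu (ball y (lam * 2^-1 ^+ j)) (fun y => g y `^ p) `^ p^-1 <=
    (S j)%:E)%E ->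
  oscillation_bound w (fun j => 2 * cP * (2^-1 ^+ j * S j)) y.
Proof.
move=> cP0 PI iw gw gS j; have rj := rad_gt0 j.
have av : (average mu (ball y (2^-1 ^+ j)) w = (dyadic_average w y j)%:E)%E.
  rewrite /dyadic_average fineK// /average.
  have Bf := ball_measure_fin bfp y rj.
  have B0 : 0 < fine (mu (ball y (rad j))).
    by rewrite fine_gt0// ball_measure_gt0// ltey_eq Bf.
  have If := integrable_fin_num (measurable_ball_metric br y (rad j)) (iw.2 y _ rj).
  by rewrite -(fineK Bf) inver (gt_eqF B0) -(fineK If).
have := PI y _ w g rj iw gw; rewrite -/(rad j) in av; rewrite av; move/le_trans; apply.
have dm : (diam (ball y (rad j)) <= (2 * rad j)%:E)%E.
  apply: ge_ereal_sup => _ [[x z] [/= xy zy] <-]; rewrite lee_fin.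
  have := metric_triangle x y z; move: xy zy; rewrite !ballEmdist/=.
  by rewrite (metric_sym x y); lra.
have d0 : (0 <= diam (ball y (rad j)))%E.
  apply: ereal_sup_ubound; exists (y, y); last by rewrite mdistxx.
  by split; apply: ballxx.
apply: (@le_trans _ _ (cP%:E * (2 * rad j)%:E * (S j)%:E)%E).
  apply: lee_pmul; [|exact: poweR_ge0| |exact: gS].
    by rewrite mule_ge0// lee_fin ltW.
  by rewrite lee_wpmul2l// lee_fin ltW.
rewrite -!EFinM lee_fin /rad.
by have -> : cP * (2 * 2^-1 ^+ j) * S j = 2 * cP * (2^-1 ^+ j * S j) by ring.
Qed.

Section one_function.
Variables (w : P -> \bar R) (O : nat -> R).
Hypotheses (iw : integrable_on_balls mu w) (O0 : forall j, 0 <= O j)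
  (Ooo : (\sum_(j <oo) (O j)%:E < +oo)%E).

(** The factor c is the doubling constant, paid once in passing from radius 2^-k to 2^-(k+1). *)
Definition osc_tail j : R := c * fine (\sum_(j <= k <oo) (O k)%:E)%E.

Let tail0 j : (0 <= \sum_(j <= k <oo) (O k)%:E)%E.
Proof. by apply: nneseries_ge0 => k _ _; rewrite lee_fin. Qed.

Let tailf j : (\sum_(j <= k <oo) (O k)%:E)%E \is a fin_num.
Proof.
rewrite ge0_fin_numE//; apply: le_lt_trans Ooo.
rewrite [leRHS](nneseries_split 0 j)/=; last by move=> k _; rewrite lee_fin.
by rewrite add0n leeDr// sume_ge0// => k _; rewrite lee_fin.
Qed.

Lemma osc_tail_ge0 j : 0 <= osc_tail j.
Proof. by rewrite mulr_ge0// fine_ge0. Qed.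

Lemma osc_tailS j : osc_tail j = c * O j + osc_tail j.+1.
Proof.
rewrite /osc_tail -mulrDr; congr (_ * _); apply: EFin_inj.
rewrite EFinD !fineK// (nneseries_split j 1); last by move=> k _; rewrite lee_fin.
by rewrite addn1 big_nat1.
Qed.

Lemma osc_tail_cvg : osc_tail @ \oo --> 0.
Proof.
have O0E k : true -> (0 <= (O k)%:E)%E by rewrite lee_fin.
have /fine_cvgP[_ H] := nneseries_tail_cvg Ooo O0E.
rewrite -[X in _ --> X](mulr0 c); exact: (cvgM (cvg_cst c) H).
Qed.

Lemma osc_le_tail j : c * O j <= osc_tail j.
Proof. by rewrite osc_tailS lerDl osc_tail_ge0. Qed.

(** B(z, 2^-(j+1)) lies in B(y, 2^-j), which lies in B(z, 4 2^-(j+1)); two doublings give the factor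
    c c. *)
Lemma dyadic_average_step y z j : oscillation_bound w O y -> mdist y z < 2^-1 ^+ j.+1 ->
  `|dyadic_average w z j.+1 - dyadic_average w y j| <= c * c * O j.
Proof.
move=> Oy yz; rewrite -lee_fin.
have By := ball_measure_fin bfp y (rad_gt0 j).
apply: le_trans (average_dist_le (K := c * c) _ _ _ _ _ _ _ _) _.
- exact: (measurable_ball_metric br y (rad j)).
- exact: (measurable_ball_metric br).
- by apply: ball_sub; rewrite -/(rad j) radS; move: yz; rewrite -/(rad j.+1); lra.
- exact: iw.2.
- exact: ball_measure_gt0.
- by rewrite -ge0_fin_numE.
- apply: (@le_trans _ _ (mu (ball z (2 * (2 * rad j.+1))))).
    apply: le_measure; rewrite ?inE; [exact: (measurable_ball_metric br)..|].
    apply: ball_sub; rewrite metric_sym radS; move: yz; rewrite -/(rad j.+1).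
    by have := rad_gt0 j.+1; lra.
  apply: le_trans (dbl _ _) _; first by rewrite mulr_gt0.
  rewrite EFinM -muleA lee_wpmul2l ?lee_fin//; exact: dbl.
by rewrite [leRHS]EFinM lee_wpmul2l ?lee_fin ?mulr_ge0//; exact: Oy.
Qed.

Lemma dyadic_average_near y j n : oscillation_bound w O y ->
  `|dyadic_average w y (j + n)%N - dyadic_average w y j| <= osc_tail j.
Proof.
move=> Oy.
have step k : `|dyadic_average w y k.+1 - dyadic_average w y k| <= c * O k.
  rewrite -lee_fin.
  apply: le_trans (average_dist_le (K := c) _ _ _ _ _ _ _ _) _.
  - exact: (measurable_ball_metric br y (rad k)).
  - exact: (measurable_ball_metric br).
  - by apply: le_ball; rewrite -/(rad k) radS; have := rad_gt0 k.+1; rewrite /rad; lra.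
  - exact: iw.2.
  - exact: ball_measure_gt0.
  - by rewrite -ge0_fin_numE// ball_measure_fin.
  - by rewrite radS; exact: dbl.
  by rewrite [leRHS]EFinM lee_wpmul2l ?lee_fin//; exact: Oy.
elim: n j => [|n IH] j; first by rewrite addn0 subrr normr0 osc_tail_ge0.
rewrite addnS -addSn osc_tailS.
rewrite -(subrKA (dyadic_average w y j.+1)) addrC (le_trans (ler_normD _ _))//.
by rewrite lerD.
Qed.

Lemma dyadic_average_cvg y : oscillation_bound w O y -> cvgn (dyadic_average w y).
Proof.
move=> Oy; apply/cauchy_cvgP; apply: cauchy_exP => e e0.
have /cvgrPdist_lt/(_ _ e0)[N _ /(_ N (leqnn N))] := osc_tail_cvg.
rewrite /= sub0r normrN ger0_norm ?osc_tail_ge0// => Ne.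
exists (dyadic_average w y N); exists N => // n /= Nn.
rewrite /ball/= distrC; apply: le_lt_trans Ne.
by have := dyadic_average_near N (n - N) Oy; rewrite subnKC.
Qed.

Definition dyadic_limit y : R := limn (dyadic_average w y).

Lemma dyadic_limit_near y j : oscillation_bound w O y ->
  `|dyadic_limit y - dyadic_average w y j| <= osc_tail j.
Proof.
move=> Oy; have cv := dyadic_average_cvg Oy.
have /cvg_norm H : (fun n => dyadic_average w y n - dyadic_average w y j) @ \oo -->
    dyadic_limit y - dyadic_average w y j by apply: cvgB => //; exact: cvg_cst.
apply: (cvgr_to_le H); exists j => // n /= jn.
by have := dyadic_average_near j (n - j) Oy; rewrite subnKC.
Qed.

(** One tail for each limit, and c c O_j <= c [osc_tail j] for the step between the centres. *)
Lemma dyadic_limit_dist y z j : oscillation_bound w O y -> oscillation_bound w O z ->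
  mdist y z < 2^-1 ^+ j.+1 ->
  `|dyadic_limit z - dyadic_limit y| <= (c + 2) * osc_tail j.
Proof.
move=> Oy Oz yz.
have h1 := dyadic_limit_near j.+1 Oz; have h2 := dyadic_average_step Oy yz.
have h3 := dyadic_limit_near j Oy.
have h4 : c * c * O j <= c * osc_tail j by rewrite -mulrA ler_wpM2l// osc_le_tail.
have h5 : osc_tail j.+1 <= osc_tail j by rewrite (osc_tailS j) lerDr mulr_ge0.
have -> : dyadic_limit z - dyadic_limit y = (dyadic_limit z - dyadic_average w z j.+1) +
  (dyadic_average w z j.+1 - dyadic_average w y j) +
  - (dyadic_limit y - dyadic_average w y j) by ring.
apply: le_trans (ler_normD _ _) _; rewrite normrN.
have := ler_normD (dyadic_limit z - dyadic_average w z j.+1)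
  (dyadic_average w z j.+1 - dyadic_average w y j).
lra.
Qed.

End one_function.
End oscillation.

(** * Separated nets and coverings by balls *)

Section separated_nets.
Context {R : realType} {d : measure_display} {P : measurableMetricType R d}.
Variables (mu : {measure set P -> \bar R}).
Hypotheses (br : borel_regular mu).

Definition separated (e : R) (t : seq P) := pairwise (fun x y => e <= mdist x y) t.

Let mball x r : measurable (ball x r : set P). Proof. exact: (measurable_ball_metric br). Qed.

Let mU (r : R) t : measurable (\big[setU/set0]_(y <- t) (ball y r : set P)).
Proof. by apply: bigsetU_measurable => y _; exact: mball. Qed.

Lemma bigsetU_sub_seq (F : P -> set P) (t : seq P) (D : set P) :
  (forall y, List.In y t -> F y `<=` D) -> \big[setU/set0]_(y <- t) F y `<=` D.
Proof.
elim: t => [_|y t IH] tD; first by rewrite big_nil.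
rewrite big_cons subUset; split; first by apply: tD; left.
by apply: IH => x xt; apply: tD; right.
Qed.

Lemma integral_le_average (B : set P) (h : P -> \bar R) (K : R) :
  (0 < mu B)%E -> mu B \is a fin_num -> (average mu B h <= K%:E)%E ->
  (\int[mu]_(x in B) h x <= K%:E * mu B)%E.
Proof.
move=> B0 Bf; have b0 : 0 < fine (mu B) by rewrite fine_gt0// B0 ltey_eq Bf.
rewrite /average -(fineK Bf) inver (gt_eqF b0).
by rewrite muleC lee_pdivrMr.
Qed.

Lemma separated_measure (e : R) (t : seq P) : separated e t ->
  (\sum_(y <- t) mu (ball y (e / 2)) = mu (\big[setU/set0]_(y <- t) ball y (e / 2)))%E.
Proof.
elim: t => [_|y t IH /=]; first by rewrite !big_nil measure0.
move=> /andP[yt st]; rewrite !big_cons IH// measureU; [by []|exact: mball|exact: mU|].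
apply/seteqP; split => // z [].
elim: t yt {IH st} => [_ _|x t IH /= /andP[yx yt] yz]; first by rewrite big_nil.
rewrite big_cons => -[xz|]; last exact: IH.
move: yz xz; rewrite !ballEmdist/= => yz xz.
have := metric_triangle y z x; rewrite (metric_sym z); lra.
Qed.

(** The balls of radius e/2 around e-separated points are disjoint, so at most mu(D)/m such points
    fit; a family that cannot be enlarged is a net. *)
Lemma separated_net (A : set P) (e m : R) (D : set P) : 0 < m -> 0 < e ->
  measurable D -> (mu D < +oo)%E ->
  (forall y, A y -> ball y (e / 2) `<=` D /\ (m%:E <= mu (ball y (e / 2)))%E) ->
  exists t : seq P, [/\ separated e t, forall y, List.In y t -> A y &
    forall z, A z -> exists2 y, List.In y t & mdist y z < e].
Proof.
move=> m0 e0 mD Doo AD; apply: contrapT => Hno.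
have ext n : exists t : seq P, [/\ size t = n, separated e t & forall y, List.In y t -> A y].
  elim: n => [|n [t [sz st tA]]]; first by exists [::].
  have [z [Az nz]] : exists z, A z /\ forall y, List.In y t -> e <= mdist y z.
    apply: contrapT => /forallNP H; apply: Hno; exists t; split => // z Az.
    apply: contrapT => N; apply: (H z); split => // y yt.
    by rewrite leNgt; apply/negP => yz; apply: N; exists y.
  exists (z :: t); split => /=; first by rewrite sz.
    rewrite st andbT; elim: t nz {sz st tA} => [//|y t IH] nz /=.
    rewrite metric_sym nz/=; last by left.
    by apply: IH => x xt; apply: nz; right.
  by move=> y [<-//|]; exact: tA.
have bound t : separated e t -> (forall y, List.In y t -> A y) ->
    (((size t)%:R * m)%:E <= mu D)%E.
  move=> st tA; apply: (@le_trans _ _ (\sum_(y <- t) mu (ball y (e / 2)))%E).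
    elim: t tA {st} => [|y t IH] tA; first by rewrite mul0r sume_ge0.
    rewrite big_cons /= -natr1 mulrDl mul1r addrC EFinD; apply: leeD.
      by case: (AD y) => //; apply: tA; left.
    by apply: IH => x xt; apply: tA; right.
  rewrite (separated_measure st); apply: le_measure; rewrite ?inE//.
  by apply: bigsetU_sub_seq => y /tA /AD[].
have Df : mu D \is a fin_num by rewrite ge0_fin_numE.
have [t [sz st tA]] := ext (Num.truncn (fine (mu D) / m)).+1.
have := bound t st tA; rewrite sz -(fineK Df) lee_fin.
rewrite -ler_pdivlMr// leNgt => /negP; apply; exact: truncnS_gt.
Qed.

Lemma integral_cover_le (phi : P -> \bar R) (t : seq P) (e K : R) (A : set P) :
  measurable A -> measurable_fun setT phi -> (forall x, 0 <= phi x)%E ->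
  A `<=` \big[setU/set0]_(y <- t) ball y e ->
  (forall y, List.In y t -> \int[mu]_(x in ball y e) phi x <= K%:E * mu (ball y (e / 2)))%E ->
  (\int[mu]_(x in A) phi x <= \sum_(y <- t) K%:E * mu (ball y (e / 2)))%E.
Proof.
move=> mA mphi phi0 At tK.
apply: (@le_trans _ _ (\int[mu]_(x in \big[setU/set0]_(y <- t) ball y e) phi x)%E).
  by apply: ge0_subset_integral => //; exact: measurable_funTS.
elim: t tK {At} => [|y t IH] tK; first by rewrite !big_nil integral_set0.
rewrite !big_cons.
set V := \big[setU/set0]_(j <- t) ball j e; set W := ball y e.
have mV : measurable V by exact: mU.
have mW : measurable W by exact: mball.
have -> : W `|` V = W `|` (V `\` W) by rewrite setUDr setDv setD0.
have mVW : measurable (V `\` W) by exact: measurableD.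
rewrite ge0_integral_setU//; last 2 first.
- exact: measurable_funTS.
- by apply/disj_setPS => x [Wx [_ /(_ Wx)]].
apply: leeD; first by apply: tK; left.
apply: (@le_trans _ _ (\int[mu]_(x in V) phi x)%E).
  by apply: ge0_subset_integral => //; exact: measurable_funTS.
by apply: IH => x xt; apply: tK; right.
Qed.

End separated_nets.

(** * The limit function: continuity and agreement almost everywhere *)

Section dyadic_limit.
Context {R : realType} {d : measure_display} {P : measurableMetricType R d}.
Variables (mu : {measure set P -> \bar R}).
Hypotheses (br : borel_regular mu) (bfp : balls_finite_positive mu).
Variable c : R.
Hypotheses (c1 : 1 <= c) (dbl : forall (x : P) (r : R), 0 < r ->
  (mu (ball x (2 * r)) <= c%:E * mu (ball x r))%E).
Variables (w : P -> \bar R) (O : nat -> R) (x0 : P).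
Hypotheses (iw : integrable_on_balls mu w) (O0 : forall j, 0 <= O j)
  (Ooo : (\sum_(j <oo) (O j)%:E < +oo)%E)
  (Ow : forall y, ball x0 1 y -> oscillation_bound mu w O y).

Let f := dyadic_limit mu w.
Let c0 : 0 <= c. Proof. exact: le_trans ler01 c1. Qed.

Lemma dyadic_limit_continuous : {for x0, continuous f}.
Proof.
apply/cvgrPdist_le => e e0; have c1' : 1 <= c := c1.
have c20 : 0 < c + 2 by lra.
have e'0 : 0 < e / (c + 2) by rewrite divr_gt0.
have /cvgrPdist_lt/(_ _ e'0)[N _ /(_ N (leqnn N))] := osc_tail_cvg c O0 Ooo.
rewrite /= sub0r normrN ger0_norm ?osc_tail_ge0// => Ne.
near=> y; rewrite distrC.
have yx : mdist x0 y < 2^-1 ^+ N.+1.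
  have : ball x0 (2^-1 ^+ N.+1) y by near: y; apply: nbhsx_ballx; rewrite exprn_gt0.
  by rewrite ballEmdist.
have y1 : ball x0 1 y.
  rewrite ballEmdist/=; apply: lt_le_trans yx _; rewrite exprn_ile1//; lra.
have x1 : ball x0 1 x0 by exact: ballxx.
apply: le_trans (dyadic_limit_dist br bfp c1 dbl iw O0 Ooo (Ow x1) (Ow y1) yx) _.
rewrite mulrC -ler_pdivlMr; [exact: ltW|lra].
Unshelve. all: by end_near. Qed.

(** A substitute for the differentiation theorem. On each ball of a net of mesh 2^-(j+1), both w in
    mean and f uniformly are close to the same average of w; summing bounds the integral of |w - f|
    over B(x0, 1/2) by a multiple of [osc_tail j], which tends to 0. *)
Lemma dyadic_limit_ae (s : R) : dimension_condition mu s -> continuous f ->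
  exists N, [/\ measurable N, mu N = 0%E &
    forall z, ball x0 2^-1 z -> ~ N z -> w z = (f z)%:E].
Proof.
move=> dim cf; have c1' : 1 <= c := c1.
have mball x r : measurable (ball x r : set P) by exact: (measurable_ball_metric br).
have mfE : measurable_fun setT (EFin \o f).
  by apply/measurable_EFinP; exact: (continuous_measurable_metric br cf).
have mw : measurable_fun setT w by case: iw.
pose phi z := `|w z - (f z)%:E|%E.
have mphi : measurable_fun setT phi.
  by apply: measurableT_comp => //; exact: emeasurable_funB.
have phi0 z : (0 <= phi z)%E by exact: abse_ge0.
have [m [m0 _ mb]] := ball_measure_ge bfp dim x0 ltr01.
have D1 := ball_measure_fin bfp x0 ltr01.
have bound j : (\int[mu]_(z in ball x0 2^-1) phi z <=
    ((4 + c) * osc_tail c O j * c)%:E * mu (ball x0 1))%E.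
  pose e : R := 2^-1 ^+ j.+1.
  have e0 : 0 < e by rewrite exprn_gt0.
  have e1 : e <= 2^-1 by rewrite /e exprS ger_pMr// exprn_ile1//; lra.
  have t0 := osc_tail_ge0 c1 O0 j.
  (* If a is the average of w over B(y, 2^-j), then |f z - a| <= (c + 2) tail + tail, and the mean
     oscillation of w adds one more tail. The further factor c shrinks B(y, e) to B(y, e / 2), since
     these smaller balls are disjoint. *)
  pose K := (4 + c) * osc_tail c O j.
  have K0 : 0 <= K by rewrite mulr_ge0//; lra.
  have [|||||t [st tA tcov]] := @separated_net _ _ _ mu br (ball x0 2^-1) e
      (m * (2^-1 `^ s) ^+ j.+2) (ball x0 1).
  - by rewrite mulr_gt0// exprn_gt0// powR_gt0.
  - by [].
  - exact: mball.
  - by rewrite -ge0_fin_numE.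
  - move=> y yB; have eE : e / 2 = 1 * 2^-1 ^+ j.+2 by rewrite mul1r exprS mulrC.
    split; last by rewrite eE; apply: mb; apply: le_ball yB; lra.
    by apply: ball_sub; move: yB; rewrite ballEmdist/=; lra.
  have H1 : (\int[mu]_(z in ball x0 2^-1) phi z <=
      \sum_(y <- t) (K * c)%:E * mu (ball y (e / 2)))%E.
    apply: (integral_cover_le br) => //.
      move=> z /tcov[y yt yz].
      elim: t yt {st tA tcov} => [//|x t IH] /= [->|yt]; rewrite big_cons.
        by left; rewrite ballEmdist.
      by right; exact: IH.
    move=> y /tA yB.
    have y1 : ball x0 1 y by apply: le_ball yB; lra.
    have Oy := Ow y1.
    have ye : (mu (ball y e) <= c%:E * mu (ball y (e / 2)))%E.
      have /(dbl y) : 0 < e / 2 by rewrite divr_gt0.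
      by have -> : 2 * (e / 2) = e by lra.
    apply: (@le_trans _ _ (K%:E * mu (ball y e))%E); last first.
      by rewrite (EFinM K c) -muleA lee_wpmul2l// lee_fin.
    pose a := dyadic_average mu w y j.
    pose b := (3 + c) * osc_tail c O j.
    have b0 : 0 <= b by rewrite mulr_ge0//; lra.
    apply: (@le_trans _ _ (\int[mu]_(z in ball y e) (`|w z - a%:E| + b%:E))%E).
      apply: ge0_le_integral_nomeas => // z; rewrite ballEmdist/= => yz.
      have z1 : ball x0 1 z.
        move: yB; rewrite !ballEmdist/= => yB.
        have := metric_triangle x0 y z; lra.
      have fa := dyadic_limit_near br bfp c1 dbl iw O0 Ooo j Oy.
      have fz := dyadic_limit_dist br bfp c1 dbl iw O0 Ooo (y:=y) (z:=z) (j:=j) Oy (Ow z1) yz.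
      rewrite /phi; case: (w z) => [r| |] //=; rewrite lee_fin.
      have -> : r - f z = (r - a) - (f y - a) - (f z - f y) by ring.
      apply: le_trans (ler_normB _ _) _.
      have := ler_normB (r - a) (f y - a); rewrite /f /b; lra.
    have mwa : measurable_fun setT (fun z => `|w z - a%:E|)%E.
      by apply: measurableT_comp => //; exact: emeasurable_funB.
    rewrite ge0_integralD//; last exact: measurable_funTS.
    rewrite integral_cst//.
    have -> : K = osc_tail c O j + b by rewrite /K /b; ring.
    rewrite EFinD ge0_muleDl ?lee_fin//; apply: leeD => //.
    have B0 : 0 < 2^-1 ^+ j :> R by rewrite exprn_gt0.
    apply: (@le_trans _ _ (\int[mu]_(z in ball y (2^-1 ^+ j)) `|w z - a%:E|)%E).
      apply: ge0_subset_integral => //; first exact: measurable_funTS.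
      by apply: le_ball; rewrite /e exprS; lra.
    apply: le_trans (integral_le_average _ _ (Oy j)) _.
    - exact: ball_measure_gt0.
    - exact: ball_measure_fin.
    apply: (@le_trans _ _ ((O j)%:E * (c%:E * mu (ball y e)))%E).
      rewrite lee_wpmul2l ?lee_fin//.
      by have -> : 2^-1 ^+ j = 2 * e :> R; [rewrite /e exprS; lra|exact: dbl].
    rewrite muleA -EFinM lee_wpmul2r// lee_fin mulrC.
    exact: osc_le_tail.
  apply: le_trans H1 _.
  rewrite -ge0_sume_distrr//.
  have c40 : 0 <= 4 + c by lra.
  apply: lee_wpmul2l; first by rewrite lee_fin; apply: mulr_ge0.
  rewrite (separated_measure br st).
  apply: le_measure; rewrite ?inE//.
    by apply: bigsetU_measurable => y _; exact: mball.
  apply: bigsetU_sub_seq => y /tA yB; apply: ball_sub.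
  by move: yB; rewrite ballEmdist/=; lra.
have I0 : (\int[mu]_(z in ball x0 2^-1) phi z = 0)%E.
  apply/eqP; rewrite eq_le integral_ge0// andbT; apply/lee_addgt0Pr => e e0; rewrite add0e.
  have M0 : 0 <= fine (mu (ball x0 1)) by exact: fine_ge0.
  set M := fine (mu (ball x0 1)) in M0.
  have L0 : 0 < (4 + c) * c * (M + 1) by rewrite !mulr_gt0//; lra.
  have e'0 : 0 < e / ((4 + c) * c * (M + 1)) by rewrite divr_gt0.
  have /cvgrPdist_lt/(_ _ e'0)[j _ /(_ j (leqnn j))] := osc_tail_cvg c O0 Ooo.
  rewrite /= sub0r normrN ger0_norm ?osc_tail_ge0// => je.
  apply: le_trans (bound j) _; rewrite -(fineK D1) -EFinM lee_fin -/M.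
  move: je; rewrite ltr_pdivlMr// => /ltW; apply: le_trans.
  have -> : (4 + c) * osc_tail c O j * c * M = osc_tail c O j * ((4 + c) * c * M) by ring.
  rewrite ler_wpM2l ?osc_tail_ge0// ler_wpM2l ?mulr_ge0 //; lra.
have mB : measurable (ball x0 2^-1 : set P) by exact: mball.
have := (ae_eq_integral_abs mu mB (measurable_funTS (D:=ball x0 2^-1) (emeasurable_funB mw mfE))).1 I0.
move=> [N [mN N0 NP]]; exists N; split => // z zB zN.
have : (w z - (f z)%:E = 0)%E.
  apply: contrapT => H; apply: zN; apply: NP => /= /(_ zB); exact: H.
case: (w z) => [r| |] //=; rewrite -EFinB => -[] /eqP; rewrite subr_eq0 => /eqP ->//.
Qed.

End dyadic_limit.

(** * Values on the exceptional set *)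

Section majorant.
Context {R : realType} {d : measure_display} {P : measurableMetricType R d}.
Variables (mu : {measure set P -> \bar R}).
Hypotheses (br : borel_regular mu) (bfp : balls_finite_positive mu).

Lemma average_ge0 (B : set P) (h : P -> \bar R) : (0 < mu B)%E ->
  mu B \is a fin_num -> (forall x, 0 <= h x)%E -> (0 <= average mu B h)%E.
Proof.
move=> B0 Bf h0; have b0 : 0 < fine (mu B) by rewrite fine_gt0// B0 ltey_eq Bf.
rewrite /average -(fineK Bf) inver (gt_eqF b0); apply: mule_ge0.
  by rewrite lee_fin invr_ge0 ltW.
by apply: integral_ge0 => x _.
Qed.

(** The additive error a = j + 4 survives the p-th root because S^p + a <= (S + a)^p for a >= 1 and
    p >= 1. *)
Lemma lsc_majorant_average (p lam : R) (g : P -> \bar R) (S : nat -> R) (x0 : P)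
    (G D : set P) :
  1 <= p -> 0 < lam -> measurable_fun setT g -> (forall x, 0 <= g x)%E ->
  open G -> (mu G < +oo)%E -> measurable D -> mu D = 0%E -> (forall j, 0 <= S j) ->
  (forall j, average mu (ball x0 (lam * 2^-1 ^+ j)) (fun y => g y `^ p) `^ p^-1 <=
    (S j)%:E)%E ->
  exists h : P -> \bar R, [/\ lower_semicontinuous h, forall x, (1 <= h x)%E,
    forall x, G x -> (g x <= h x)%E, forall x, G x -> D x -> h x = +oo%E &
    forall j, (average mu (ball x0 (lam * 2^-1 ^+ j)) (fun y => h y `^ p) `^ p^-1 <=
      (S j + (j + 4)%:R)%:E)%E].
Proof.
move=> p1 lam0 mg g0 oG Gfin mD D0 S0 gS; have p0 : 0 < p by lra.
have rj j : 0 < lam * 2^-1 ^+ j by rewrite mulr_gt0// exprn_gt0.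
have [|||h [hl h1 hg hD hB]] := @lsc_majorant _ _ _ _ br G D
    (fun j => ball x0 (lam * 2^-1 ^+ j)) g p p0 oG Gfin mD D0 mg g0.
- by move=> j; exact: (measurable_ball_metric br).
- by move=> j; exact: bfp.
- move=> j k jk; apply: le_ball; rewrite ler_pM2l// ler_wiXn2l//; lra.
exists h; split => // j.
set B := ball x0 (lam * 2^-1 ^+ j).
have B0 : (0 < mu B)%E by exact: ball_measure_gt0.
have Bf : mu B \is a fin_num by exact: ball_measure_fin.
have b0 : 0 < fine (mu B) by rewrite fine_gt0// B0 ltey_eq Bf.
have gp : (average mu B (fun y => g y `^ p) <= (S j `^ p)%:E)%E.
  have a0 : (0 <= average mu B (fun y => g y `^ p))%E.
    by apply: average_ge0 => // y; exact: poweR_ge0.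
  have := le_poweR (ltW p0) (poweR_ge0 _ _) (gS j).
  by rewrite -poweRrM mulVf ?gt_eqF// poweRe1// poweR_EFin.
have gI := integral_le_average B0 Bf gp.
have a1 : 1 <= (j + 4)%:R :> R by rewrite ler1n addn4.
move: (j + 4)%N a1 (hB j) => a a1 hj.
have hI : (average mu B (fun y => h y `^ p) <= (S j `^ p + a%:R)%:E)%E.
  apply: (average_le (m := fine (mu B))) => //.
  - exact: (measurable_ball_metric br).
  - by rewrite fineK.
  - by rewrite -ge0_fin_numE.
  - by rewrite addr_ge0 ?powR_ge0//; lra.
  rewrite EFinD ge0_muleDl ?lee_fin ?powR_ge0//.
  by apply: le_trans hj _; rewrite leeD2r.
have h0 : (0 <= average mu B (fun y => h y `^ p))%E.
  by apply: average_ge0 => // y; exact: poweR_ge0.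
apply: le_trans (le_poweR _ h0 hI) _; first by rewrite invr_ge0 ltW.
rewrite poweR_EFin lee_fin.
have Sa : 0 < S j + a%:R by have := S0 j; lra.
have -> : S j + a%:R = ((S j + a%:R) `^ p) `^ p^-1.
  by rewrite -powRrM mulfV ?gt_eqF// powRr1// ltW.
have key : S j `^ p + a%:R <= (S j + a%:R) `^ p.
  have pE x : 0 < x -> x `^ p = x * x `^ (p - 1).
    move=> x0'; have {1}-> : p = 1 + (p - 1) by lra.
    by rewrite (@powRD _ x 1) ?(gt_eqF x0') ?implybT// powRr1 ?ltW.
  rewrite (pE _ Sa) mulrDl; apply: lerD.
    have := S0 j; rewrite le_eqVlt => /orP[/eqP <-|Sj]; first by rewrite powR0 ?gt_eqF// mul0r.
    rewrite (pE _ Sj) ler_pM2l//; apply: ge0_ler_powR; rewrite ?nnegrE //; lra.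
  apply: ler_peMr; first by lra.
  apply: (@le_trans _ _ (1 `^ (p - 1))); first by rewrite powR1.
  by apply: ge0_ler_powR; rewrite ?nnegrE//; have := S0 j; lra.
by apply: ge0_ler_powR; rewrite ?nnegrE ?invr_ge0 ?addr_ge0 ?powR_ge0// ltW.
Qed.

(** j + 4 <= 4 (3/2)^j turns the added part into a geometric series of ratio 3/4. *)
Lemma nneseries_majorant_lty (S : nat -> R) : (forall j, 0 <= S j) ->
  (\sum_(j <oo) (2^-1 ^+ j * S j)%:E < +oo)%E ->
  (\sum_(j <oo) (2^-1 ^+ j * (S j + (j + 4)%:R))%:E < +oo)%E.
Proof.
move=> S0 Soo.
have pj j : (j + 4)%:R <= 4 * (3 / 2) ^+ j :> R.
  elim: j => [|j IH]; first by rewrite expr0; lra.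
  have : 1 <= (3 / 2) ^+ j :> R by rewrite exprn_ege1//; lra.
  have -> : (j.+1 + 4)%:R = (j + 4)%:R + 1 :> R by rewrite natr1.
  rewrite exprS; move: ((3 / 2) ^+ j) ((j + 4)%:R : R) IH => y z; lra.
have H j : 2^-1 ^+ j * (S j + (j + 4)%:R) <= 2^-1 ^+ j * S j + 4 * (3 / 4) ^+ j.
  rewrite mulrDr lerD2l.
  have -> : 4 * (3 / 4) ^+ j = 2^-1 ^+ j * (4 * (3 / 2) ^+ j) :> R.
    by rewrite mulrCA -exprMn; congr (_ * _ ^+ _); lra.
  by rewrite ler_wpM2l// exprn_ge0.
have t0 j : (0 <= (2^-1 ^+ j * S j)%:E)%E by rewrite lee_fin mulr_ge0// exprn_ge0.
have q0 : 0 <= 3 / 4 :> R by lra.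
apply: (@le_lt_trans _ _ (\sum_(j <oo) ((2^-1 ^+ j * S j)%:E + (4 * (3 / 4) ^+ j)%:E))%E).
  apply: lee_nneseries => [j _ _|j _]; last by rewrite -EFinD lee_fin.
  by rewrite lee_fin mulr_ge0 ?exprn_ge0// addr_ge0.
rewrite nneseriesD; [|by move=> j _ _; exact: t0|
  by move=> j _ _; rewrite lee_fin mulr_ge0// exprn_ge0].
rewrite lte_add_pinfty//.
under eq_eseriesr do rewrite EFinM.
rewrite nneseriesZl; last by move=> j _; rewrite lee_fin exprn_ge0.
have Q : (\sum_(j <oo) ((3 / 4) ^+ j : R)%:E < +oo)%E by apply: nneseries_geometric_lty; lra.
rewrite lte_mul_pinfty//.
Qed.

Lemma average_poweR_scale (p a : R) (h : P -> \bar R) (x : P) (r : R) :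
  0 < p -> 0 <= a -> 0 < r -> measurable_fun setT h -> (forall x, 0 <= h x)%E ->
  (average mu (ball x r) (fun y => (a%:E * h y) `^ p) `^ p^-1 =
   a%:E * average mu (ball x r) (fun y => h y `^ p) `^ p^-1)%E.
Proof.
move=> p0 a0 r0 mh h0.
have Bf := ball_measure_fin bfp x r0.
have b0 : 0 < fine (mu (ball x r)) by rewrite fine_gt0// ball_measure_gt0// ltey_eq Bf.
rewrite /average -(fineK Bf) inver (gt_eqF b0).
have I0 : (0 <= \int[mu]_(y in ball x r) (h y `^ p))%E.
  by apply: integral_ge0 => y _; exact: poweR_ge0.
under eq_integral => y _ do rewrite poweRM ?lee_fin// poweR_EFin.
rewrite ge0_integralZl; last 4 first.
- exact: (measurable_ball_metric br).
- apply: measurable_funTS; exact: (measurableT_comp (measurable_poweR p)).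
- by move=> y _; exact: poweR_ge0.
- by rewrite lee_fin powR_ge0.
rewrite muleCA poweRM ?mule_ge0 ?lee_fin ?powR_ge0 ?invr_ge0 ?(ltW b0)//.
by rewrite poweR_EFin -powRrM mulfV ?gt_eqF// powRr1.
Qed.

End majorant.

(** * Finiteness of the cost *)

Section cost_finite.
Context {R : realType} {d : measure_display} {P : measurableMetricType R d}.
Variables (mu : {measure set P -> \bar R}).
Hypotheses (br : borel_regular mu) (bfp : balls_finite_positive mu).
Variable c : R.
Hypotheses (c1 : 1 <= c) (dbl : forall (x : P) (r : R), 0 < r ->
  (mu (ball x (2 * r)) <= c%:E * mu (ball x r))%E).
Variables (p cP lam : R).
Hypotheses (p1 : 1 <= p) (cP0 : 0 < cP) (lam0 : 0 < lam)
  (PI : forall (x : P) (r : R) (u g : P -> \bar R), 0 < r ->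
      integrable_on_balls mu u -> upper_gradient u g ->
      (average mu (ball x r) (fun y => `|u y - average mu (ball x r) u|)
        <= cP%:E * diam (ball x r) *
           average mu (ball x (lam * r)%R) (fun y => g y `^ p) `^ p^-1)%E).
Variables (h : P -> \bar R) (F : set P) (x0 : P) (S : nat -> R).
Hypotheses (h0 : forall x, (0 <= h x)%E) (lsc_h : lower_semicontinuous h)
  (lsc_cost : lower_semicontinuous (cost h F)) (mF : measurable F)
  (F0 : (0 < mu (F `&` ball x0 1))%E)
  (S0 : forall j, 0 <= S j) (Soo : (\sum_(j <oo) (2^-1 ^+ j * S j)%:E < +oo)%E)
  (hS : forall j, (average mu (ball x0 (lam * 2^-1 ^+ j)) (fun y => h y `^ p) `^ p^-1 <=
    (S j)%:E)%E).

Lemma bounded_integrable_on_balls (w : P -> \bar R) : measurable_fun setT w ->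
  (forall y, 0 <= w y <= 1)%E -> integrable_on_balls mu w.
Proof.
move=> mw w01; split => // x r r0; apply/integrableP; split; first exact: measurable_funTS.
have mB := measurable_ball_metric br x r.
apply: (@le_lt_trans _ _ (\int[mu]_(y in ball x r) 1)%E).
  apply: ge0_le_integral_nomeas => y _ //.
  by case/andP: (w01 y) => w0 w1; rewrite gee0_abs.
rewrite integral_cst// mul1e -ge0_fin_numE//; exact: ball_measure_fin.
Qed.

(* If the cost were infinite at [x0], its truncation at height one would be
   close to [1] around [x0] and [0] on [F], while having an arbitrarily small
   upper gradient. *)
Lemma cost_lt_pinfty : (cost h F x0 < +oo)%E.
Proof.
rewrite ltey; apply/eqP => coo.
have p0 : 0 < p := lt_le_trans ltr01 p1.
pose Sg := fine (\sum_(j <oo) (2^-1 ^+ j * S j)%:E)%E.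
have S0' j : (0 <= (2^-1 ^+ j * S j)%:E)%E by rewrite lee_fin mulr_ge0// exprn_ge0.
have Sg0 : 0 <= Sg by apply: fine_ge0; exact: nneseries_ge0.
have SgE : (\sum_(j <oo) (2^-1 ^+ j * S j)%:E)%E = Sg%:E.
  by rewrite fineK// ge0_fin_numE//; exact: nneseries_ge0.
have mball x r : measurable (ball x r : set P) by exact: (measurable_ball_metric br).
have Bf := ball_measure_fin bfp x0 ltr01.
set m := fine (mu (ball x0 1)).
pose th := fine (mu (F `&` ball x0 1)).
have mFB : measurable (F `&` ball x0 1) by exact: measurableI.
have Ff : mu (F `&` ball x0 1) \is a fin_num.
  rewrite ge0_fin_numE//; apply: (@le_lt_trans _ _ (mu (ball x0 1))).
    by apply: le_measure; rewrite ?inE//; exact: subIsetr.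
  by rewrite -ge0_fin_numE.
have th0 : 0 < th by rewrite fine_gt0// F0 ltey_eq Ff.
have m0 : 0 <= m by exact: fine_ge0.
(* Let w be the truncated cost with parameter k and A its average over B(x0, 1). Then T / k bounds
   the drift of the averages of w at x0 between radius 1 and small radii, and V / k bounds the
   integral of |w - A| over B(x0, 1). *)
pose T := c * (2 * cP * Sg); pose V := 2 * cP * S 0 * m.
have c0 : 0 < c by apply: lt_le_trans c1.
have T0 : 0 <= T by rewrite !mulr_ge0// ltW.
have V0 : 0 <= V by rewrite !mulr_ge0// ltW.
(* As w = 0 on F and A >= 1/2 - T / k, one gets (1/2 - T / k) th <= V / k. The claim is this
   multiplied by k, and it fails for k = 2 X / th + 1. *)
suff H (k : R) : 0 < k -> k * (th / 2) <= V + T * th.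
  pose X := V + T * th; have X0 : 0 <= X by rewrite addr_ge0// mulr_ge0// ltW.
  have k0 : 0 < 2 * X / th + 1 by rewrite ltr_wpDl// divr_ge0 ?mulr_ge0// ltW.
  have := H _ k0; rewrite -/X.
  have -> : (2 * X / th + 1) * (th / 2) = X + th / 2 by field; rewrite gt_eqF.
  lra.
move=> k0; pose w := cost_trunc h F k.
have w01 y : (0 <= w y <= 1)%E by exact: cost_trunc_itv.
have lw : lower_semicontinuous w by exact: cost_trunc_lsc.
have mw : measurable_fun setT w by apply: (borel_fun_measurable br); exact: lsc_borel.
have iw := bounded_integrable_on_balls mw w01.
have ki0 : 0 <= k^-1 by rewrite invr_ge0 ltW.
pose O j := 2 * cP * (2^-1 ^+ j * (k^-1 * S j)).
have O0 j : 0 <= O j by rewrite !mulr_ge0// ?exprn_ge0// ltW.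
have mh : measurable_fun setT h by apply: (borel_fun_measurable br); exact: lsc_borel.
have Ow : oscillation_bound mu w O x0.
  apply: (poincare_oscillation br bfp (S := fun j => k^-1 * S j) cP0 PI iw
    (cost_trunc_upper_gradient F h0 lsc_h k0)).
  move=> j; rewrite (average_poweR_scale br bfp)//; last by rewrite mulr_gt0// exprn_gt0.
  by rewrite EFinM lee_wpmul2l ?lee_fin.
have OE : (\sum_(j <oo) (O j)%:E = (2 * cP * k^-1 * Sg)%:E)%E.
  rewrite EFinM -SgE -nneseriesZl; last by move=> j _; exact: S0'.
  by apply: eq_eseriesr => j _; rewrite -EFinM /O; congr (_%:E); ring.
have Ooo : (\sum_(j <oo) (O j)%:E < +oo)%E by rewrite OE ltry.
have tail : osc_tail c O 0 = T / k.
  by rewrite /osc_tail OE /= /T; ring.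
(* The infinite cost gives w x0 = 1, so w > 1/2 on a neighbourhood by lower semicontinuity. *)
have [V' /nbhs_ballP[e /= e0 eV'] V'w] : exists2 V, nbhs x0 V & forall y, V y -> (2^-1%:E < w y)%E.
  apply: lw; rewrite /w /cost_trunc coo gt0_muley ?lte_fin ?invr_gt0//.
  rewrite lt_min lte_fin ltry andbT; lra.
have [j je] : exists j, 2^-1 ^+ j < e :> R.
  have /cvgrPdist_lt/(_ _ e0)[j _ /(_ j (leqnn j))] : (fun j => 2^-1 ^+ j : R) @ \oo --> 0.
    by apply: cvg_expr; rewrite ger0_norm; lra.
  by rewrite /= sub0r normrN ger0_norm ?exprn_ge0//; exists j.
have Aj : 2^-1 <= dyadic_average mu w x0 j.
  have rj : 0 < 2^-1 ^+ j :> R by rewrite exprn_gt0.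
  have Bj := ball_measure_fin bfp x0 rj.
  have bj : 0 < fine (mu (ball x0 (2^-1 ^+ j))).
    by rewrite fine_gt0// ball_measure_gt0// ltey_eq Bj.
  have Ij : (\int[mu]_(y in ball x0 (2^-1 ^+ j)) w y)%E \is a fin_num.
    by apply: integrable_fin_num => //; exact: iw.2.
  rewrite /dyadic_average /average -(fineK Bj) inver (gt_eqF bj) -(fineK Ij) /=.
  rewrite mulrC ler_pdivlMr// -lee_fin EFinM !fineK// -integral_cst//.
  apply: ge0_le_integral_nomeas => y By; first by rewrite lee_fin.
  by apply/ltW/V'w/eV'; apply: le_ball By; exact: ltW.
have A0 : 2^-1 - T / k <= dyadic_average mu w x0 0.
  have := dyadic_average_near br bfp c1 dbl iw O0 Ooo 0 j Ow.
  rewrite add0n tail ler_norml => /andP[_]; lra.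
have := integral_le_average _ _ (Ow 0); rewrite expr0.
move=> /(_ (ball_measure_gt0 bfp x0 ltr01) Bf).
set A := dyadic_average mu w x0 0 in A0 *.
have AF : (A%:E * mu (F `&` ball x0 1) <= \int[mu]_(y in ball x0 1) `|w y - A%:E|)%E.
  apply: (@le_trans _ _ (\int[mu]_(y in F `&` ball x0 1) `|w y - A%:E|)%E); last first.
    apply: ge0_subset_integral => //.
    by apply: measurableT_comp => //; apply: emeasurable_funB => //; exact: measurable_funTS.
  have [A_ge0|A_lt0] := leP 0 A; last first.
    apply: (@le_trans _ _ 0%E); last exact: integral_ge0.
    by rewrite mule_le0_ge0// lee_fin ltW.
  rewrite -integral_cst//; apply: ge0_le_integral_nomeas => y [Fy _].
    by rewrite lee_fin.
  rewrite /w /cost_trunc (cost_eq0 h0 Fy) mule0 min_r// sub0e abseN gee0_abs// lee_fin.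
move=> /(le_trans AF); rewrite -(fineK Ff) -(fineK Bf) -!EFinM lee_fin -/th -/m.
rewrite /O expr0 mul1r => H.
have {}H : (2^-1 - T / k) * th <= 2 * cP * (k^-1 * S 0) * m.
  by apply: le_trans H; rewrite ler_wpM2r// ltW.
have -> : k * (th / 2) = k * ((2^-1 - T / k) * th) + T * th.
  by field; rewrite gt_eqF.
rewrite lerD2r; apply: (le_trans (ler_wpM2l (ltW k0) H)).
by rewrite le_eqVlt; apply/orP; left; apply/eqP; rewrite /V; field; rewrite gt_eqF.
Qed.
End cost_finite.

(** * Values at the start of a curve of finite integral *)

Section curve_limit.
Context {R : realType} {d : measure_display} {P : measurableMetricType R d}.
Notation leb := (@lebesgue_measure R).

Lemma integral_near0 (l e : R) (H : R -> \bar R) : 0 < l -> 0 < e ->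
  measurable_fun (setT : set (measurableTypeR R)) H -> (forall t, 0 <= H t)%E ->
  (\int[leb]_(t in `[0%R, l]) H t < +oo)%E ->
  \forall t \near 0, 0 <= t -> (\int[leb]_(s in `[0%R, t]) H s <= e%:E)%E.
Proof.
move=> l0 e0 mH H0 Hoo.
have iH : leb.-integrable `[0%R, l] H.
  apply/integrableP; split; first exact: measurable_funTS.
  by under eq_integral do rewrite gee0_abs//.
have mk : measurable_fun (setT : set (measurableTypeR R)) (fine \o H).
  exact: measurableT_comp.
have ik : leb.-integrable `[0%R, l] (EFin \o (fine \o H)).
  apply: (le_integrable _ _ _ iH) => //.
    by apply/measurable_EFinP; exact: measurable_funTS.
  move=> t _ /=; rewrite (gee0_abs (H0 t)) ger0_norm ?fine_ge0//.
  by case: (H t) (H0 t) => [r| |]// _; rewrite leey.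
have := parameterized_integral_near_left l0 e0 ik.
move=> near_int; near=> t.
have int_t : 0 <= t -> `|parameterized_integral leb 0 t (fine \o H)| < e by near: t.
move=> t0.
have tl : t <= l.
  near: t; apply/nbhs_ballP; exists l => //= t; rewrite /ball/= sub0r normrN => tl.
  exact: ltW (le_lt_trans (ler_norm _) tl).
have it : leb.-integrable `[0%R, t] H.
  by apply: integrableS iH => //; apply: subset_itvl; rewrite bnd_simp.
have -> : (\int[leb]_(s in `[0%R, t]) H s = \int[leb]_(s in `[0%R, t]) (fine (H s))%:E)%E.
  apply: ge0_ae_eq_integral => //.
  - exact: measurable_funTS.
  - by apply/measurable_EFinP; exact: measurable_funTS.
  - by move=> s _; rewrite lee_fin fine_ge0.
  - have : {ae leb, forall s, [set` `[0%R, t]] s -> H s \is a fin_num} by exact: integrable_ae.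
    move=> [A [mA A0 HA]]; exists A; split => // s /= Hs; apply: HA => /= Hf.
    by apply: Hs => ts; rewrite fineK// Hf.
have kt : leb.-integrable `[0%R, t] (EFin \o (fine \o H)).
  by apply: integrableS ik => //; apply: subset_itvl; rewrite bnd_simp.
rewrite -(fineK (integrable_fin_num _ kt))// lee_fin.
by apply: le_trans (ler_norm _) (ltW _); exact: int_t.
Unshelve. all: by end_near. Qed.

(** Initial arcs of an arc length curve are again such curves, so |u (gamma 0) - f (gamma t)| is at
    most the integral of h up to t, for arbitrarily small t with gamma t outside N. *)
Lemma upper_gradient_curve_limit (u g h : P -> \bar R) (f : P -> R) (G N : set P)
    (l : R) (gamma : R -> P) :
  upper_gradient u g -> continuous f ->
  (forall z, G z -> ~ N z -> u z = (f z)%:E) ->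
  (forall z, 0 <= h z)%E -> (forall z, G z -> g z <= h z)%E ->
  (forall z, G z -> N z -> h z = +oo)%E ->
  measurable_fun (setT : set (measurableTypeR R)) (h \o gamma) ->
  arc_length_curve l gamma -> continuous gamma ->
  (forall t, 0 <= t < l -> G (gamma t)) ->
  (\int[leb]_(t in `[0%R, l]) h (gamma t) < +oo)%E ->
  u (gamma 0) = (f (gamma 0))%:E.
Proof.
move=> ug cf uf h0 gh hN mh gl cg gG hoo; have l0 := curve_pos gl.
have close (e : R) : 0 < e -> (`|u (gamma 0%R) - (f (gamma 0%R))%:E| <= (2 * e)%:E)%E.
  move=> e0.
  have small := integral_near0 l0 e0 mh (fun t => h0 _) hoo.
  have fc : \forall t \near 0, `|f (gamma 0) - f (gamma t)| <= e.
    have : (f \o gamma) t @[t --> 0] --> (f \o gamma) 0.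
      by apply: continuous_comp; [exact: cg|exact: cf].
    by move=> /cvgrPdist_le/(_ _ e0).
  have : \forall t \near 0, 0 <= t -> t < l /\
      ((\int[leb]_(s in `[0%R, t]) h (gamma s) <= e%:E)%E /\ `|f (gamma 0) - f (gamma t)| <= e).
    near=> t.
    have st : 0 <= t -> (\int[leb]_(s in `[0%R, t]) h (gamma s) <= e%:E)%E by near: t.
    move=> t0; split; last by split; [exact: st|near: t].
    near: t; apply/nbhs_ballP; exists l => //= t; rewrite /ball/= sub0r normrN.
    exact: le_lt_trans (ler_norm _).
  move=> /nbhs_ballP[r /= r0 near_r].
  (* Otherwise h would be +oo along a whole initial arc, against the finite integral. *)
  have [t [t0 tr tN]] : exists t, [/\ 0 < t, t < r & ~ (G (gamma t) /\ N (gamma t))].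
    apply: contrapT => Hno; pose q := Num.min r l.
    have q0 : 0 < q by rewrite lt_min r0.
    have hr : (\int[leb]_(s in `]0%R, q[) h (gamma s) = +oo)%E.
      have -> : (\int[leb]_(s in `]0%R, q[) h (gamma s) = \int[leb]_(s in `]0%R, q[) (cst +oo s))%E.
        apply: eq_integral => s; rewrite inE/= in_itv/= lt_min => /and3P[s0 sr _].
        apply: contrapT => hs; apply: Hno; exists s; split => // -[Gs Ns].
        exact/hs/hN.
      by rewrite integral_cst//= lebesgue_measure_itv/= lte_fin q0 sube0 gt0_mulye.
    move: hoo; rewrite ltNge => /negP; apply; rewrite -hr.
    apply: ge0_subset_integral => //; first exact: measurable_funTS.
    move=> s /=; rewrite !in_itv/= lt_min => /and3P[s0 _ sl].
    by rewrite (ltW s0) (ltW sl).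
  have [tl [ti ft]] : t < l /\ ((\int[leb]_(s in `[0%R, t]) h (gamma s) <= e%:E)%E /\
      `|f (gamma 0) - f (gamma t)| <= e).
    by apply: (near_r t) => //; rewrite ?(ltW t0)// /ball/= sub0r normrN gtr0_norm.
  have Gt : G (gamma t) by apply: gG; rewrite ltW.
  have ut : u (gamma t) = (f (gamma t))%:E by apply: uf => // Nt; apply: tN.
  have gt : arc_length_curve t gamma.
    split => //; first exact: continuous_subspaceT.
    move=> s /andP[s0 st]; apply: (curve_arc_length gl).
    by rewrite s0 (le_trans st)// ltW.
  have : (`|u (gamma 0%R) - (f (gamma t))%:E| <= e%:E)%E.
    rewrite -ut; apply: le_trans (upper_gradient_le ug gt) _.
    apply: le_trans ti; apply: ge0_le_integral_nomeas => s /=; rewrite in_itv/= => /andP[s0 st].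
      exact: upper_gradient_ge0 ug _.
    by apply/gh/gG; rewrite s0 (le_lt_trans st).
  case: (u (gamma 0)) => [x| |] //=; rewrite !lee_fin.
  have -> : x - f (gamma 0) = (x - f (gamma t)) - (f (gamma 0) - f (gamma t)) by ring.
  have := ler_normB (x - f (gamma t)) (f (gamma 0) - f (gamma t)); lra.
(* The bound also excludes infinite values of u, for which the distance to a real number is +oo. *)
case E : (u (gamma 0)) close => [x| |] close.
- congr (_%:E); apply/eqP; rewrite -subr_eq0 -normr_le0; apply/ler_addgt0Pr => e e0.
  have e20 : 0 < e / 2 by rewrite divr_gt0.
  have := close _ e20; rewrite lee_fin add0r; lra.
- by have := close 1 ltr01.
- by have := close 1 ltr01.
Unshelve. all: by end_near. Qed.

End curve_limit.

Section pointwise_value.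
Context {R : realType} {d : measure_display} {P : measurableMetricType R d}.
Variables (mu : {measure set P -> \bar R}).
Hypotheses (br : borel_regular mu) (bfp : balls_finite_positive mu).
Variable c : R.
Hypotheses (c1 : 1 <= c) (dbl : forall (x : P) (r : R), 0 < r ->
  (mu (ball x (2 * r)) <= c%:E * mu (ball x r))%E).
Variables (p cP lam : R).
Hypotheses (p1 : 1 <= p) (cP0 : 0 < cP) (lam0 : 0 < lam)
  (PI : forall (x : P) (r : R) (u g : P -> \bar R), 0 < r ->
      integrable_on_balls mu u -> upper_gradient u g ->
      (average mu (ball x r) (fun y => `|u y - average mu (ball x r) u|)
        <= cP%:E * diam (ball x r) *
           average mu (ball x (lam * r)%R) (fun y => g y `^ p) `^ p^-1)%E).
Variables (u g : P -> \bar R) (f : P -> R) (x0 : P) (N : set P) (S : nat -> R).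
Hypotheses (lc : locally_compact [set: P]) (ug : upper_gradient u g)
  (cf : continuous f) (mN : measurable N) (N0 : mu N = 0%E)
  (uf : forall z, ball x0 2^-1 z -> ~ N z -> u z = (f z)%:E)
  (S0 : forall j, 0 <= S j) (Soo : (\sum_(j <oo) (2^-1 ^+ j * S j)%:E < +oo)%E)
  (gS : forall j, (average mu (ball x0 (lam * 2^-1 ^+ j)) (fun y => g y `^ p) `^ p^-1 <=
    (S j)%:E)%E).

Let mball x r : measurable (ball x r : set P). Proof. exact: (measurable_ball_metric br). Qed.

(** The singleton is a ball and has positive measure, so x0 is not in the null set N. *)
Lemma isolated_value (e : R) : 0 < e -> ball x0 e `<=` [set x0] -> u x0 = (f x0)%:E.
Proof.
move=> e0 eB; apply: uf; first by apply: ballxx; lra.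
move=> Nx; have := ball_measure_gt0 bfp x0 e0; rewrite ltNge => /negP; apply.
by rewrite -N0; apply: le_measure; rewrite ?inE// => z /eB ->.
Qed.

Lemma nonisolated_value : (forall e : R, 0 < e -> ~ ball x0 e `<=` [set x0]) ->
  u x0 = (f x0)%:E.
Proof.
move=> niso.
have [K [rho rho0 rhoK] cK] : exists2 K : set P, (exists2 rho : R, 0 < rho & ball x0 rho `<=` K) &
    compact K.
  have [K + [cK _]] := @lc x0 I; rewrite withinET => /nbhs_ballP[rho /= rho0 HK].
  by exists K => //; exists rho.
pose a := Num.min rho 2^-1.
have a0 : 0 < a by rewrite lt_min rho0/= invr_gt0.
have [z [az zx]] : exists z, ball x0 a z /\ z <> x0.
  have /existsNP[z /not_implyP[]] := niso _ a0; by exists z.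
have arho : a <= rho by rewrite ge_min lexx.
have a2 : a <= 2^-1 by rewrite ge_min lexx orbT.
pose dz := mdist x0 z.
have dz0 : 0 < dz by rewrite mdist_gt0; apply/eqP => xz; apply: zx.
have dza : dz < a by move: az; rewrite ballEmdist.
(* Half the distance to z: then B(z, r) lies in F and in B(x0, 1), which gives F positive measure
   there, and B(x0, 2r) still lies in the compact set K. *)
pose r := dz / 2; have r0 : 0 < r by rewrite divr_gt0.
pose G : set P := ball x0 r; pose F := ~` G.
have oG : open G by exact: metric_ball_open.
have mF : measurable F by apply: measurableC; exact: mball.
have F0 : (0 < mu (F `&` ball x0 1))%E.
  apply: (@lt_le_trans _ _ (mu (ball z r))); first exact: ball_measure_gt0.
  apply: le_measure; rewrite ?inE//; first exact: measurableI.
  move=> y; rewrite ballEmdist/= => zy; split.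
    rewrite /F /G ballEmdist/= => xy.
    have := metric_triangle x0 y z; rewrite (metric_sym y) -/dz; move: xy zy; rewrite /r; lra.
  by rewrite ballEmdist/=; have := metric_triangle x0 z y; rewrite -/dz; move: zy; rewrite /r; lra.
have mg : measurable_fun setT g.
  by apply: (borel_fun_measurable br); exact: upper_gradient_borel ug.
have Goo : (mu G < +oo)%E by rewrite -ge0_fin_numE//; exact: ball_measure_fin.
have [h [lh h1 gh hN hS]] := lsc_majorant_average br bfp p1 lam0 mg
  (upper_gradient_ge0 ug) oG Goo mN N0 S0 gS.
have h0 y : (0 <= h y)%E by apply: le_trans (h1 y); rewrite lee_fin.
have lcost : lower_semicontinuous (cost h F).
  apply: (cost_lsc h0 lh h1 (K := K) (x0 := x0) (r := r)) => //.
  by apply: subset_trans rhoK; apply: le_ball; rewrite /r; lra.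
have S0' j : 0 <= S j + (j + 4)%:R by rewrite addr_ge0.
have coo := cost_lt_pinfty br bfp c1 dbl p1 cP0 lam0 PI h0 lh lcost mF F0 S0'
  (nneseries_majorant_lty S0 Soo) hS.
have cF : closed F by exact: open_closedC.
have [M [gam [M0 gL gx [gF gG] gI]]] := cost_hit h0 lh cF coo.
have gM : gam 0 <> gam M.
  by move=> E; apply: gF; rewrite -E gx; exact: ballxx.
have [l [gam' [gl gL' gx' gt gH]]] := lip1_arc_length_reparam gL M0 gM.
have mh' := measurable_lsc_curve lh (lip1_continuous gL').
rewrite -gx -gx'.
apply: (upper_gradient_curve_limit (G := G) (N := N) (h := h) ug cf _ h0 gh hN mh' gl).
- by move=> y Gy; apply: uf; apply: le_ball Gy; rewrite /r; lra.
- exact: lip1_continuous.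
- by move=> t /gt[s sM ->]; apply: contrapT; exact: gG.
- exact: le_lt_trans (gH h h0 mh') gI.
Qed.

End pointwise_value.

Theorem theorem7p6 (R : realType) (d : measure_display)
    (P : measurableMetricType R d) (mu : {sigma_finite_measure set P -> \bar R})
    (nX : (P -> \bar R) -> \bar R) (p s : R) :
  borel_regular mu -> balls_finite_positive mu ->
  doubling mu ->
  quasi_banach_function_lattice mu nX ->
  locally_compact [set: P] ->
  1 <= p -> poincare mu p ->
  0 < s -> dimension_condition mu s ->
  [\/ [/\ 1 <= s, s < p &
        exists q : \bar R, (p%:E <= q)%E /\ embeds_loc nX (fun=> Lnorm mu q)],
      [/\ 1 = p, p = s &
        exists alpha : R, 1 <= alpha /\ embeds_loc nX (zygmund_norm mu s alpha)],
      [/\ 1 < p, p = s &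
        exists alpha : R, 1 < alpha /\ embeds_loc nX (zygmund_norm mu s alpha)]
    | [/\ 1 <= p, p < s & embeds_loc nX (fun=> lorentz_norm mu s)]] ->
  forall u : P -> \bar R, newtonian nX u ->
    exists2 f : P -> R, continuous f & forall x, u x = (f x)%:E.
Proof.
move=> br bfp [c c1 dbl] [cX cX1 qb] lc p1 [cP [lam [cP0 lam1 PI]]] s0 dim emb u [mu_ unorm].
have nX0 := nX_ge0 qb; have lattice := nX_lattice qb.
have lam0 : 0 < lam by exact: lt_le_trans lam1.
have [uoo [g [ug goo]]] : (nX u < +oo)%E /\ exists g, upper_gradient u g /\ (nX g < +oo)%E.
  have inf0 : (0 <= ereal_inf [set nX g | g in upper_gradient u])%E.
    apply: le_ereal_inf_tmp => _ [g ug <-]; apply: nX0.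
    by apply: (borel_fun_measurable br); exact: upper_gradient_borel ug.
  split; first by apply: le_lt_trans unorm; rewrite /newtonian_norm leeDl.
  have : (ereal_inf [set nX g | g in upper_gradient u] < +oo)%E.
    by apply: le_lt_trans unorm; rewrite /newtonian_norm leeDr// nX0.
  by move=> /ereal_inf_lt[_ [g ug <-] goo]; exists g.
have growth := embedding_growth br bfp lattice p1 s0 dim emb.
have mg : measurable_fun setT g.
  by apply: (borel_fun_measurable br); exact: upper_gradient_borel ug.
have iu : integrable_on_balls mu u.
  by apply: (growth_integrable br bfp p1 mu_) => x0 r0; exact: growth.
have gS x0 : exists S : nat -> R, [/\ forall j, 0 <= S j,
    (\sum_(j <oo) (2^-1 ^+ j * S j)%:E < +oo)%E & forall y j, ball x0 1 y ->
      (average mu (ball y (lam * 2^-1 ^+ j)) (fun z => g z `^ p) `^ p^-1 <= (S j)%:E)%E].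
  (* The scale is the dilation constant of the Poincare inequality; as it is at least 1, centres in
     B(x0, 1) are admissible. *)
  have [S [S0 Soo HS]] := growth g mg goo x0 _ lam0.
  exists S; split => // y j y1; have := HS y j (le_ball lam1 y1).
  by have -> : (fun z => `|g z| `^ p)%E = (fun z => g z `^ p)%E
    by apply/funext => z; rewrite gee0_abs// (upper_gradient_ge0 ug).
pose O S j : R := 2 * cP * (2^-1 ^+ j * S j).
have oscP x0 S : (forall j, 0 <= S j) -> (\sum_(j <oo) (2^-1 ^+ j * S j)%:E < +oo)%E ->
    (forall y j, ball x0 1 y ->
      (average mu (ball y (lam * 2^-1 ^+ j)) (fun z => g z `^ p) `^ p^-1 <= (S j)%:E)%E) ->
    [/\ forall j, 0 <= O S j, (\sum_(j <oo) (O S j)%:E < +oo)%E &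
      forall y, ball x0 1 y -> oscillation_bound mu u (O S) y].
  move=> S0 Soo HS; split.
  - by move=> j; rewrite !mulr_ge0// ?exprn_ge0// ltW.
  - rewrite /O; under eq_eseriesr do rewrite EFinM.
    rewrite nneseriesZl; last by move=> j _; rewrite lee_fin mulr_ge0// exprn_ge0.
    by rewrite lte_mul_pinfty// lee_fin mulr_ge0// ltW.
  - move=> y y1; apply: (poincare_oscillation br bfp cP0 PI iu ug) => j; exact: HS.
pose f := dyadic_limit mu u.
have cf : continuous f.
  move=> x0; have [S [S0 Soo HS]] := gS x0.
  have [osc0 oscoo osc_u] := oscP x0 S S0 Soo HS.
  exact: (dyadic_limit_continuous br bfp c1 dbl iu osc0 oscoo osc_u).
exists f => // x0.
have [S [S0 Soo HS]] := gS x0.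
have [osc0 oscoo osc_u] := oscP x0 S S0 Soo HS.
have [N [mN N0 uf]] := dyadic_limit_ae br bfp c1 dbl iu osc0 oscoo osc_u dim cf.
have [[e [e0 eB]]|niso] := pselect (exists e : R, 0 < e /\ ball x0 e `<=` [set x0]).
  exact: (isolated_value br bfp mN N0 uf e0 eB).
have HS0 j := HS x0 j (ballxx x0 ltr01).
apply: (nonisolated_value br bfp c1 dbl p1 cP0 lam0 PI lc ug cf mN N0 uf S0 Soo HS0).
by move=> e e0 eB; apply: niso; exists e.
Qed.
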